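(* Let $T$ be a compact torus with Lie algebra $\mathfrak{t}$. If $(\Delta,\mathcal{F},s,k)$ is an admissible quadruple in $\mathfrak{t}^*$, then there exists a normalized monotone tall complexity one $T$-space $(M,\omega,\Phi)$ such that (1) $\Phi(M)=\Delta$ and the Duistermaat-Heckman function of $(M,\omega,\Phi)$ equals the abstract Duistermaat-Heckman function determined by $(\Delta,\mathcal{F},s,k)$, and (2) the Hamiltonian $T$-action extends to an effective Hamiltonian $(T\times S^1)$-action on $(M,\omega)$.
   Context: Let $T$ be a compact torus of dimension $d$ with Lie algebra $\mathfrak{t}$, integral lattice $\ell=\ker(\exp:\mathfrak{t}\to T)$ and dual lattice $\ell^*\subset\mathfrak{t}^*$. Polytopes are convex and full-dimensional. A polytope $\Delta\subset\mathfrak{t}^*$ is Delzant if at each vertex there are exactly $d$ incident edges and there is a basis $\alpha_1,\dots,\alpha_d$ of $\ell^*$ such that the $\alpha_i$ are tangent to these edges. It is reflexive if its vertices lie in $\ell^*$ and in its minimal (facet) representation $\Delta=\bigcap_i\{w\mid\langle w,\nu_i\rangle\geq c_i\}$ with inward normals $\nu_i$ primitive in $\ell$, one has $c_i=-1$ for all $i$. A quadruple $(\Delta,\mathcal{F},s,k)$ consisting of a polytope $\Delta$ in $\mathfrak{t}^*$, a facet $\mathcal{F}\subset\Delta$ and integers $s,k$ is admissible if: (i) $\Delta$ is a (full-dimensional) reflexive Delzant polytope in $\mathfrak{t}^*$; (ii) $\mathcal{F}$ is a facet of $\Delta$, supported on the affine hyperplane $\{w\in\mathfrak{t}^*\mid\langle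 w,\nu\rangle=-1\}$, where $\nu\in\ell$ is its primitive inward normal; (iii) $(s,k)\in\{(0,0),(-1,0),(-1,1),(-1,2)\}$; (iv) if there is a vertex of $\Delta$ on the linear hyperplane $\{w\mid\langle w,\nu\rangle=0\}$, then $k=0$; (v) if $k=2$, then there exists a facet $\mathcal{F}'$ of $\Delta$ supported on the hyperplane $\{w\mid\langle w,-\nu\rangle=-1\}$. The abstract Duistermaat-Heckman function determined by an admissible quadruple is $DH:\Delta\to\mathbb{R}$, $DH(w)=2-s\langle w,\nu\rangle-k\rho(w)$, where $\rho(w)=0$ if $\langle w,\nu\rangle\leq 0$ and $\rho(w)=\langle w,\nu\rangle$ if $\langle w,\nu\rangle\geq 0$. A compact Hamiltonian $T$-space $(M,\omega,\Phi)$ is a compact connected symplectic manifold $(M,\omega)$, $\dim M=2n$, with an effective $T$-action by symplectomorphisms and a smooth $T$-invariant moment map $\Phi:M\to\mathfrak{t}^*$ with $d\langle\Phi,\xi\rangle=-\iota_{\xi^\#}\omega$ for all $\xi\in\mathfrak{t}$, where $\xi^\#$ is the vector field generated by $t\mapsto\exp(t\xi)$. An action is Hamiltonian if it admits a moment map. It is a complexity one $T$-space if $n-d=1$; it is tall if no reduced space $\Phi^{-1}(x)/T$, $x\in\Phi(M)$, is a single point. Isotropy weights at $p\in M^T$: using a $T$-invariant compatible almost complex structure, $T_pM\cong\mathbb{C}^n$ with $\exp(\xi)\cdot z=(e^{2\pi i\langle\alpha_1,\xi\rangle}z_1,\dots,e^{2\pi i\langle\alpha_n,\xi\rangle}z_n)$,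 $\alpha_j\in\ell^*$. The space is normalized monotone if $c_1=[\omega]$ and $\Phi(p)=-\sum_{j=1}^n\alpha_j$ for every $p\in M^T$. Duistermaat-Heckman function: for a regular value $x\in\Phi(M)$ of $\Phi$, $M_x=\Phi^{-1}(x)/T$ is a two-dimensional symplectic orbifold with induced form $\omega_x$; $DH(M,\omega,\Phi):\Phi(M)\to\mathbb{R}$ is the unique continuous function with $DH(M,\omega,\Phi)(x)=\int_{M_x}\omega_x$ at all such $x$. *)

(* Defs.v *)
From HB Require Import structures.
From mathcomp Require Import all_boot all_order all_algebra.
From mathcomp Require Import all_classical all_reals all_analysis.
Set Implicit Arguments.
Unset Strict Implicit.
Unset Printing Implicit Defensive.
Import Order.TTheory GRing.Theory Num.Theory.
Import numFieldNormedType.Exports.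
Local Open Scope classical_set_scope.
Local Open Scope ring_scope.

(** * Lattices and polytopes

   A compact torus of dimension d is T = R^d / Z^d: its Lie algebra t and the
   dual t^* are both 'rV[R]_d, paired by [dot], exp : t -> T is the quotient
   map, and l = ker exp and l^* are both the set of integer vectors. *)

Section Polytopes.
Context {R : realType} {d : nat}.
Implicit Types (v w xi nu : 'rV[R]_d) (D F E : set 'rV[R]_d).

Definition dot v w : R := (v *m w^T) 0 0.

Definition integral v : Prop := forall i, v 0 i \is a Num.int.

(* The case n = 0 excludes nu = 0, up to which (nu = 2 *: 0) is excluded too. *)
Definition primitive nu : Prop :=
  integral nu /\
  forall (n : nat) mu, integral mu -> nu = n%:R *: mu -> n = 1%N.

Definition polytope D : Prop :=
  (exists (r : nat) (p : 'I_r -> 'rV[R]_d),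
     D = [set w | exists c : 'I_r -> R,
            [/\ forall i, 0 <= c i, \sum_i c i = 1 & w = \sum_i c i *: p i]]) /\
  interior D !=set0.

Definition supporting D F xi (c : R) : Prop :=
  (forall w, D w -> c <= dot w xi) /\ F = D `&` [set w | dot w xi = c].

Definition face D F : Prop := F !=set0 /\ exists xi c, supporting D F xi c.

(* The affine hull of A has dimension k: it is p + (row space of B). *)
Definition affine_dim (A : set 'rV[R]_d) (k : nat) : Prop :=
  exists p (B : 'M[R]_(k, d)),
    [/\ A p, row_free B, forall i, A (p + row i B)
      & forall w, A w -> (w - p <= B)%MS].

Definition vertex D v : Prop := face D [set v].
Definition edge D E : Prop := face D E /\ affine_dim E 1.
Definition facet D F : Prop :=
  face D F /\ exists2 k, d = k.+1 & affine_dim F k.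

(* The rows of an integer matrix are a basis of Z^d iff it is invertible over
   Z; here alpha_i is the i-th row of A. *)
Definition delzant D : Prop :=
  forall v, vertex D v ->
  exists (A : 'M[int]_d) (E : 'I_d -> set 'rV[R]_d),
    [/\ A \in unitmx, injective E,
        forall i, edge D (E i) /\ E i v,
        forall E', edge D E' -> E' v -> exists i, E' = E i
      & forall i w, E i w ->
          exists t : R, w - v = t *: row i (map_mx intr A)].

Definition reflexive_polytope D : Prop :=
  (forall v, vertex D v -> integral v) /\
  exists (r : nat) (nu : 'I_r -> 'rV[R]_d),
    [/\ forall i, primitive (nu i),
        D = [set w | forall i, -1 <= dot w (nu i)]
      & forall j, D <> [set w | forall i, i != j -> -1 <= dot w (nu i)]].

Definition admissible D F nu (s k : int) : Prop :=
  [/\ polytope D /\ (reflexive_polytope D /\ delzant D),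
      facet D F /\ (primitive nu /\ supporting D F nu (-1)),
      (s, k) \in [:: (0, 0); (-1, 0); (-1, 1); (-1, 2)],
      (exists2 v, vertex D v & dot v nu = 0) -> k = 0
    & k = 2 -> exists2 F', facet D F' & supporting D F' (- nu) (-1)].

Definition rho nu w : R := if dot w nu <= 0 then 0 else dot w nu.

Definition abstract_DH nu (s k : int) w : R :=
  2 - s%:~R * dot w nu - k%:~R * rho nu w.

End Polytopes.

(** * Smooth manifolds *)

(* f is C^n on the open set U *)
Fixpoint Ck {R : realType} {V W : normedModType R} (n : nat)
    (U : set V) (f : V -> W) : Prop :=
  if n is n'.+1 then
    (forall x, U x -> differentiable f x) /\
    (forall v : V, Ck n' U (fun x => 'd f x v))
  else forall x, U x -> {for x, continuous f}.

Definition smooth_on {R : realType} {V W : normedModType R}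
  (U : set V) (f : V -> W) : Prop := forall n, Ck n U f.

(* chart i : dom i -> R^m, with inverse par i; both are total functions whose
   values outside dom i and its image are irrelevant. *)
Record manifold (R : realType) (m : nat) := Manifold {
  carrier :> topologicalType;
  idx : Type;
  dom : idx -> set carrier;
  chart : idx -> carrier -> 'rV[R]_m;
  par : idx -> 'rV[R]_m -> carrier;
  _ : hausdorff_space carrier;
  _ : @second_countable carrier;
  _ : forall p, exists i, dom i p;
  _ : forall i, open (dom i);
  _ : forall i, open (chart i @` dom i);
  _ : forall i p, dom i p -> par i (chart i p) = p;
  _ : forall i p, dom i p -> {for p, continuous (chart i)};
  _ : forall i u, (chart i @` dom i) u -> {for u, continuous (par i)};
  _ : forall i j,
        smooth_on ((chart i @` dom i) `&` (par i @^-1` dom j))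
                  (chart j \o par i)
}.

Section Tensors.
Context {R : realType} {m : nat} (M : manifold R m).

Definition img (i : idx M) : set 'rV[R]_m := chart i @` dom i.

Definition smooth_fun {W : normedModType R} (f : M -> W) : Prop :=
  forall i, smooth_on (img i) (f \o par i).

Definition smooth_into {V : normedModType R} (U : set V) (f : V -> M) : Prop :=
  (forall x, U x -> {for x, continuous f}) /\
  forall j, smooth_on (U `&` (f @^-1` dom j)) (chart j \o f).

(* Tensor fields are families of local expressions, indexed by the charts. A
   tangent vector at p is, in the chart i, a row vector v at u = chart i p.
   [loc f i j] is a map f : M -> M read in the charts i and j, so that the
   change of charts is [loc id i j]. *)
Definition loc (f : M -> M) (i j : idx M) : 'rV[R]_m -> 'rV[R]_m :=
  chart j \o f \o par i.

Definition loc_dom (f : M -> M) (i j : idx M) (u : 'rV[R]_m) : Prop :=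
  img i u /\ dom j (f (par i u)).

Definition oneform := idx M -> 'rV[R]_m -> 'rV[R]_m.
Definition twoform := idx M -> 'rV[R]_m -> 'M[R]_m.
Definition endofield := idx M -> 'rV[R]_m -> 'M[R]_m.

Definition ev2 (A : 'M[R]_m) (v w : 'rV[R]_m) : R := dot (v *m A) w.

Definition is_oneform (b : oneform) : Prop :=
  (forall i, smooth_on (img i) (b i)) /\
  forall i j u, loc_dom id i j u -> forall v,
    dot (b i u) v = dot (b j (loc id i j u)) ('d (loc id i j) u v).

Definition d_oneform (b : oneform) i (u v w : 'rV[R]_m) : R :=
  dot ('d (b i) u v) w - dot ('d (b i) u w) v.

(* f^* omega = omega *)
Definition preserves_form (f : M -> M) (omega : twoform) : Prop :=
  forall i j u, loc_dom f i j u -> forall v w,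
    ev2 (omega i u) v w =
    ev2 (omega j (loc f i j u)) ('d (loc f i j) u v) ('d (loc f i j) u w).

Definition is_twoform (omega : twoform) : Prop :=
  [/\ forall i, smooth_on (img i) (omega i),
      forall i u, img i u -> (omega i u)^T = - omega i u
    & preserves_form id omega].

Definition closed_twoform (omega : twoform) : Prop :=
  forall i u, img i u -> forall v w z,
    ev2 ('d (omega i) u v) w z + ev2 ('d (omega i) u w) z v
      + ev2 ('d (omega i) u z) v w = 0.

Definition symplectic (omega : twoform) : Prop :=
  [/\ is_twoform omega, closed_twoform omega
    & forall i u, img i u -> omega i u \in unitmx].

(* df o J = J o df; the endomorphism J acts by v |-> v *m J i u *)
Definition preserves_endo (f : M -> M) (J : endofield) : Prop :=
  forall i j u, loc_dom f i j u -> forall v,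
    'd (loc f i j) u (v *m J i u) = 'd (loc f i j) u v *m J j (loc f i j u).

Definition almost_complex (J : endofield) : Prop :=
  [/\ forall i, smooth_on (img i) (J i),
      forall i u, img i u -> J i u *m J i u = - 1%:M
    & preserves_endo id J].

(* omega(_, J _) is a Riemannian metric *)
Definition compatible (omega : twoform) (J : endofield) : Prop :=
  forall i u, img i u ->
    (forall v, v != 0 -> 0 < ev2 (omega i u) v (v *m J i u)) /\
    (forall v w, ev2 (omega i u) (v *m J i u) (w *m J i u)
                 = ev2 (omega i u) v w).

(** ** First Chern class, by Chern-Weil theory *)

(* Christoffel symbols of a connection on TM: in the chart i,
   nabla_v s = 'd s u v + s u *m christoffel G i u v. *)
Definition connform := idx M -> 'rV[R]_m -> 'M[R]_(m, m * m).

Definition christoffel (G : connform) i (u v : 'rV[R]_m) : 'M[R]_m :=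
  vec_mx (v *m G i u).

Definition is_connection (G : connform) : Prop :=
  (forall i, smooth_on (img i) (G i)) /\
  forall i j u, loc_dom id i j u -> forall v s,
    let D := 'd (loc id i j) u in
    D (s *m christoffel G i u v) =
    'd (fun x => 'd (loc id i j) x s) u v
      + D s *m christoffel G j (loc id i j u) (D v).

(* nabla J = 0 *)
Definition complex_linear (G : connform) (J : endofield) : Prop :=
  forall i u, img i u -> forall v,
    'd (J i) u v + J i u *m christoffel G i u v
      - christoffel G i u v *m J i u = 0.

(* R(v, w) = nabla_v nabla_w - nabla_w nabla_v, acting on row vectors on the
   right, for v, w constant in the chart. *)
Definition curvature (G : connform) i (u v w : 'rV[R]_m) : 'M[R]_m :=
  'd (fun x => christoffel G i x w) u v - 'd (fun x => christoffel G i x v) u w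
    + christoffel G i u w *m christoffel G i u v
    - christoffel G i u v *m christoffel G i u w.

(* The real part of (i / 2 pi) tr_C R(v, w), since
   tr_C A = (tr_R A - i tr_R (J A)) / 2 for a J-linear A. Its imaginary part is
   the exact form (i / 4 pi) tr_R R, so this form represents c_1(TM, J). *)
Definition chern_form (G : connform) (J : endofield) i (u v w : 'rV[R]_m) : R :=
  (4 * pi)^-1 * \tr (curvature G i u v w *m J i u).

(* c_1(M) = [omega] in H^2(M; R); c_1 depends neither on the compatible J nor
   on the connection. *)
Definition c1_eq (omega : twoform) : Prop :=
  exists (J : endofield) (G : connform) (b : oneform),
    [/\ almost_complex J /\ compatible omega J,
        is_connection G, complex_linear G J, is_oneform b
      & forall i u, img i u -> forall v w,
          ev2 (omega i u) v w - chern_form G J i u v w = d_oneform b i u v w].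

End Tensors.

(** * Hamiltonian torus actions

   An action of T = R^d / Z^d is an action a of R^d, a xi being the action of
   exp xi, that is trivial on Z^d. *)

Section Hamiltonian.
Context {R : realType} {m : nat} {M : manifold R m} {d : nat}.
Implicit Types (omega : twoform M) (a : 'rV[R]_d -> M -> M)
  (Phi : M -> 'rV[R]_d) (p : M) (x xi : 'rV[R]_d).

Definition torus_action a : Prop :=
  [/\ forall xi p, integral xi -> a xi p = p,
      forall xi eta p, a (xi + eta) p = a xi (a eta p),
      continuous (fun z : 'rV[R]_d * M => a z.1 z.2)
    & forall i, smooth_into (setT `*` img i)
        (fun z : 'rV[R]_d * 'rV[R]_m => a z.1 (par i z.2))].

Definition effective a : Prop :=
  forall xi, (forall p, a xi p = p) -> integral xi.

Definition fundamental_field a xi i (u : 'rV[R]_m) : 'rV[R]_m :=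
  derive1 (fun t : R => chart i (a (t *: xi) (par i u))) 0.

Definition moment_map omega a Phi : Prop :=
  [/\ smooth_fun Phi, forall xi p, Phi (a xi p) = Phi p
    & forall xi i u, img i u -> forall v,
        dot ('d (Phi \o par i) u v) xi
        = - ev2 (omega i u) (fundamental_field a xi i u) v].

Definition hamiltonian_action omega a Phi : Prop :=
  [/\ torus_action a, effective a, forall xi, preserves_form (a xi) omega
    & moment_map omega a Phi].

Definition compact_hamiltonian_space omega a Phi : Prop :=
  [/\ compact [set: M], connected [set: M], symplectic omega
    & hamiltonian_action omega a Phi].

(* no reduced space is a single T-orbit *)
Definition tall a Phi : Prop :=
  forall p, exists q, Phi q = Phi p /\ ~ exists xi, q = a xi p.

Definition regular_value Phi x : Prop :=
  forall i u, img i u -> Phi (par i u) = x ->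
    forall y, exists v, 'd (Phi \o par i) u v = y.

(* sigma^* omega = h ds /\ dt on U, where (s, t) are the coordinates of R^2 *)
Definition pulls_back_to omega (U : set (R * R)) (sigma : R * R -> M)
    (h : R * R -> R) : Prop :=
  forall z j, U z -> dom j (sigma z) ->
    h z = ev2 (omega j (chart j (sigma z)))
            ('d (chart j \o sigma) z (1, 0)) ('d (chart j \o sigma) z (0, 1)).

(* c is the integral of omega_x over the 2-dimensional orbifold
   M_x = Phi^-1(x) / T. The reduced form is determined by
   pi^* omega_x = omega | Phi^-1(x), where pi : Phi^-1(x) -> M_x. The condition
   h > 0 says that sigma n parametrizes a slice transverse to the orbits,
   compatibly with the symplectic orientation, so that pi o sigma n is an
   oriented (uniformizing) orbifold chart in which omega_x is h ds /\ dt. Such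
   charts are integrated over measurable sets A n on which pi o sigma n is
   injective and whose images under pi form a partition of M_x. *)
Definition reduced_integral omega a Phi x (c : \bar R) : Prop :=
  exists (U A : nat -> set (R * R)) (sigma : nat -> R * R -> M)
    (h : nat -> R * R -> R),
  [/\ forall n, [/\ open (U n), measurable (A n) & A n `<=` U n],
      forall n, [/\ smooth_into (U n) (sigma n),
                    forall z, U n z -> Phi (sigma n z) = x,
                    pulls_back_to omega (U n) (sigma n) (h n)
                  & forall z, U n z -> 0 < h n z],
      forall n n' z z' xi, A n z -> A n' z' ->
        a xi (sigma n z) = sigma n' z' -> n = n' /\ z = z',
      forall p, Phi p = x ->
        exists n z xi, A n z /\ a xi (sigma n z) = p
    & c = (\sum_(0 <= n <oo)
             \int[lebesgue_measure \x lebesgue_measure]_(z in A n)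
               (h n z)%:E)%E].

(* meaningful when dim M = 2 (d + 1) *)
Definition is_DH_function omega a Phi (f : 'rV[R]_d -> R) : Prop :=
  {within range Phi, continuous f} /\
  forall x, range Phi x -> regular_value Phi x ->
    reduced_integral omega a Phi x (f x)%:E.

End Hamiltonian.

Section Monotone.
Context {R : realType} {n : nat} {M : manifold R (n + n)} {d : nat}.
Implicit Types (omega : twoform M) (a : 'rV[R]_d -> M -> M)
  (Phi : M -> 'rV[R]_d) (p : M).

(* v |-> z = v *m X + i (v *m Y) is a J-linear isomorphism T_p M -> C^n that
   turns the isotropy representation into the one with weights alpha. *)
Definition isotropy_weights omega a p (alpha : 'I_n -> 'rV[R]_d) : Prop :=
  (forall j, integral (alpha j)) /\
  exists J : endofield M,
  [/\ almost_complex J, compatible omega J,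
      forall xi, preserves_endo (a xi) J
    & exists i (X Y : 'M[R]_(n + n, n)),
      let u := chart i p in
      [/\ dom i p, row_mx X Y \in unitmx,
          J i u *m X = - Y /\ J i u *m Y = X
        & forall xi v j,
          let gv := 'd (loc (a xi) i i) u v in
          let theta := 2 * pi * dot (alpha j) xi in
          (gv *m X) 0 j = cos theta * (v *m X) 0 j - sin theta * (v *m Y) 0 j /\
          (gv *m Y) 0 j =
            sin theta * (v *m X) 0 j + cos theta * (v *m Y) 0 j]].

(* the weights at p are unique up to order *)
Definition normalized_monotone omega a Phi : Prop :=
  c1_eq omega /\
  forall p, (forall xi, a xi p = p) ->
    exists2 alpha, isotropy_weights omega a p alpha
                 & Phi p = - \sum_j alpha j.

End Monotone.

(* Main.v *)
Require Import Defs.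
From HB Require Import structures.
From mathcomp Require Import all_boot all_order all_algebra.
From mathcomp Require Import all_classical all_reals all_analysis.
Set Implicit Arguments.
Unset Strict Implicit.
Unset Printing Implicit Defensive.
Import Order.TTheory GRing.Theory Num.Theory.
Import numFieldNormedType.Exports.
From mathcomp Require Import complex ring lra zify.
Local Open Scope classical_set_scope.
Local Open Scope ring_scope.
Local Open Scope complex_scope.

(** The space is a toric manifold with a smaller torus. Over Delta put the polytope
    of all (w, y) that lie below the top lids y <= 1 + <w, m> and above the bottom
    lids y >= <w, m> - 1, where the slopes m of the lids are 0 or nu, chosen from
    (s, k) such that the length of the fibre over w is the abstract
    Duistermaat-Heckman function. Two lids on the same side only meet over the
    hyperplane <w, nu> = 0; by (iv) Delta has no vertex there, so the face of w
    has a vertex on F, and near it the thickened polytope is again smooth.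

    For a polytope {x | 1 + <x, nu_i> >= 0} with unimodular vertices, the manifold
    is the image in a Euclidean space of the pairs (x, th) under x and the monomials
    prod_i (1 + <x, nu_i>)^(|<alpha, nu_i>| / 2) e^(2 pi i <alpha, th>), where alpha
    ranges over the dual bases of the vertices. Delzant's coordinates z_k are charts
    in which omega = (1/pi) sum_k dx_k /\ dy_k. On the open orbit, the frame made of
    the angular fields and their images under Guillemin's complex structure J
    changes by constant matrices between the charts, so the connection form in
    this frame has a globally defined trace against J, which gives a primitive of
    omega - c_1. The reduced space over a regular value is the interval of the
    fibre times a circle, with its two ends collapsed, so its area is the length of
    the fibre. *)

(** * Smooth functions *)

Section Differentials.
Context {R : realType}.
Implicit Types (V W X : normedModType R).

(** Monotonicity comes from the constant 1 in every facet inequality. Near the facet z_k = 0 the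
    trace in the frame contributes the singular form 2 d(arg z_k), and twice the pairing of x with
    the angles contributes 2 (|z_k|^2 - 1) d(arg z_k); the sum is smooth exactly because the facet
    has constant 1. The same constant makes the moment map minus the sum of the weights at a fixed
    point. So the lids need the constant 1 as well, and only their slopes are free. Condition (v)
    bounds <w, nu> by 1 when k = 2, which keeps opposite lids apart. Working inside a Euclidean
    space gives the topology without quotients and a global connection without partitions of unity:
    second derivatives are projected to the tangent spaces and then averaged with J. The frames
    degenerate over the facets, so identities are proved where all z_k are nonzero and extended by
    continuity. This requires expressions without poles on the whole chart, and it dictates the form
    in which J and the primitive are written. *)

Lemma near_eq_is_diff V W (f g : V -> W) (df : V -> W) (x : V) :
  (\forall y \near x, f y = g y) -> is_diff x f df -> is_diff x g df.
Proof.
move=> fg dfP; have dfx : differentiable f x by exact: ex_diff.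
have fgx : f x = g x by exact: (nbhs_singleton fg).
have gE : g \o shift x = cst (g x) + 'd f x +o_ 0 id.
  apply/eqaddoP => e e0; near=> h.
  have -> : (g \o shift x - (cst (g x) + 'd f x)) h =
            (f \o shift x - (cst (f x) + 'd f x)) h.
    rewrite !fctE /= fgx; congr (_ - _); apply/esym.
    near: h; have := fg; rewrite (near_shift 0) /= => H.
    by apply: filterS H => h /=; rewrite subr0 .
  near: h; have /diff_locally/eqaddoP := dfx; exact.
have dE : 'd g x = 'd f x :> (V -> W).
  by apply: diff_unique gE; apply: diff_continuous.
have dg : differentiable g x.
  by apply/diff_locallyP; rewrite dE; split => //; apply: diff_continuous.
by apply: DiffDef => //; rewrite dE diff_val.
Unshelve. all: by end_near. Qed.

Lemma is_diffE V W (f df : V -> W) x v : is_diff x f df -> 'd f x v = df v.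
Proof. by case=> _ <-. Qed.

Lemma near_eq_differentiable V W (f g : V -> W) (x : V) :
  (\forall y \near x, f y = g y) -> differentiable f x -> differentiable g x.
Proof. by move=> fg /differentiableP /(near_eq_is_diff fg) []. Qed.

Lemma near_eq_diff V W (f g : V -> W) (x : V) :
  (\forall y \near x, f y = g y) -> differentiable f x ->
  'd g x = 'd f x :> (V -> W).
Proof. by move=> fg /differentiableP /(near_eq_is_diff fg) []. Qed.

Lemma open_near V (U : set V) x (P : V -> Prop) :
  open U -> U x -> (forall y, U y -> P y) -> \forall y \near x, P y.
Proof. by move=> oU Ux UP; apply: filterS UP _; apply: open_nbhs_nbhs. Qed.

Lemma Ck_ext n V W (U : set V) (f g : V -> W) :
  open U -> (forall x, U x -> f x = g x) -> Ck n U f -> Ck n U g.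
Proof.
elim: n f g => [|n IHn] f g oU fg /=.
  move=> cf x Ux; have fgx : f x = g x by exact: fg.
  rewrite /prop_for /continuous_at -fgx; apply: cvg_trans (cf x Ux).
  by apply: near_eq_cvg; exact: open_near fg.
move=> [df ckf]; have near_fg x : U x -> \forall y \near x, f y = g y.
  by move=> Ux; exact: open_near fg.
split=> [x Ux|v].
  exact: near_eq_differentiable (near_fg x Ux) (df x Ux).
apply: (IHn _ _ oU _ (ckf v)) => x Ux.
by rewrite (near_eq_diff (near_fg x Ux)) //; exact: df.
Qed.

Lemma Ck_sub n V W (U U' : set V) (f : V -> W) :
  U' `<=` U -> Ck n U f -> Ck n U' f.
Proof.
elim: n f => [|n IHn] f sU /=; first by move=> cf x /sU/cf.
by move=> [df ckf]; split=> [x /sU/df//|v]; apply: IHn (ckf v).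
Qed.

Lemma smooth_sub V W (U U' : set V) (f : V -> W) :
  U' `<=` U -> smooth_on U f -> smooth_on U' f.
Proof. by move=> sU sf n; apply: Ck_sub sU (sf n). Qed.

Lemma smooth_ext V W (U : set V) (f g : V -> W) :
  open U -> (forall x, U x -> f x = g x) -> smooth_on U f -> smooth_on U g.
Proof. by move=> oU fg sf n; apply: Ck_ext (sf n). Qed.

Lemma smooth_differentiable V W (U : set V) (f : V -> W) x :
  smooth_on U f -> U x -> differentiable f x.
Proof. by move=> sf Ux; have [+ _] := sf 1%N; apply. Qed.

Lemma smooth_continuous V W (U : set V) (f : V -> W) x :
  smooth_on U f -> U x -> {for x, continuous f}.
Proof. by move=> sf Ux; exact: (sf 0%N). Qed.

Lemma smooth_diff V W (U : set V) (f : V -> W) v :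
  smooth_on U f -> smooth_on U (fun x => 'd f x v).
Proof. by move=> sf n; have [_] := sf n.+1; apply. Qed.

Lemma Ck_cst n V W (U : set V) (w : W) : Ck n U (cst w : V -> W).
Proof.
elim: n w => [|n IHn] w /=; first by move=> x _; exact: cst_continuous.
split=> [//|v]; rewrite (_ : (fun _ => _) = cst 0) //.
by apply/funext => x; rewrite diff_cst.
Qed.

Lemma smooth_cst V W (U : set V) (w : W) : smooth_on U (fun _ : V => w).
Proof. by move=> n; exact: Ck_cst. Qed.

Lemma Ck_lin n V W X (U : set V) (f : V -> W) (L : {linear W -> X}) :
  open U -> continuous L -> Ck n U f -> Ck n U (L \o f).
Proof.
move=> oU cL; elim: n f => [|n IHn] f /=.
  by move=> cf x Ux; apply: continuous_comp; [exact: cf|exact: cL].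
move=> [df ckf]; have dL y : differentiable L y by exact: linear_differentiable.
split=> [x Ux|v]; first exact: differentiable_comp (df x Ux) (dL _).
apply: Ck_ext (IHn _ (ckf v)) => // x Ux /=.
by rewrite (diff_comp (df x Ux) (dL _)) /= diff_lin.
Qed.

Lemma smooth_lin V W X (U : set V) (f : V -> W) (L : {linear W -> X}) :
  open U -> continuous L -> smooth_on U f -> smooth_on U (L \o f).
Proof. by move=> oU cL sf n; apply: Ck_lin. Qed.

Lemma smooth_id V (U : set V) : smooth_on U (id : V -> V).
Proof.
case=> [|n] /=; first by move=> x _; exact: cvg_id.
split=> [//|v]; rewrite (_ : (fun _ => _) = cst v); first exact: Ck_cst.
by apply/funext => x; rewrite diff_val.
Qed.

Lemma Ck_add n V W (U : set V) (f g : V -> W) :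
  open U -> Ck n U f -> Ck n U g -> Ck n U (fun x => f x + g x).
Proof.
move=> oU; elim: n f g => [|n IHn] f g /=.
  by move=> cf cg x Ux; apply: cvgD; [exact: cf|exact: cg].
move=> [df ckf] [dg ckg]; split=> [x Ux|v].
  by apply: differentiableD; [exact: df|exact: dg].
apply: Ck_ext (IHn _ _ (ckf v) (ckg v)) => // x Ux.
by rewrite [in RHS]diffD //; [exact: df|exact: dg].
Qed.

Lemma smoothD V W (U : set V) (f g : V -> W) :
  open U -> smooth_on U f -> smooth_on U g -> smooth_on U (fun x => f x + g x).
Proof. by move=> oU sf sg n; apply: Ck_add. Qed.

Lemma smooth_sum V W (U : set V) (I : Type) (r : seq I) (P : pred I)
    (f : I -> V -> W) :
  open U -> (forall i, P i -> smooth_on U (f i)) ->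
  smooth_on U (fun x => \sum_(i <- r | P i) f i x).
Proof.
move=> oU sf; elim: r => [|i r IHr].
  by under [X in smooth_on _ X]funext do rewrite big_nil; exact: smooth_cst.
under [X in smooth_on _ X]funext do rewrite big_cons.
by case Pi : (P i) => //; apply: smoothD => //; exact: sf.
Qed.

Lemma smooth_coord V p q (U : set V) (f : V -> 'M[R]_(p, q)) i j :
  open U -> smooth_on U f -> smooth_on U (fun x => f x i j).
Proof.
move=> oU sf.
have @L : {linear 'M[R]_(p, q) -> R}.
  by exists (fun N : 'M[R]_(_, _) => N i j); do 2![eexists]; do ?[constructor];
     rewrite ?mxE// => ? *; rewrite ?mxE//; move=> ?; rewrite !mxE.
have cL : continuous L by exact: coord_continuous.
exact: (smooth_lin oU cL sf).
Qed.

Lemma smoothZl V W (U : set V) (f : V -> R) (w : W) :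
  open U -> smooth_on U f -> smooth_on U (fun x => f x *: w).
Proof.
move=> oU sf; have lin : linear (fun k : R => k *: w).
  by move=> a u v; rewrite scalerDl scalerA.
pose LM := GRing.isLinear.Build _ _ _ _ _ lin.
pose L : {linear R -> W} := HB.pack (fun k : R => k *: w) LM.
have cL : continuous L by exact: scalel_continuous.
exact: (smooth_lin oU cL sf).
Qed.

Lemma smooth_mx V p q (U : set V) (f : V -> 'M[R]_(p, q)) :
  open U -> (forall i j, smooth_on U (fun x => f x i j)) -> smooth_on U f.
Proof.
move=> oU sf; apply: (@smooth_ext _ _ _
  (fun x => \sum_i \sum_j f x i j *: delta_mx i j)) => // [x _|].
  by rewrite [RHS]matrix_sum_delta.
by apply: smooth_sum => // i _; apply: smooth_sum => // j _; exact: smoothZl.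
Qed.

Lemma Ck_mono n V W (U : set V) (f : V -> W) : Ck n.+1 U f -> Ck n U f.
Proof.
elim: n f => [|n IHn] f [df ckf].
  by move=> x Ux; exact: differentiable_continuous (df x Ux).
by split=> // v; exact: IHn.
Qed.

Lemma CkM n V (U : set V) (f g : V -> R) :
  open U -> Ck n U f -> Ck n U g -> Ck n U (fun x => f x * g x).
Proof.
move=> oU; elim: n f g => [|n IHn] f g.
  by move=> cf cg x Ux; apply: cvgM; [exact: cf|exact: cg].
move=> ckf ckg; have [df ckdf] := ckf; have [dg ckdg] := ckg.
split=> [x Ux|v]; first by apply: differentiableM; [exact: df|exact: dg].
have h1 := IHn _ _ (Ck_mono ckf) (ckdg v).
have h2 := IHn _ _ (Ck_mono ckg) (ckdf v).
apply: Ck_ext (Ck_add oU h1 h2) => // x Ux /=.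
by rewrite [in RHS](diffM (df x Ux) (dg x Ux)).
Qed.

Lemma smoothM V (U : set V) (f g : V -> R) :
  open U -> smooth_on U f -> smooth_on U g -> smooth_on U (fun x => f x * g x).
Proof.
by move=> oU sf sg n; exact: CkM. 
Qed.

Lemma Ck_sum n V W (U : set V) (I : Type) (r : seq I) (f : I -> V -> W) :
  open U -> (forall i, Ck n U (f i)) -> Ck n U (fun x => \sum_(i <- r) f i x).
Proof.
move=> oU sf; elim: r => [|i r IHr].
  by under [X in Ck _ _ X]funext do rewrite big_nil; exact: Ck_cst.
by under [X in Ck _ _ X]funext do rewrite big_cons; exact: Ck_add.
Qed.

Lemma smooth_prod V (U : set V) (I : Type) (r : seq I) (P : pred I)
    (f : I -> V -> R) :
  open U -> (forall i, P i -> smooth_on U (f i)) ->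
  smooth_on U (fun x => \prod_(i <- r | P i) f i x).
Proof.
move=> oU sf; elim: r => [|i r IHr].
  by under [X in smooth_on _ X]funext do rewrite big_nil; exact: smooth_cst.
under [X in smooth_on _ X]funext do rewrite big_cons.
by case Pi : (P i) => //; apply: smoothM => //; exact: sf.
Qed.

Lemma smoothN V W (U : set V) (f : V -> W) :
  open U -> smooth_on U f -> smooth_on U (fun x => - f x).
Proof.
move=> oU sf; pose L : {linear W -> W} := -%R.
by apply: (smooth_lin (L := L)) => //; exact: opp_continuous.
Qed.

Lemma smoothB V W (U : set V) (f g : V -> W) :
  open U -> smooth_on U f -> smooth_on U g -> smooth_on U (fun x => f x - g x).
Proof. by move=> oU sf sg; apply: smoothD => //; exact: smoothN. Qed.

Lemma smoothX V (U : set V) (f : V -> R) n :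
  open U -> smooth_on U f -> smooth_on U (fun x => f x ^+ n).
Proof.
move=> oU sf; elim: n => [|n IHn].
  by under [X in smooth_on _ X]funext do rewrite expr0; exact: smooth_cst.
by under [X in smooth_on _ X]funext do rewrite exprS; exact: smoothM.
Qed.

(** The induction closes because the derivative of 1 / f is a product of two copies of 1 / f,
    covered by the induction hypothesis, with - df. *)
Lemma smoothV V (U : set V) (f : V -> R) :
  open U -> (forall x, U x -> f x != 0) -> smooth_on U f ->
  smooth_on U (fun x => (f x)^-1).
Proof.
move=> oU f0 sf n; have df x : U x -> differentiable f x.
  exact: smooth_differentiable.
have dV x : U x -> differentiable (fun y => (f y)^-1) x.
  by move=> Ux; apply: differentiableV; [exact: df|exact: f0].
elim: n => [|n IHn]; first by move=> x Ux; apply: differentiable_continuous; exact: dV.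
split=> [//|v]; have ckN := smoothN oU (smooth_diff v sf) n.
apply: Ck_ext (CkM oU (CkM oU IHn IHn) ckN) => // x Ux /=.
apply/esym/(etrans (congr1 (fun h : V -> R => h v) (diffV (df x Ux) (f0 x Ux)))).
by rewrite /= /GRing.scale /= expr2 invfM mulNr mulrN.
Qed.

Lemma diff_comp1 V (phi : R -> R) (dphi : R) (f : V -> R) x :
  differentiable f x -> is_derive (f x) 1 phi dphi ->
  is_diff x (phi \o f) (fun v => dphi * 'd f x v).
Proof.
move=> df [dphix phiE]; have dphix' : differentiable phi (f x).
  exact/derivable1_diffP.
apply: DiffDef; first exact: differentiable_comp.
rewrite diff_comp // (deriv1E dphix); apply/funext => v /=.
by rewrite -phiE derive1E mulrC.
Qed.

Lemma smooth_sqrt V (U : set V) (f : V -> R) :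
  open U -> (forall x, U x -> 0 < f x) -> smooth_on U f ->
  smooth_on U (fun x => Num.sqrt (f x)).
Proof.
move=> oU f0 sf n; have df x : U x -> differentiable f x.
  exact: smooth_differentiable.
have dS x : U x -> is_diff x (fun y => Num.sqrt (f y))
    (fun v => (2 * Num.sqrt (f x))^-1 * 'd f x v).
  by move=> Ux; apply: diff_comp1; [exact: df|apply: is_derive1_sqrt; exact: f0].
elim: n => [|n IHn].
  by move=> x Ux; have := dS x Ux => ?; exact: differentiable_continuous.
split=> [x /dS ?//|v].
(* The derivative is written as [sqrt f] times a smooth function, so that the induction hypothesis
   on [sqrt f] applies again. *)
have fV : smooth_on U (fun x => 2^-1 * (f x)^-1 * 'd f x v).
  apply: smoothM => //; last exact: smooth_diff.
  apply: smoothM => //; first exact: smooth_cst.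
  by apply: smoothV => // x /f0; rewrite lt0r => /andP[].
apply: Ck_ext (CkM oU IHn (fV n)) => // x Ux /=.
apply/esym/(etrans (is_diffE v (dS x Ux))); apply/esym; have fx0 := f0 x Ux.
rewrite mulrA; congr (_ * _); rewrite invfM mulrCA; congr (_ * _).
have sq0 : Num.sqrt (f x) != 0 by rewrite gt_eqF // sqrtr_gt0.
apply: (mulfI sq0); rewrite mulrA -expr2 sqr_sqrtr ?ltW //.
by rewrite !divff // gt_eqF.
Qed.

Lemma smooth_cos_sin V (U : set V) (f : V -> R) :
  open U -> smooth_on U f ->
  smooth_on U (fun x => cos (f x)) /\ smooth_on U (fun x => sin (f x)).
Proof.
move=> oU sf; have df x : U x -> differentiable f x.
  exact: smooth_differentiable.
have dc x : U x -> is_diff x (fun y => cos (f y)) (fun v => - sin (f x) * 'd f x v).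
  by move=> Ux; apply: diff_comp1; exact: df.
have ds x : U x -> is_diff x (fun y => sin (f y)) (fun v => cos (f x) * 'd f x v).
  by move=> Ux; apply: diff_comp1; exact: df.
(* Each function is, up to sign, a factor of the derivative of the other, so their orders are raised
   together. *)
suff H n : Ck n U (fun x => cos (f x)) /\ Ck n U (fun x => sin (f x)).
  by split=> n; have [] := H n.
elim: n => [|n [IHc IHs]].
  by split=> x Ux; [have := dc x Ux|have := ds x Ux] => ?;
    exact: differentiable_continuous.
split; split.
- by move=> x /dc.
- move=> v; have IHs' : Ck n U (fun x => - sin (f x)).
    by apply: (Ck_lin (L := -%R)) => //; exact: opp_continuous.
  apply: Ck_ext (CkM oU IHs' (smooth_diff v sf n)) => // x Ux /=.
  by rewrite (is_diffE v (dc x Ux)).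
- by move=> x /ds.
- move=> v.
  apply: Ck_ext (CkM oU IHc (smooth_diff v sf n)) => // x Ux /=.
  by rewrite (is_diffE v (ds x Ux)).
Qed.

(** ['d g (f x)] is applied to a vector that itself varies with x. Expanding that vector in
    coordinates leaves a sum of products of scalar functions, with partial derivatives of g composed
    with f, to which the induction on the order applies. *)
Lemma smooth_comp n V (f : V -> 'rV[R]_n) (g : 'rV[R]_n -> R)
    (U : set V) (U' : set 'rV[R]_n) :
  open U -> (forall x, U x -> U' (f x)) ->
  smooth_on U f -> smooth_on U' g -> smooth_on U (g \o f).
Proof.
move=> oU UU' sf sg k.
elim: k g sg => [|k IHk] g sg /=.
  by move=> x Ux; apply: continuous_comp;
    [exact: smooth_continuous Ux|exact: smooth_continuous (UU' _ Ux)].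
have df x : U x -> differentiable f x by exact: smooth_differentiable.
have dg x : U x -> differentiable g (f x).
  by move=> /UU'; exact: smooth_differentiable.
split=> [x Ux|v]; first exact: differentiable_comp (df x Ux) (dg x Ux).
pose h j x := 'd f x v 0 j * 'd g (f x) (delta_mx 0 j).
apply: (@Ck_ext k _ _ _ (fun x => \sum_j h j x)) => // [x Ux|].
  rewrite (diff_comp (df x Ux) (dg x Ux)) /= [in RHS](row_sum_delta ('d f x v)).
  by rewrite linear_sum; apply: eq_bigr => j _; rewrite linearZ.
apply: Ck_sum => // j; apply: CkM => //.
  exact: (smooth_coord 0 j oU (smooth_diff v sf) k).
exact: (IHk (fun y => 'd g y (delta_mx 0 j)) (smooth_diff _ sg)).
Qed.

Lemma smooth_comp_mx n p q V (f : V -> 'rV[R]_n) (g : 'rV[R]_n -> 'M[R]_(p, q))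
    (U : set V) (U' : set 'rV[R]_n) :
  open U -> open U' -> (forall x, U x -> U' (f x)) ->
  smooth_on U f -> smooth_on U' g -> smooth_on U (g \o f).
Proof.
move=> oU oU' UU' sf sg; apply: smooth_mx => // i j.
by apply: (@smooth_comp _ _ f (fun y => g y i j) U U') => //; exact: smooth_coord.
Qed.

Lemma smooth_mulmx V p q r (U : set V) (f : V -> 'M[R]_(p, q))
    (g : V -> 'M[R]_(q, r)) :
  open U -> smooth_on U f -> smooth_on U g -> smooth_on U (fun x => f x *m g x).
Proof.
move=> oU sf sg; apply: smooth_mx => // i j.
under [X in smooth_on _ X]funext do rewrite mxE.
by apply: smooth_sum => // k _; apply: smoothM => //; exact: smooth_coord.
Qed.

Lemma smooth_trmx V p q (U : set V) (f : V -> 'M[R]_(p, q)) :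
  open U -> smooth_on U f -> smooth_on U (fun x => (f x)^T).
Proof.
move=> oU sf; apply: smooth_mx => // i j.
by under [X in smooth_on _ X]funext do rewrite mxE; exact: smooth_coord.
Qed.

Lemma smooth_scalemx V p q (U : set V) (a : V -> R) (f : V -> 'M[R]_(p, q)) :
  open U -> smooth_on U a -> smooth_on U f -> smooth_on U (fun x => a x *: f x).
Proof.
move=> oU sa sf; apply: smooth_mx => // i j.
under [X in smooth_on _ X]funext do rewrite mxE.
by apply: smoothM => //; exact: smooth_coord.
Qed.

Lemma smooth_det V p (U : set V) (f : V -> 'M[R]_p) :
  open U -> smooth_on U f -> smooth_on U (fun x => \det (f x)).
Proof.
move=> oU sf; apply: smooth_sum => // s _.
apply: smoothM => //; first exact: smooth_cst.
by apply: smooth_prod => // i _; exact: smooth_coord.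
Qed.

Lemma smooth_invmx V p (U : set V) (f : V -> 'M[R]_p) :
  open U -> (forall x, U x -> f x \in unitmx) -> smooth_on U f ->
  smooth_on U (fun x => invmx (f x)).
Proof.
move=> oU fu sf.
apply: (@smooth_ext _ _ _ (fun x => (\det (f x))^-1 *: \adj (f x))) => // [x Ux|].
  by rewrite /invmx fu.
apply: smooth_scalemx => //.
  apply: smoothV => // [x /fu|]; first by rewrite unitmxE unitfE.
  exact: smooth_det.
apply: smooth_mx => // i j; under [X in smooth_on _ X]funext do rewrite mxE.
apply: smoothM => //; first exact: smooth_cst.
apply: smooth_det => //; apply: smooth_mx => // k l.
by under [X in smooth_on _ X]funext do rewrite !mxE; exact: smooth_coord.
Qed.

Lemma smooth_mxtrace V p (U : set V) (f : V -> 'M[R]_p) :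
  open U -> smooth_on U f -> smooth_on U (fun x => \tr (f x)).
Proof. by move=> oU sf; apply: smooth_sum => // i _; exact: smooth_coord. Qed.

Lemma smooth_fst V W X (U : set V) (f : V -> (W * X)%type) :
  open U -> smooth_on U f -> smooth_on U (fun v => (f v).1).
Proof.
move=> oU sf; pose L : {linear (W * X)%type -> W} := fst.
by apply: (smooth_lin (L := L)) => // z; exact: cvg_fst.
Qed.

Lemma smooth_snd V W X (U : set V) (f : V -> (W * X)%type) :
  open U -> smooth_on U f -> smooth_on U (fun v => (f v).2).
Proof.
move=> oU sf; pose L : {linear (W * X)%type -> X} := snd.
by apply: (smooth_lin (L := L)) => // z; exact: cvg_snd.
Qed.

Lemma diff_linE V W X (f : V -> W) (L : {linear W -> X}) x v :
  continuous L -> differentiable f x -> 'd (L \o f) x v = L ('d f x v).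
Proof.
move=> cL df; have dL y : differentiable L y by exact: linear_differentiable.
by rewrite (diff_comp df (dL _)) /= diff_lin.
Qed.

Lemma diff_mxE V p q (f : V -> 'M[R]_(p, q)) x v i j :
  differentiable f x -> 'd f x v i j = 'd (fun y => f y i j) x v.
Proof.
move=> df.
have @L : {linear 'M[R]_(p, q) -> R}.
  by exists (fun N : 'M[R]_(_, _) => N i j); do 2![eexists]; do ?[constructor];
     rewrite ?mxE// => ? *; rewrite ?mxE//; move=> ?; rewrite !mxE.
have cL : continuous L by exact: coord_continuous.
exact: (esym (diff_linE v cL df)).
Qed.

Lemma differentiable_mx V p q (f : V -> 'M[R]_(p, q)) x :
  (forall i j, differentiable (fun y => f y i j) x) -> differentiable f x.
Proof.
move=> df.
rewrite (_ : f = \sum_i \sum_j (fun y => f y i j *: delta_mx i j)).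
  by apply: differentiable_sum => i; apply: differentiable_sum => j;
     apply: differentiableZl.
apply/funext => y; rewrite fct_sumE [LHS]matrix_sum_delta; apply: eq_bigr => i _.
by rewrite fct_sumE.
Qed.

Lemma is_diff_mx V p q (f df : V -> 'M[R]_(p, q)) x :
  (forall i j, is_diff x (fun y => f y i j) (fun v => df v i j)) -> is_diff x f df.
Proof.
move=> dfP; have d : differentiable f x.
  by apply: differentiable_mx => i j; have := dfP i j => ?; exact: ex_diff.
apply: DiffDef => //; apply/funext => v; apply/matrixP => i j.
by rewrite diff_mxE //; exact: is_diffE (dfP i j).
Qed.

Lemma is_derive_is_diff V (f : R -> V) (x : R) (df : V) :
  is_derive x 1 f df -> is_diff x f (fun t => t *: df).
Proof.
move=> [fd fE]; apply: DiffDef; first exact/derivable1_diffP.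
by rewrite deriv1E // derive1E fE.
Qed.

End Differentials.

(** * Toric data *)

Section Complex.
Context {R : realType}.
Implicit Types (t s : R) (z w : R[i]) (a : int).

Definition expi t : R[i] := cos (2 * pi * t) +i* sin (2 * pi * t).

Lemma expiD s t : expi (s + t) = expi s * expi t.
Proof.
rewrite /expi mulrDr cosD sinD; congr (_ +i* _).
by rewrite addrC.
Qed.

Lemma expi0 : expi 0 = 1.
Proof. by rewrite /expi mulr0 cos0 sin0. Qed.

Lemma expiN t : expi (- t) = conjc (expi t).
Proof. by rewrite /expi mulrN cosN sinN. Qed.

Lemma expi_conj t : expi t * conjc (expi t) = 1.
Proof. by rewrite -expiN -expiD subrr expi0. Qed.

Lemma expi_nat n : expi n%:R = 1.
Proof.
elim: n => [|n IHn]; first exact: expi0.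
rewrite -addn1 natrD expiD IHn mul1r /expi mulr1.
by rewrite mulr_natl cos2pi sin2pi.
Qed.

Lemma expi_int t : t \is a Num.int -> expi t = 1.
Proof.
move=> /intrP[[n|n] ->]; first exact: expi_nat.
by rewrite NegzE mulrNz expiN [_%:~R]/(n.+1%:R) expi_nat conjc1.
Qed.

Lemma expi_eq1 t : expi t = 1 -> t \is a Num.int.
Proof.
move=> et1; set f := t - (Num.floor t)%:~R.
have /andP[ft0 ft1] := floor_itv t.
have f0 : 0 <= f by rewrite subr_ge0.
have f1 : f < 1 by rewrite ltrBlDl -[X in _ + X]/(1%:~R) -intrD.
have : cos (2 * pi * f) = 1.
  have : expi f = 1 by rewrite expiD et1 mul1r expi_int // rpredN intr_int.
  by case.
suff f00 : f = 0 -> t \is a Num.int.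
  have pi0 : 0 < pi :> R := pi_gt0 R.
  (* [cos] is injective only on [0, pi]. For a fractional part above 1/2 the reflection 1 - f is
     used; it would give f = 1, a contradiction. *)
  have [fh|fh] := leP f (2^-1) => cf.
    apply: f00; suff : 2 * pi * f = 0 by move/eqP; rewrite mulf_eq0 gt_eqF /= ?mulr_gt0 // => /eqP.
    apply: cos_inj; rewrite ?cos0 // in_itv /=; apply/andP; split; nra.
  have : 2 * pi * (1 - f) = 0.
    apply: cos_inj; [by rewrite in_itv /=; apply/andP; split; nra|by rewrite in_itv /= lexx ltW|].
    rewrite cos0.
    have -> : 2 * pi * (1 - f) = - (2 * pi * f) + pi *+ 2 by rewrite mulr2n; ring.
    by rewrite cosD2pi cosN cf.
  by move/eqP; rewrite mulf_eq0 gt_eqF /= ?mulr_gt0 // subr_eq0 => /eqP f1E; move: f1; rewrite -f1E ltxx.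
by move=> /eqP; rewrite subr_eq0 => /eqP ->; exact: intr_int.
Qed.

Lemma expi_neq0 t : expi t != 0.
Proof.
by apply/eqP => e0; have := expi_conj t; rewrite e0 mul0r => /eqP; rewrite eq_sym oner_eq0.
Qed.

(* For |z| = 1 this is z^a; a negative exponent conjugates, so that zpow is
   smooth at 0. *)
Definition zpow z a : R[i] :=
  match a with Posz n => z ^+ n | Negz n => conjc z ^+ n.+1 end.

Lemma zpowM z w a : zpow (z * w) a = zpow z a * zpow w a.
Proof. by case: a => n /=; rewrite ?rmorphM exprMn. Qed.

Lemma zpow_real t a : zpow t%:C a = (t ^+ `|a|%N)%:C.
Proof.
case: a => n; rewrite /zpow ?conjc_real -rmorphXn //.
Qed.

Lemma zpow_expi t a : zpow (expi t) a = expi (a%:~R * t).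
Proof.
have H n : expi t ^+ n = expi (n%:R * t).
  elim: n => [|n IHn]; first by rewrite mul0r expi0.
  by rewrite exprS IHn -expiD -addn1 natrD mulrDl mul1r addrC.
case: a => n; rewrite /zpow; first exact: H.
by rewrite -rmorphXn H NegzE mulrNz mulNr expiN.
Qed.

Lemma polar z : exists t, z = (Num.sqrt ((Re z) ^+ 2 + (Im z) ^+ 2))%:C * expi t.
Proof.
case: z => a b /=; set r := Num.sqrt _.
have ab0 : 0 <= a ^+ 2 + b ^+ 2 by rewrite addr_ge0 ?sqr_ge0.
have r2 : r ^+ 2 = a ^+ 2 + b ^+ 2 by rewrite sqr_sqrtr.
have [r0|rn0] := eqVneq r 0.
  exists 0; rewrite r0 mul0r; move: r2; rewrite r0 expr0n /= => /esym/eqP.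
  by rewrite paddr_eq0 ?sqr_ge0 // !sqrf_eq0 => /andP[/eqP -> /eqP ->].
have rp : 0 < r by rewrite lt0r rn0 sqrtr_ge0.
have c1 : -1 <= a / r <= 1.
  rewrite -ler_norml normrM normfV (gtr0_norm rp) ler_pdivrMr // mul1r.
  rewrite -(ler_pXn2r (n := 2)) ?nnegrE // ?(ltW rp) // -normrX ger0_norm ?sqr_ge0 //.
  by rewrite r2 lerDl sqr_ge0.
have p2 : 2 * pi != 0 :> R by rewrite mulf_neq0 // gt_eqF // pi_gt0.
have sq : Num.sqrt (1 - (a / r) ^+ 2) = `|b| / r.
  have -> : 1 - (a / r) ^+ 2 = (b / r) ^+ 2.
    rewrite !expr_div_n; apply/eqP; rewrite -(inj_eq (mulIf (expf_neq0 2 rn0))) mulrBl mul1r.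
    by rewrite !divfK ?expf_neq0 // r2 addrC addKr.
  by rewrite sqrtr_sqr normrM normfV (gtr0_norm rp).
(* [acos] only yields angles of the upper half plane, so the sign of b decides. *)
exists (if 0 <= b then acos (a / r) / (2 * pi) else - (acos (a / r) / (2 * pi))).
have E1 : expi (acos (a / r) / (2 * pi)) = (a / r) +i* (`|b| / r).
  by rewrite /expi mulrC divfK // acosK ?in_itv //= sin_acos // sq.
case: (leP 0 b) => b0; rewrite ?expiN E1 /GRing.mul /= ?mul0r ?subr0 ?addr0 ?[r * _]mulrC ?divfK //.
  by rewrite ger0_norm.
by rewrite mulNr divfK // ltr0_norm // opprK.
Qed.

End Complex.

(** * Smooth complex-valued functions *)

Section SmoothComplex.
Context {R : realType} {V : normedModType R}.
Implicit Types (U : set V) (f g : V -> R[i]).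

Definition csmooth U f :=
  smooth_on U (fun x => Re (f x)) /\ smooth_on U (fun x => Im (f x)).

Lemma ReM (z w : R[i]) : Re (z * w) = Re z * Re w - Im z * Im w.
Proof. by case: z w => [a b] [c d]. Qed.

Lemma ImM (z w : R[i]) : Im (z * w) = Re z * Im w + Im z * Re w.
Proof. by case: z w => [a b] [c d]. Qed.

Lemma csmooth_cst U (z : R[i]) : csmooth U (fun=> z).
Proof. by split; exact: smooth_cst. Qed.

Lemma csmooth_real U (f : V -> R) : smooth_on U f -> csmooth U (fun x => (f x)%:C).
Proof. by move=> sf; split=> //=; exact: smooth_cst. Qed.

Lemma csmoothM U f g : open U -> csmooth U f -> csmooth U g ->
  csmooth U (fun x => f x * g x).
Proof.
move=> oU [fr fi] [gr gi]; split.
  under [X in smooth_on _ X]funext do rewrite ReM.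
  by apply: smoothB => //; exact: smoothM.
under [X in smooth_on _ X]funext do rewrite ImM.
by apply: smoothD => //; exact: smoothM.
Qed.

Lemma csmooth_conj U f : open U -> csmooth U f -> csmooth U (fun x => conjc (f x)).
Proof.
move=> oU [fr fi]; split.
  by rewrite (_ : (fun _ => _) = fun x => Re (f x)) //; apply/funext => x; case: (f x).
rewrite (_ : (fun _ => _) = fun x => - Im (f x)); last by apply/funext => x; case: (f x).
exact: smoothN.
Qed.

Lemma csmoothX U f n : open U -> csmooth U f -> csmooth U (fun x => f x ^+ n).
Proof.
move=> oU sf; elim: n => [|n IHn].
  by under [X in csmooth _ X]funext do rewrite expr0; exact: csmooth_cst.
by under [X in csmooth _ X]funext do rewrite exprS; exact: csmoothM.
Qed.

Lemma csmooth_zpow U f a : open U -> csmooth U f -> csmooth U (fun x => zpow (f x) a).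
Proof.
move=> oU sf; case: a => n; first exact: csmoothX.
by apply: csmoothX => //; exact: csmooth_conj.
Qed.

Lemma csmooth_prod U (I : Type) (r : seq I) (P : pred I) (f : I -> V -> R[i]) :
  open U -> (forall i, P i -> csmooth U (f i)) ->
  csmooth U (fun x => \prod_(i <- r | P i) f i x).
Proof.
move=> oU sf; elim: r => [|i r IHr].
  by under [X in csmooth _ X]funext do rewrite big_nil; exact: csmooth_cst.
under [X in csmooth _ X]funext do rewrite big_cons.
by case Pi : (P i) => //; apply: csmoothM => //; exact: sf.
Qed.

Lemma csmooth_expi U (f : V -> R) : open U -> smooth_on U f ->
  csmooth U (fun x => expi (f x)).
Proof.
move=> oU sf; apply: smooth_cos_sin => //.
by apply: smoothM => //; exact: smooth_cst.
Qed.

End SmoothComplex.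

(** * The pairing of row vectors *)

Section Dot.
Context {R : realType} {d : nat}.
Implicit Types v w : 'rV[R]_d.

Lemma dotE v w : dot v w = \sum_i v 0 i * w 0 i.
Proof. by rewrite /dot mxE; apply: eq_bigr => i _; rewrite mxE. Qed.

Lemma dotC v w : dot v w = dot w v.
Proof. by rewrite !dotE; apply: eq_bigr => i _; rewrite mulrC. Qed.

Lemma dotDl v v' w : dot (v + v') w = dot v w + dot v' w.
Proof. by rewrite /dot mulmxDl mxE. Qed.

Lemma dotDr v w w' : dot v (w + w') = dot v w + dot v w'.
Proof. by rewrite dotC dotDl ![dot _ v]dotC. Qed.

Lemma dotZl c v w : dot (c *: v) w = c * dot v w.
Proof. by rewrite /dot -scalemxAl mxE. Qed.

Lemma dotZr c v w : dot v (c *: w) = c * dot v w.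
Proof. by rewrite dotC dotZl dotC. Qed.

Lemma dotNl v w : dot (- v) w = - dot v w.
Proof. by rewrite /dot mulNmx mxE. Qed.

Lemma dotNr v w : dot v (- w) = - dot v w.
Proof. by rewrite dotC dotNl dotC. Qed.

Lemma dot0l w : dot 0 w = 0.
Proof. by rewrite /dot mul0mx mxE. Qed.

Lemma dot0r w : dot w 0 = 0.
Proof. by rewrite dotC dot0l. Qed.

Lemma dot_suml (I : Type) (r : seq I) (P : pred I) (F : I -> 'rV[R]_d) w :
  dot (\sum_(i <- r | P i) F i) w = \sum_(i <- r | P i) dot (F i) w.
Proof. by rewrite /dot mulmx_suml summxE. Qed.

Lemma dot_row_mul n (A : 'M[R]_(n, d)) k v : dot v (row k A) = (v *m A^T) 0 k.
Proof. by rewrite dotE !mxE; apply: eq_bigr => i _; rewrite !mxE. Qed.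

Lemma dot_int v w : Defs.integral v -> Defs.integral w -> dot v w \is a Num.int.
Proof. by move=> iv iw; rewrite dotE rpred_sum // => i _; rewrite rpredM. Qed.

End Dot.

(* The polytope {x | forall i, 0 <= 1 + <x, normal i>} in R^e. A chart I is a
   family of n facets whose normals are a basis of Z^e, with dual basis the rows
   of dual I, so n = e; two names avoid casts between d.+1 and d + 1. Some chart
   contains all the facets through a given point. A normal may be 0: such a
   facet is never active. *)
Record toric_data (R : realType) (n e : nat) := ToricData {
  facets : finType;
  charts : finType;
  normal : facets -> 'rV[R]_e;
  fac : charts -> 'I_n -> facets;
  dual : charts -> 'M[R]_(n, e);
  normal_integral : forall i, Defs.integral (normal i);
  dual_integral : forall I k, Defs.integral (row k (dual I));
  normal_dual : forall I, (\matrix_k normal (fac I k)) *m (dual I)^T = 1%:M;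
  dual_normal : forall I, (dual I)^T *m (\matrix_k normal (fac I k)) = 1%:M;
  bounded_polyhedron : exists B : R, forall x,
    (forall i, 0 <= 1 + dot x (normal i)) -> forall b, `|x 0 b| <= B;
  charts_cover : forall x, (forall i, 0 <= 1 + dot x (normal i)) ->
    exists I, forall i, 1 + dot x (normal i) = 0 -> exists k, fac I k = i
}.

(** * Monomials and polar coordinates of a polytope *)

Section ToricAlgebra.
Context {R : realType} {n e : nat} (D : toric_data R n e).
Implicit Types (i : facets D) (I J : charts D) (j k : 'I_n)
  (x th : 'rV[R]_e) (u : 'rV[R]_(n + n)).

Definition ell i x : R := 1 + dot x (normal i).
Definition tpoly : set 'rV[R]_e := [set x | forall i, 0 <= ell i x].
Definition nmx I : 'M[R]_(n, e) := \matrix_k normal (fac I k).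
(** The pairing is an integer, so [floor] merely reads it off as an [int]. *)
Definition wt I k i : int := Num.floor (dot (row k (dual I)) (normal i)).

Lemma wtE I k i : (wt I k i)%:~R = dot (row k (dual I)) (normal i).
Proof.
apply: floorK; apply: dot_int; first exact: dual_integral.
exact: normal_integral.
Qed.

Lemma dot_fac I k x : dot x (normal (fac I k)) = (x *m (nmx I)^T) 0 k.
Proof. by rewrite -dot_row_mul rowK. Qed.

Lemma dual_fac I k j : dot (row k (dual I)) (normal (fac I j)) = (k == j)%:R.
Proof.
have := congr1 (fun A : 'M[R]_n => A j k) (normal_dual I).
rewrite -/(nmx I) !mxE eq_sym => <-; rewrite dotE; apply: eq_bigr => b _.
by rewrite !mxE mulrC.
Qed.

Lemma wt_fac I k j : wt I k (fac I j) = (k == j)%:R.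
Proof. by apply: (@intr_inj R); rewrite wtE dual_fac; case: eqP. Qed.

Lemma fac_inj I : injective (fac I).
Proof.
move=> j k jk; apply/eqP; have := dual_fac I j k; rewrite -jk dual_fac eqxx.
by case: eqP => // _ /eqP; rewrite oner_eq0.
Qed.

Lemma dual_nmxT I : dual I *m (nmx I)^T = 1%:M.
Proof. by rewrite -[LHS]trmxK trmx_mul trmxK normal_dual trmx1. Qed.

Lemma nmxT_dual I : (nmx I)^T *m dual I = 1%:M.
Proof. by rewrite -[LHS]trmxK trmx_mul trmxK dual_normal trmx1. Qed.

Lemma row_expand I x : x = (x *m (nmx I)^T) *m dual I.
Proof.
by rewrite -mulmxA nmxT_dual mulmx1.
Qed.

Lemma row_expandN I x : x = (x *m (dual I)^T) *m nmx I.
Proof. by rewrite -mulmxA dual_normal mulmx1. Qed.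

Lemma ell0 i : ell i 0 = 1. Proof. by rewrite /ell dot0l addr0. Qed.

Lemma tpoly0 : tpoly 0. Proof. by move=> i; rewrite ell0. Qed.

Lemma ellD i x y : ell i (x + y) = ell i x + dot y (normal i).
Proof. by rewrite /ell dotDl addrA. Qed.

Definition zc u k : R[i] := u 0 (lshift n k) +i* u 0 (rshift n k).
Definition zrow (z : 'I_n -> R[i]) : 'rV[R]_(n + n) :=
  row_mx (\row_k Re (z k)) (\row_k Im (z k)).
Definition sqn u k : R := u 0 (lshift n k) ^+ 2 + u 0 (rshift n k) ^+ 2.

Lemma zc_zrow z k : zc (zrow z) k = z k.
Proof. by rewrite /zc /zrow row_mxEl row_mxEr !mxE; case: (z k). Qed.

Lemma zrow_zc u : zrow (zc u) = u.
Proof.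
apply/rowP => c; rewrite -(splitK c); case: (fintype.split c) => k /=.
  by rewrite /zrow row_mxEl mxE.
by rewrite /zrow row_mxEr mxE.
Qed.

Lemma zrowP u u' : (forall k, zc u k = zc u' k) -> u = u'.
Proof.
by move=> E; rewrite -(zrow_zc u) -(zrow_zc u'); congr zrow; exact/funext.
Qed.

(* The chart I has coordinates z_k with |z_k|^2 = ell (fac I k) x. *)
Definition xI I u : 'rV[R]_e := (\row_k (sqn u k - 1)) *m dual I.

Lemma ell_xI I u k : ell (fac I k) (xI I u) = sqn u k.
Proof.
rewrite /ell dot_fac /xI -mulmxA dual_nmxT mulmx1 mxE.
by rewrite addrC subrK.
Qed.

(** The absolute value keeps the monomial continuous where [ell i x] vanishes; a negative weight
    corresponds to a power of the conjugate coordinate, as in [zpow]. *)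
Definition mon x J k i : R := Num.sqrt (ell i x) ^+ `|wt J k i|%N.
Definition outI I i : bool := i \notin codom (fac I).

(* The point of the manifold with moment x and angle th is determined by x and
   these numbers, one for each chart J and k. *)
Definition Fmon x th J k : R[i] :=
  (\prod_i mon x J k i)%:C * expi (dot (row k (dual J)) th).

Definition pol I x th : 'rV[R]_(n + n) :=
  zrow (fun k => (Num.sqrt (ell (fac I k) x))%:C * expi (dot (row k (dual I)) th)).

Lemma norm_expi (t r : R) : Re (r%:C * expi t) ^+ 2 + Im (r%:C * expi t) ^+ 2 = r ^+ 2.
Proof.
rewrite /expi /GRing.mul /= !mul0r subr0 addr0 !exprMn -mulrDr.
by rewrite cos2Dsin2 mulr1.
Qed.

Lemma sqn_pol I x th k : 0 <= ell (fac I k) x -> sqn (pol I x th) k = ell (fac I k) x.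
Proof.
move=> l0; rewrite -[RHS](sqr_sqrtr l0) -(norm_expi (dot (row k (dual I)) th)).
by rewrite /sqn /pol /zrow row_mxEl row_mxEr !mxE.
Qed.

Lemma xI_pol I x th : (forall k, 0 <= ell (fac I k) x) -> xI I (pol I x th) = x.
Proof.
move=> l0; rewrite [RHS](row_expand I) /xI; congr (_ *m _); apply/rowP => k.
by rewrite [LHS]mxE sqn_pol // /ell dot_fac addrAC subrr add0r.
Qed.

Lemma polarI I u : exists th, u = pol I (xI I u) th.
Proof.
have /choice[t tE] k : exists t, zc u k = (Num.sqrt (sqn u k))%:C * expi t.
  exact: polar.
(* The angles of the chart are the pairings of th with the dual basis, and [nmx I] inverts this. *)
exists ((\row_k t k) *m nmx I); apply: zrowP => k.
rewrite zc_zrow ell_xI tE; congr (_ * expi _).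
by rewrite dotC dot_row_mul -mulmxA normal_dual mulmx1 mxE.
Qed.

Lemma prod_facets (T : comPzSemiRingType) I (F : facets D -> T) :
  \prod_i F i = (\prod_k F (fac I k)) * \prod_(i | outI I i) F i.
Proof.
rewrite (bigID (mem (codom (fac I)))) /=; congr (_ * _).
rewrite (eq_bigl (fun i => i \in [set fac I k | k in 'I_n]%SET)).
  by rewrite big_imset //= => j k _ _; exact: fac_inj.
by move=> i; apply/codomP/imsetP => [[k ->]|[k _ ->]]; exists k.
Qed.

Definition gout I J k x : R := \prod_(i | outI I i) mon x J k i.
(** The monomial [Fmon] read in the chart I. The facets of I contribute powers of the z_j or of
    their conjugates; all other facets are inactive on the chart, so the roots in [gout] are smooth
    there. *)
Definition Fchart I u J k : R[i] :=
  (\prod_j zpow (zc u j) (wt J k (fac I j))) * (gout I J k (xI I u))%:C.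

Lemma Fchart_pol I x th J k : (forall k, 0 <= ell (fac I k) x) ->
  Fchart I (pol I x th) J k = Fmon x th J k.
Proof.
move=> l0; rewrite /Fchart xI_pol // /Fmon (prod_facets I) rmorphM /= -!mulrA.
rewrite [in RHS](mulrC (gout _ _ _ _)%:C) !mulrA; congr (_ * _).
rewrite rmorph_prod /=.
have -> : expi (dot (row k (dual J)) th) =
    \prod_j expi ((wt J k (fac I j))%:~R * dot (row j (dual I)) th).
  rewrite {1}(row_expand I (row k (dual J))) mulmx_sum_row dot_suml.
  rewrite (eq_bigr (fun j => (wt J k (fac I j))%:~R * dot (row j (dual I)) th)); last first.
    by move=> j _; rewrite dotZl -dot_fac -wtE.
  elim/big_rec2: _ => [|j y1 y2 _ E]; first exact: expi0.
  by rewrite expiD E.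
rewrite -big_split /=; apply: eq_bigr => j _.
by rewrite zc_zrow zpowM zpow_real zpow_expi.
Qed.

(** On the facets of its own chart a dual basis has Kronecker weights, so among these facets only
    the k-th enters. This is why the chart can be recovered from the monomials. *)
Lemma Fmon_diag I x th k :
  Fmon x th I k = (Num.sqrt (ell (fac I k) x) * gout I I k x)%:C *
                  expi (dot (row k (dual I)) th).
Proof.
rewrite /Fmon (prod_facets I) (bigD1 k) //= [X in _ * X * _]big1 ?mulr1.
  by rewrite /mon wt_fac eqxx expr1.
by move=> j jk; rewrite /mon wt_fac eq_sym (negPf jk) expr0.
Qed.

Lemma gout_gt0 I J k x : (forall i, outI I i -> 0 < ell i x) -> 0 < gout I J k x.
Proof. by move=> l0; apply: prodr_gt0 => i /l0 li; rewrite exprn_gt0 // sqrtr_gt0. Qed.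

(** The circle generated by [normal i] collapses over the facet i: a monomial of nonzero weight
    vanishes there, and one of weight 0 does not see the shift. *)
Lemma Fmon_shift x th J k i (c : R) :
  tpoly x -> ell i x = 0 -> Fmon x (th + c *: normal i) J k = Fmon x th J k.
Proof.
move=> px li0; rewrite /Fmon.
have [w0|wn0] := eqVneq (wt J k i) 0.
  by rewrite dotDr dotZr -wtE w0 mulr0 addr0.
rewrite (bigD1 i) //= /mon li0 sqrtr0 expr0n absz_eq0 (negPf wn0) !mul0r.
by [].
Qed.

Lemma Fmon_lattice x th m J k :
  Defs.integral m -> Fmon x (th + m) J k = Fmon x th J k.
Proof.
move=> im; rewrite /Fmon dotDr expiD [expi (dot _ m)]expi_int ?mulr1 //.
by apply: dot_int => //; exact: dual_integral.
Qed.

Lemma Fmon_rot x th xi J k :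
  Fmon x (th + xi) J k = expi (dot (row k (dual J)) xi) * Fmon x th J k.
Proof. by rewrite /Fmon dotDr expiD mulrCA [expi _ * _ in RHS]mulrC mulrCA mulrA mulrC. Qed.

End ToricAlgebra.

(** * The toric manifold of a polytope *)

Section Topology.
Context {R : realType}.

Lemma cvg_rV (T : topologicalType) p (f : T -> 'rV[R]_p) (z : T) :
  (forall c, {for z, continuous (fun y => f y 0 c)}) -> {for z, continuous f}.
Proof.
move=> cf; apply/cvgrPdist_le => /= eps e0.
have : \forall y \near z, forall c, `|f z 0 c - f y 0 c| <= eps.
  by apply: filter_forall => c; have /cvgrPdist_le := cf c; exact.
apply: filterS => y H.
rewrite /Num.Def.normr /= mx_normrE (bigmax_le _ (ltW e0)) //= => -[i c] _.
by rewrite !mxE ord1.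
Qed.

Lemma continuous_pairat (T A B : topologicalType) (f : T -> A) (g : T -> B) z :
  {for z, continuous f} -> {for z, continuous g} ->
  {for z, continuous (fun x => (f x, g x))}.
Proof. by move=> cf cg; apply: (cvg_pair cf cg). Qed.

Lemma open_finite_pos (T : topologicalType) (I : finType) (P : pred I)
    (g : I -> T -> R) :
  (forall i, P i -> continuous (g i)) ->
  open [set u | forall i, P i -> 0 < g i u].
Proof.
move=> cg; rewrite openE => u gu; rewrite /interior /=.
apply: filter_forall => i; case Pi: (P i); last exact: nearW.
have := cg i Pi u; move/cvgrPdist_lt => /(_ _ (gu i Pi)).
apply: filterS => y H _; have := le_lt_trans (ler_norm _) H; lra.
Qed.

Lemma continuous_prod (T : topologicalType) (I : Type) (r : seq I)
    (f : I -> T -> R) :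
  (forall i, continuous (f i)) -> continuous (fun y => \prod_(i <- r) f i y).
Proof.
move=> cf; elim: r => [|i r IHr].
  by under [X in continuous X]funext do rewrite big_nil; exact: cst_continuous.
under [X in continuous X]funext do rewrite big_cons.
by move=> z; apply: cvgM; [exact: cf|exact: IHr].
Qed.

Context {T : topologicalType} (A : set T).

Lemma set_type_hausdorff : hausdorff_space T -> hausdorff_space (set_type A).
Proof.
move=> hT p q pq; apply: val_inj; apply: hT => U W Up Wq.
have cval := @initial_continuous (set_type A) T set_val.
have [r [Ur Wr]] := pq _ _ (cval p U Up) (cval q W Wq).
by exists (set_val r).
Qed.

Lemma set_type_compact : compact A -> compact [set: set_type A].
Proof.
move=> cA F FF _; have FA : (set_val @ F) A.
  by rewrite /nbhs /=; apply: filterE => p; exact: set_valP.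
have [y [Ay cy]] := cA _ (fmap_proper_filter set_val FF) FA.
exists (exist _ y (mem_set Ay)); split=> // B C FB [_ [[W oW <-] Wy sC]].
have FB' : (set_val @ F) (set_val @` B).
  by rewrite /nbhs /=; apply: filterS FB => p Bp; exists p.
have [_ [[p Bp <-] Wp]] := cy _ _ FB' (open_nbhs_nbhs (conj oW Wy)).
by exists p; split=> //; apply: sC.
Qed.

End Topology.

(** * The embedded space, its charts and its torus action *)

Section Embedding.
Context {R : realType} {n e : nat} (D : toric_data R n e).
Implicit Types (i : facets D) (I J : charts D) (j k : 'I_n)
  (x th xi : 'rV[R]_e) (u : 'rV[R]_(n + n)).

Definition tidx : finType := ('I_e + charts D * 'I_n * bool)%type.
Local Notation q := #|tidx|.
Implicit Types y : 'rV[R]_q.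

Definition emb x (F : charts D -> 'I_n -> R[i]) : 'rV[R]_q :=
  \row_c match enum_val c with
         | inl b => x 0 b
         | inr (J, k, b) => if b then Im (F J k) else Re (F J k)
         end.

Definition cx y : 'rV[R]_e := \row_b y 0 (enum_rank (inl b : tidx)).
Definition cF y J k : R[i] :=
  y 0 (enum_rank (inr (J, k, false) : tidx))
  +i* y 0 (enum_rank (inr (J, k, true) : tidx)).

Lemma cx_emb x F : cx (emb x F) = x.
Proof. by apply/rowP => b; rewrite !mxE enum_rankK. Qed.

Lemma cF_emb x F J k : cF (emb x F) J k = F J k.
Proof. by rewrite /cF !mxE !enum_rankK; case: (F J k). Qed.

Lemma eq_emb x F F' : (forall J k, F J k = F' J k) -> emb x F = emb x F'.
Proof. by move=> FF; congr emb; apply/funext => J; apply/funext => k. Qed.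

(** By [Fmon_diag] the monomials of the chart itself are its coordinates up to the positive factor
    [gout]. The map is defined on the ambient space, from which its smoothness is inherited. *)
Definition kap I y : 'rV[R]_(n + n) :=
  zrow (fun k => cF y I k * ((gout I I k (cx y))^-1)%:C).
Definition imm I u : 'rV[R]_q := emb (xI I u) (Fchart I u).
Definition embP x th : 'rV[R]_q := emb x (Fmon x th).
(** The torus acts by rotations of the ambient coordinates, so the continuity and smoothness of the
    action are proved there. *)
Definition rot xi y : 'rV[R]_q :=
  emb (cx y) (fun J k => expi (dot (row k (dual J)) xi) * cF y J k).

Lemma rot_embP xi x th : rot xi (embP x th) = embP x (th + xi).
Proof.
by rewrite /rot cx_emb; apply: eq_emb => J k; rewrite cF_emb Fmon_rot.
Qed.

Lemma imm_pol I x th : (forall k, 0 <= ell (fac I k) x) ->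
  imm I (pol I x th) = embP x th.
Proof.
by move=> l0; rewrite /imm xI_pol //; apply: eq_emb => J k; rewrite Fchart_pol.
Qed.

Lemma kap_embP I x th : (forall i, outI I i -> 0 < ell i x) ->
  kap I (embP x th) = pol I x th.
Proof.
move=> l0; rewrite /kap /pol cx_emb; congr zrow; apply/funext => k.
have /lt0r_neq0 g0 := gout_gt0 I k l0.
by rewrite cF_emb Fmon_diag mulrAC -rmorphM /= mulfK.
Qed.

Definition imgI I : set 'rV[R]_(n + n) :=
  [set u | forall i, outI I i -> 0 < ell i (xI I u)].

Lemma imgI_tpoly I u : imgI I u -> tpoly D (xI I u).
Proof.
move=> Iu i; case: (boolP (outI I i)) => [/Iu/ltW //|].
by rewrite negbK => /codomP[k ->]; rewrite ell_xI addr_ge0 ?sqr_ge0.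
Qed.

Lemma kap_imm I u : imgI I u -> kap I (imm I u) = u.
Proof.
move=> Iu; have [th uE] := polarI I u; rewrite [RHS]uE -(kap_embP th Iu).
have l0 k : 0 <= ell (fac I k) (xI I u) by exact: imgI_tpoly.
by rewrite -(imm_pol th l0) -uE.
Qed.

Section Smooth.
Context {V : normedModType R} (U : set V).
Hypothesis oU : open U.

Lemma smooth_zrow (z : V -> 'I_n -> R[i]) :
  (forall k, csmooth U (fun v => z v k)) -> smooth_on U (fun v => zrow (z v)).
Proof.
move=> sz; apply: smooth_mx => // a c; rewrite ord1 -(splitK c).
case: (fintype.split c) => k /=; rewrite /zrow.
  by under [X in smooth_on _ X]funext do rewrite row_mxEl mxE; exact: (sz k).1.
by under [X in smooth_on _ X]funext do rewrite row_mxEr mxE; exact: (sz k).2.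
Qed.

Lemma smooth_emb (x : V -> 'rV[R]_e) (F : V -> charts D -> 'I_n -> R[i]) :
  smooth_on U x -> (forall J k, csmooth U (fun v => F v J k)) ->
  smooth_on U (fun v => emb (x v) (F v)).
Proof.
move=> sx sF; apply: smooth_mx => // a c.
under [X in smooth_on _ X]funext do rewrite mxE.
case: (enum_val c) => [b|[[J k] []]]; first exact: smooth_coord.
  exact: (sF J k).2.
exact: (sF J k).1.
Qed.

Lemma smooth_dot p (f g : V -> 'rV[R]_p) :
  smooth_on U f -> smooth_on U g -> smooth_on U (fun v => dot (f v) (g v)).
Proof.
move=> sf sg; apply: (@smooth_coord _ _ _ _ U (fun v => f v *m (g v)^T)) => //.
by apply: smooth_mulmx => //; exact: smooth_trmx.
Qed.

Lemma smooth_ell i (x : V -> 'rV[R]_e) :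
  smooth_on U x -> smooth_on U (fun v => ell i (x v)).
Proof.
move=> sx; apply: smoothD => //; first exact: smooth_cst.
by apply: smooth_dot => //; exact: smooth_cst.
Qed.

Lemma smooth_gout I J k (x : V -> 'rV[R]_e) : smooth_on U x ->
  (forall v, U v -> forall i, outI I i -> 0 < ell i (x v)) ->
  smooth_on U (fun v => gout I J k (x v)).
Proof.
move=> sx lx; apply: smooth_prod => // i oi; apply: smoothX => //.
by apply: smooth_sqrt => // [v Uv|]; [exact: lx|exact: smooth_ell].
Qed.

Lemma smooth_cx (y : V -> 'rV[R]_q) : smooth_on U y -> smooth_on U (cx \o y).
Proof.
move=> sy; apply: smooth_mx => // a b.
by under [X in smooth_on _ X]funext do rewrite mxE; exact: smooth_coord.
Qed.

Lemma smooth_cF (y : V -> 'rV[R]_q) J k :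
  smooth_on U y -> csmooth U (fun v => cF (y v) J k).
Proof. by move=> sy; split; exact: smooth_coord. Qed.

Lemma smooth_zc (u : V -> 'rV[R]_(n + n)) k :
  smooth_on U u -> csmooth U (fun v => zc (u v) k).
Proof. by move=> su; split; exact: smooth_coord. Qed.

Lemma smooth_rot (y : V -> 'rV[R]_q) (xi : V -> 'rV[R]_e) :
  smooth_on U y -> smooth_on U xi -> smooth_on U (fun v => rot (xi v) (y v)).
Proof.
move=> sy sxi; apply: smooth_emb; first exact: smooth_cx.
move=> J k; apply: csmoothM => //; last exact: smooth_cF.
by apply: csmooth_expi => //; apply: smooth_dot => //; exact: smooth_cst.
Qed.

Lemma smooth_sqn (u : V -> 'rV[R]_(n + n)) k :
  smooth_on U u -> smooth_on U (fun v => sqn (u v) k).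
Proof.
by move=> su; apply: smoothD => //; apply: smoothX => //; exact: smooth_coord.
Qed.

Lemma smooth_xI I (u : V -> 'rV[R]_(n + n)) :
  smooth_on U u -> smooth_on U (fun v => xI I (u v)).
Proof.
move=> su; apply: smooth_mulmx => //; last exact: smooth_cst.
apply: smooth_mx => // a k; under [X in smooth_on _ X]funext do rewrite mxE.
by apply: smoothB => //; [exact: smooth_sqn|exact: smooth_cst].
Qed.

Lemma smooth_kap I (y : V -> 'rV[R]_q) :
  (forall v, U v -> forall i, outI I i -> 0 < ell i (cx (y v))) ->
  smooth_on U y -> smooth_on U (fun v => kap I (y v)).
Proof.
move=> ly sy; apply: smooth_zrow => k; apply: csmoothM => //; first exact: smooth_cF.
apply: csmooth_real; apply: smoothV => // [v Uv|].
  by rewrite gt_eqF //; apply: gout_gt0; exact: ly.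
by apply: smooth_gout => //; exact: smooth_cx.
Qed.

Lemma smooth_imm I (u : V -> 'rV[R]_(n + n)) :
  (forall v, U v -> imgI I (u v)) ->
  smooth_on U u -> smooth_on U (fun v => imm I (u v)).
Proof.
move=> Iu su; apply: smooth_emb; first exact: smooth_xI.
move=> J k; apply: csmoothM => //.
  by apply: csmooth_prod => // j _; apply: csmooth_zpow => //; exact: smooth_zc.
by apply: csmooth_real; apply: smooth_gout => //; exact: smooth_xI.
Qed.

End Smooth.

Lemma continuous_ell_xI I i : continuous (fun u => ell i (xI I u)).
Proof.
move=> u; apply: (@smooth_continuous _ _ _ setT (fun u => ell i (xI I u))) => //.
by apply: smooth_ell; [exact: openT|apply: smooth_xI; [exact: openT|exact: smooth_id]].
Qed.

Lemma open_imgI I : open (imgI I).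
Proof. by apply: open_finite_pos => i _; exact: continuous_ell_xI. Qed.

Lemma continuous_ell_cx i : continuous (fun y => ell i (cx y)).
Proof.
move=> y; apply: (@smooth_continuous _ _ _ setT (fun y => ell i (cx y))) => //.
by apply: smooth_ell; [exact: openT|apply: smooth_cx; [exact: openT|exact: smooth_id]].
Qed.

Definition tset : set 'rV[R]_q :=
  [set y | exists x th, tpoly D x /\ y = embP x th].
Local Notation M := (set_type tset).

Lemma embP_tset x th : tpoly D x -> tset (embP x th).
Proof. by move=> px; exists x, th. Qed.

Definition base_point : M :=
  exist _ (embP 0 0) (mem_set (embP_tset 0 (@tpoly0 _ _ _ D))).

Definition toM (y : 'rV[R]_q) : M :=
  if pselect (tset y) is left ty then exist _ y (mem_set ty) else base_point.

Lemma toMK y : tset y -> set_val (toM y) = y.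
Proof. by rewrite /toM; case: pselect. Qed.

Lemma tset_inj (p p' : M) : set_val p = set_val p' -> p = p'.
Proof. exact: val_inj. Qed.

Definition pt x th : M := toM (embP x th).

Lemma val_pt x th : tpoly D x -> set_val (pt x th) = embP x th.
Proof. by move=> px; apply: toMK; exact: embP_tset. Qed.

Lemma ptP (p : M) : exists x th, tpoly D x /\ p = pt x th.
Proof.
have [x [th [px pE]]] := set_valP p.
by exists x, th; split=> //; apply: tset_inj; rewrite val_pt.
Qed.

Definition xof (p : M) : 'rV[R]_e := cx (set_val p).

Lemma xof_pt x th : tpoly D x -> xof (pt x th) = x.
Proof. by move=> px; rewrite /xof val_pt // cx_emb. Qed.

Lemma tpoly_xof p : tpoly D (xof p).
Proof. by have [x [th [px ->]]] := ptP p; rewrite xof_pt. Qed.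

Definition act xi (p : M) : M := toM (rot xi (set_val p)).

Lemma act_pt xi x th : tpoly D x -> act xi (pt x th) = pt x (th + xi).
Proof. by move=> px; rewrite /act val_pt // rot_embP. Qed.

Lemma val_act xi p : set_val (act xi p) = rot xi (set_val p).
Proof.
by have [x [th [px ->]]] := ptP p; rewrite act_pt // !val_pt // rot_embP.
Qed.

Lemma pt_shift x th i c : tpoly D x -> ell i x = 0 ->
  pt x (th + c *: normal i) = pt x th.
Proof.
move=> px li; apply: tset_inj; rewrite !val_pt //.
by apply: eq_emb => J k; exact: Fmon_shift.
Qed.

Lemma pt_lattice x th m : Defs.integral m -> pt x (th + m) = pt x th.
Proof. by move=> im; congr toM; apply: eq_emb => J k; exact: Fmon_lattice. Qed.

Definition domI I : set M := [set p | forall i, outI I i -> 0 < ell i (xof p)].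
Definition chartI I (p : M) : 'rV[R]_(n + n) := kap I (set_val p).
Definition parI I u : M := toM (imm I u).

Lemma chart_pt I x th : tpoly D x -> domI I (pt x th) ->
  chartI I (pt x th) = pol I x th.
Proof.
by move=> px; rewrite /domI /= xof_pt // => Ix; rewrite /chartI val_pt // kap_embP.
Qed.

Lemma par_pol I x th : tpoly D x -> parI I (pol I x th) = pt x th.
Proof. by move=> px; rewrite /parI imm_pol. Qed.

Lemma parE I u : imgI I u -> exists th,
  [/\ u = pol I (xI I u) th, tpoly D (xI I u) & parI I u = pt (xI I u) th].
Proof.
move=> Iu; have px := imgI_tpoly Iu; have [th uE] := polarI I u.
by exists th; split=> //; rewrite {1}uE par_pol.
Qed.

Lemma val_par I u : imgI I u -> set_val (parI I u) = imm I u.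
Proof.
move=> Iu; have [th [uE px ->]] := parE Iu.
by rewrite val_pt // [in RHS]uE imm_pol.
Qed.

Lemma xof_par I u : imgI I u -> xof (parI I u) = xI I u.
Proof. by move=> Iu; rewrite /xof val_par // cx_emb. Qed.

Lemma domI_par I u : imgI I u -> domI I (parI I u).
Proof. by move=> Iu i oi; rewrite xof_par //; exact: Iu. Qed.

Lemma chart_par I u : imgI I u -> chartI I (parI I u) = u.
Proof. by move=> Iu; rewrite /chartI val_par // kap_imm. Qed.

Lemma par_chart I p : domI I p -> parI I (chartI I p) = p.
Proof.
have [x [th [px ->]]] := ptP p => Ip.
by rewrite chart_pt // par_pol.
Qed.

Lemma xI_chart I p : domI I p -> xI I (chartI I p) = xof p.
Proof.
have [x [th [px ->]]] := ptP p => Ip.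
by rewrite chart_pt // xI_pol ?xof_pt.
Qed.

Lemma imgE I : chartI I @` domI I = imgI I.
Proof.
apply/seteqP; split=> [_ [p Ip <-] i oi|u Iu]; first by rewrite xI_chart //; exact: Ip.
by exists (parI I u); [exact: domI_par|exact: chart_par].
Qed.

Lemma continuous_xof_ell i : continuous (fun p : M => ell i (xof p)).
Proof.
move=> p; apply: (@continuous_comp M _ _ set_val (fun y => ell i (cx y))).
  exact: (@initial_continuous M _ set_val).
exact: continuous_ell_cx.
Qed.

Lemma open_domI I : open (domI I).
Proof. by apply: open_finite_pos => i _; exact: continuous_xof_ell. Qed.

Lemma continuous_chart I p : domI I p -> {for p, continuous (chartI I)}.
Proof.
move=> Ip; apply: (@continuous_comp M _ _ set_val (kap I)).
  exact: (@initial_continuous M _ set_val).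
pose U := [set y : 'rV[R]_q | forall i, outI I i -> 0 < ell i (cx y)].
have oU : open U by apply: open_finite_pos => i _; exact: continuous_ell_cx.
apply: (@smooth_continuous _ _ _ U (kap I)) => //.
by apply: (smooth_kap oU (y := id)) => // ; exact: smooth_id.
Qed.

Lemma continuous_to_tset (T : topologicalType) (f : T -> M) (z : T) :
  {for z, continuous (fun w => set_val (f w))} -> {for z, continuous f}.
Proof.
move=> cf U [_ [[W oW <-] Wz sU]]; apply: (filterS sU); apply: cf.
exact: open_nbhs_nbhs.
Qed.

Section SmoothChange.
Context {V : normedModType R} (U : set V).
Hypothesis oU : open U.
Variables (I : charts D) (xi : V -> 'rV[R]_e) (u : V -> 'rV[R]_(n + n)).
Hypotheses (sxi : smooth_on U xi) (su : smooth_on U u).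
Hypothesis Iu : forall v, U v -> imgI I (u v).

Let f v := act (xi v) (parI I (u v)).

Let val_f v : U v -> set_val (f v) = rot (xi v) (imm I (u v)).
Proof. by move=> Uv; rewrite /f val_act val_par //; exact: Iu. Qed.

Let srot : smooth_on U (fun v => rot (xi v) (imm I (u v))).
Proof. by apply: smooth_rot => //; exact: smooth_imm. Qed.

(** The group element and the point both depend on a parameter. Thus the changes of charts ([xi] =
    0), the smoothness of the action and the slices of the reduced spaces are all instances. *)
Lemma smooth_act_par : (forall v, U v -> {for v, continuous f}) /\
  forall J, smooth_on (U `&` (f @^-1` domI J)) (chartI J \o f).
Proof.
have cf v : U v -> {for v, continuous f}.
  move=> Uv; apply: continuous_to_tset.
  have := smooth_continuous srot Uv; rewrite /prop_for /continuous_at -val_f //.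
  apply: cvg_trans; apply: near_eq_cvg; apply: (open_near oU Uv) => w Uw.
  by rewrite val_f.
split=> // J; have oW : open (U `&` (f @^-1` domI J)).
  rewrite openE => v [Uv Jv]; rewrite /interior; apply: filterI.
    exact: open_nbhs_nbhs.
  by apply: cf => //; apply: open_nbhs_nbhs; split=> //; exact: open_domI.
apply: (@smooth_ext _ _ _ _ (fun v => kap J (rot (xi v) (imm I (u v))))) => //.
  by move=> v [Uv Jv]; rewrite /= /chartI val_f.
apply: smooth_kap => // [v [Uv Jv]|]; first by rewrite -val_f.
by apply: smooth_sub srot => v [].
Qed.

End SmoothChange.

Lemma tspace_hausdorff : hausdorff_space M.
Proof. by apply: set_type_hausdorff; exact: norm_hausdorff. Qed.

Lemma continuous_Fmon J k :
  continuous (fun z : 'rV[R]_e * 'rV[R]_e => Re (Fmon z.1 z.2 J k)) /\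
  continuous (fun z : 'rV[R]_e * 'rV[R]_e => Im (Fmon z.1 z.2 J k)).
Proof.
have cdot1 w : continuous (fun z : 'rV[R]_e * 'rV[R]_e => dot z.1 w).
  move=> z; apply: (@continuous_comp _ _ _ fst (fun x => dot x w)); first exact: cvg_fst.
  apply: (@smooth_continuous _ _ _ setT (fun x => dot x w)) => //.
  by apply: smooth_dot; [exact: openT|exact: smooth_id|exact: smooth_cst].
have cdot2 w : continuous (fun z : 'rV[R]_e * 'rV[R]_e => dot w z.2).
  move=> z; apply: (@continuous_comp _ _ _ snd (fun x => dot w x)); first exact: cvg_snd.
  apply: (@smooth_continuous _ _ _ setT (fun x => dot w x)) => //.
  by apply: smooth_dot; [exact: openT|exact: smooth_cst|exact: smooth_id].
have cm : continuous (fun z : 'rV[R]_e * 'rV[R]_e => \prod_i mon z.1 J k i).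
  apply: continuous_prod => i z; rewrite /mon.
  apply: (@continuous_comp _ _ _ (fun z => Num.sqrt (ell i z.1)) (fun r => r ^+ _)).
    apply: (@continuous_comp _ _ _ (fun z => ell i z.1) Num.sqrt).
      by apply: cvgD; [exact: cvg_cst|exact: cdot1].
    exact: sqrt_continuous.
  exact: exprn_continuous.
have c2 : continuous (fun z : 'rV[R]_e * 'rV[R]_e => 2 * pi * dot (row k (dual J)) z.2).
  by move=> z; apply: cvgM; [exact: cvg_cst|exact: cdot2].
have E z : Fmon z.1 z.2 J k =
  ((\prod_i mon z.1 J k i) * cos (2 * pi * dot (row k (dual J)) z.2)) +i*
  ((\prod_i mon z.1 J k i) * sin (2 * pi * dot (row k (dual J)) z.2)).
  by rewrite /Fmon /expi /GRing.mul /= !mul0r subr0 addr0.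
split.
  under [X in continuous X]funext do rewrite E /=.
  move=> z; apply: cvgM; first exact: cm.
  by apply: continuous_comp; [exact: c2|exact: continuous_cos].
under [X in continuous X]funext do rewrite E /=.
move=> z; apply: cvgM; first exact: cm.
by apply: continuous_comp; [exact: c2|exact: continuous_sin].
Qed.

Lemma continuous_embP :
  continuous (fun z : 'rV[R]_e * 'rV[R]_e => embP z.1 z.2).
Proof.
move=> z; apply: cvg_rV => c.
rewrite /embP /emb; under [X in {for _, continuous X}]funext do rewrite mxE.
case: (enum_val c) => [b|[[J k] []]]; last 2 first.
- exact: (continuous_Fmon J k).2.
- exact: (continuous_Fmon J k).1.
apply: (@continuous_comp _ _ _ fst (fun x : 'rV[R]_e => x 0 b)); first exact: cvg_fst.
exact: coord_continuous.
Qed.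

Lemma compact_tpoly : compact (tpoly D).
Proof.
have [B HB] := bounded_polyhedron D.
apply: (@subclosed_compact _ _ [set x : 'rV[R]_e | forall b, x 0 b \in `[- B, B]]).
- have -> : tpoly D = \bigcap_(i in [set: facets D]) [set x | 0 <= ell i x].
    by apply/seteqP; split=> [x px i _|x px i]; [exact: px|exact: (px i)].
  apply: closed_bigI => i _.
  apply: (@preimage_closed _ _ (ell i) [set r | 0 <= r]); last exact: closed_ge.
  move=> x _; apply: (@smooth_continuous _ _ _ setT (ell i)) => //.
  have oT : open [set: 'rV[R]_e] := openT.
  exact: (smooth_ell oT i (x := id) (smooth_id _)).
- by apply: (@rV_compact R e (fun _ => `[- B, B]%classic)) => i; exact: segment_compact.
- by move=> x px b; rewrite in_itv /= -ler_norml; exact: HB.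
Qed.

Lemma compact_tset : compact tset.
Proof.
pose Q := [set x : 'rV[R]_e | forall b, x 0 b \in `[0, 1]].
have cQ : compact Q.
  by apply: (@rV_compact R e (fun _ => `[0, 1]%classic)) => i; exact: segment_compact.
have -> : tset = (fun z : 'rV[R]_e * 'rV[R]_e => embP z.1 z.2) @` (tpoly D `*` Q).
  apply/seteqP; split=> [y [x [th [px ->]]]|_ [[x th] [/= px _] <-]]; last exact: embP_tset.
  (* Angles only matter modulo integers, so th can be moved into the unit cube. *)
  pose m : 'rV[R]_e := \row_b (Num.floor (th 0 b))%:~R.
  have im : Defs.integral (- m) by move=> b; rewrite !mxE rpredN intr_int.
  exists (x, th - m) => /=; last by apply: eq_emb => J k; exact: Fmon_lattice.
  split=> //= b; rewrite !mxE in_itv /=; have /andP[f1 f2] := floor_itv (th 0 b).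
  by rewrite subr_ge0 f1 lerBlDl -[X in _ + X]/(1%:~R) -intrD ltW.
apply: continuous_compact; last by apply: compact_setX => //; exact: compact_tpoly.
exact/continuous_subspaceT/continuous_embP.
Qed.

Lemma compact_tspace : compact [set: M].
Proof. exact/set_type_compact/compact_tset. Qed.

Lemma tpoly_scale x (t : R) : tpoly D x -> 0 <= t <= 1 -> tpoly D (t *: x).
Proof.
move=> px /andP[t0 t1] i; have := px i; rewrite /ell dotZl; nra.
Qed.

(** The polytope is star-shaped about 0, so scaling x and th joins every point to [pt 0 0]. *)
Lemma connected_tspace : connected [set: M].
Proof.
pose g (z : 'rV[R]_e * 'rV[R]_e) (t : R) := pt (t *: z.1) (t *: z.2).
have -> : [set: M] = \bigcup_(z in [set z | tpoly D z.1]) (g z @` `[0, 1]).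
  apply/seteqP; split=> // p _; have [x [th [px ->]]] := ptP p.
  exists (x, th) => //; exists 1; first by rewrite /= in_itv /= ler01 lexx.
  by rewrite /g /= !scale1r.
apply: bigcup_connected.
  exists (pt 0 0) => z pz; exists 0; first by rewrite /= in_itv /= ler01 lexx.
  by rewrite /g !scale0r.
move=> z pz; apply: connected_continuous_connected; first exact: segment_connected.
apply/subspace_sigL_continuousP => t.
apply: continuous_to_tset.
have ct : continuous (fun t : R => embP (t *: z.1) (t *: z.2)).
  move=> s; apply: (@continuous_comp _ _ _ (fun t : R => (t *: z.1, t *: z.2))
    (fun z => embP z.1 z.2)); last exact: continuous_embP.
  by apply: continuous_pairat; apply: scalel_continuous.
rewrite (_ : (fun w => _) = (fun t : R => embP (t *: z.1) (t *: z.2)) \o set_val); last first.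
  apply/funext => w /=; rewrite /sigL /= /g val_pt //; apply: tpoly_scale => //.
  by have := set_valP w; rewrite /= in_itv.
apply: continuous_comp; last exact: ct.
exact: (@initial_continuous (set_type `[(0:R), 1]) _ set_val).
Qed.

Lemma continuous_act : continuous (fun z : 'rV[R]_e * M => act z.1 z.2).
Proof.
move=> z; apply: continuous_to_tset.
rewrite (_ : (fun w => _) = (fun w : 'rV[R]_e * 'rV[R]_q => rot w.1 w.2) \o
   (fun w : 'rV[R]_e * M => (w.1, set_val w.2))); last first.
  by apply/funext => w /=; rewrite val_act.
apply: continuous_comp.
  apply: continuous_pairat; first exact: cvg_fst.
  apply: (@continuous_comp _ _ _ snd (set_val : M -> _)); first exact: cvg_snd.
  exact: (@initial_continuous M _ set_val).
apply: (@smooth_continuous _ _ _ setT (fun w : 'rV[R]_e * 'rV[R]_q => rot w.1 w.2)) => //.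
by apply: smooth_rot; [exact: openT| |];
  [apply: smooth_snd|apply: smooth_fst]; (exact: openT || exact: smooth_id).
Qed.

Lemma second_countable_tspace : @second_countable M.
Proof.
pose P := isPointed.Build M base_point.
pose T : pseudoPMetricType R := HB.pack M P.
exact: (@compact_second_countable R T compact_tspace).
Qed.

Lemma charts_cover_tspace (p : M) : exists I, domI I p.
Proof.
have pp := tpoly_xof p; have [I HI] := charts_cover pp.
exists I => i oi; rewrite lt0r pp andbT; apply/eqP => /HI[k kE].
by move: oi; rewrite /outI -kE codom_f.
Qed.

Lemma smooth_transition I J :
  smooth_on ((chartI I @` domI I) `&` (parI I @^-1` domI J)) (chartI J \o parI I).
Proof.
rewrite imgE; have act0 p : act 0 p = p.
  by have [x [th [px ->]]] := ptP p; rewrite act_pt // addr0.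
have oI : open (imgI I) by exact: open_imgI.
have [_ /(_ J)] := smooth_act_par oI (I := I) (xi := fun=> 0) (u := id)
   (smooth_cst _ _) (smooth_id _) (fun _ => id).
by rewrite (_ : (fun v => act 0 (parI I v)) = parI I) //; apply/funext => v; rewrite act0.
Qed.

Lemma continuous_par I u : (chartI I @` domI I) u -> {for u, continuous (parI I)}.
Proof.
rewrite imgE => Iu; have act0 p : act 0 p = p.
  by have [x [th [px ->]]] := ptP p; rewrite act_pt // addr0.
have oI : open (imgI I) by exact: open_imgI.
have [+ _] := smooth_act_par oI (I := I) (xi := fun=> 0) (u := id)
   (smooth_cst _ _) (smooth_id _) (fun _ => id).
rewrite (_ : (fun v => act 0 (parI I v)) = parI I); first exact.
by apply/funext => v; rewrite act0.
Qed.

Lemma open_img_chart I : open (chartI I @` domI I).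
Proof. by rewrite imgE; exact: open_imgI. Qed.

Definition tmanifold : manifold R (n + n) :=
  @Manifold R (n + n) M (charts D) domI chartI parI tspace_hausdorff
    second_countable_tspace charts_cover_tspace open_domI open_img_chart
    par_chart continuous_chart continuous_par smooth_transition.

End Embedding.

(** * Frames over the open orbit *)

Section DenseEquality.
Context {R : realType} {n : nat}.
Local Notation E := ('rV[R]_(n + n)).

(** Inside the image of a chart these are the points over the interior of the polytope, that is, the
    open orbit; see [all_pos]. *)
Definition regp (u : E) : Prop := forall k, sqn u k != 0.

Lemma sqn_eq0 (u : E) k : (sqn u k == 0) = (zc u k == 0).
Proof.
rewrite /sqn paddr_eq0 ?sqr_ge0 // !sqrf_eq0.
by rewrite /zc eq_complex.
Qed.

Lemma sqn_ge0 (u : E) k : 0 <= sqn u k.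
Proof. by rewrite addr_ge0 ?sqr_ge0. Qed.

(* The points all of whose complex coordinates are nonzero are dense: move
   along the diagonal. *)
Lemma dense_eq (W : normedModType R) (U : set E) (f g : E -> W) :
  open U -> (forall u, U u -> {for u, continuous f}) ->
  (forall u, U u -> {for u, continuous g}) ->
  (forall u, U u -> regp u -> f u = g u) -> forall u, U u -> f u = g u.
Proof.
move=> oU cf cg fg u Uu.
pose c (t : R) : E := u + t *: const_mx 1.
have c0 : c 0 = u by rewrite /c scale0r addr0.
have cc : {for 0, continuous c}.
  by apply: cvgD; [exact: cvg_cst|exact: scalel_continuous].
have cvg_c (h : E -> W) : {for u, continuous h} -> h (c t) @[t --> 0^'] --> h u.
  move=> ch; apply: cvg_within_filter; rewrite -[in X in _ --> X]c0.
  by apply: (@continuous_comp _ _ _ c h) => //; rewrite c0.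
have near_fg : \forall t \near 0^', f (c t) = g (c t).
  have h1 : \forall t \near 0^', U (c t).
    apply: cvg_within; apply: cc; rewrite c0; exact: open_nbhs_nbhs.
  have h2 : \forall t \near 0^', forall k, zc (c t) k != 0.
    apply: filter_forall => k; set a := u 0 (lshift n k).
    have : \forall t \near (0 : R)^', a + t != 0.
      have [a0|an0] := eqVneq a 0.
        rewrite a0; near=> t; rewrite add0r; near: t; exact: nbhs_dnbhs_neq.
      near=> t; rewrite addr_eq0; apply/negP => /eqP aE.
      have : `|t| < `|a| by near: t; apply: dnbhs0_lt; rewrite normr_gt0.
      by rewrite aE normrN ltxx.
    apply: filterS => t at0; rewrite /zc eq_complex /= negb_and /c !mxE mulr1.
    by rewrite at0.
  near=> t; apply: fg; first by near: t.
  by move=> k; rewrite sqn_eq0; move: k; near: t.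
have cvgf := cvg_c f (cf u Uu); have cvgg := cvg_c g (cg u Uu).
have cvgf' : f (c t) @[t --> 0^'] --> g u.
  by apply: cvg_trans cvgg; apply: near_eq_cvg; apply: filterS near_fg => t ->.
exact: (cvg_unique (@norm_hausdorff _ _) cvgf cvgf').
Unshelve. all: by end_near. Qed.

End DenseEquality.

Lemma mulc_real (R : realType) (a b r : R) :
  (a +i* b) * r%:C = (a * r) +i* (b * r).
Proof. by rewrite {1}/GRing.mul /= !mulr0 subr0 add0r. Qed.

Section Frames.
Context {R : realType} {n : nat}.
Implicit Types (u v : 'rV[R]_(n + n)) (k : 'I_n).

(** Multiplication by i, acting on row vectors from the right. *)
Definition J0 : 'M[R]_(n + n) := block_mx 0 1%:M (- 1%:M) 0.
(** Row k is the radial field of z_k at u, and row k of [Th u] its angular field. Both vanish where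
    z_k = 0. *)
Definition Rm u : 'M[R]_(n, n + n) :=
  row_mx (diag_mx (lsubmx u)) (diag_mx (rsubmx u)).
Definition Th u : 'M[R]_(n, n + n) :=
  row_mx (- diag_mx (rsubmx u)) (diag_mx (lsubmx u)).
Definition Dm u : 'M[R]_n := diag_mx (\row_k sqn u k).
Definition Di u : 'M[R]_n := diag_mx (\row_k (sqn u k)^-1).

Lemma J0J0 : J0 *m J0 = - 1%:M.
Proof.
rewrite /J0 mulmx_block !mul0mx !mulmx0 !mul1mx !mulNmx !mulmx1 ?mul1mx !addr0 !add0r.
by rewrite [in RHS](@scalar_mx_block _ n n 1) opp_block_mx !oppr0.
Qed.

Lemma trJ0 : J0^T = - J0.
Proof.
by rewrite /J0 tr_block_mx !trmx0 linearN /= trmx1 opp_block_mx !oppr0 opprK.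
Qed.

Lemma RmJ0 u : Rm u *m J0 = Th u.
Proof.
by rewrite /Th /Rm /J0 mul_row_block !mulmx0 !mulmxN !mulmx1 addr0 add0r.
Qed.

Lemma ThJ0 u : Th u *m J0 = - Rm u.
Proof. by rewrite -RmJ0 -mulmxA J0J0 mulmxN mulmx1. Qed.

Lemma RmRmT u : Rm u *m (Rm u)^T = Dm u.
Proof.
rewrite /Rm tr_row_mx mul_row_col !tr_diag_mx !mulmx_diag -raddfD /=.
by congr diag_mx; apply/rowP => k; rewrite !mxE /sqn -!expr2.
Qed.

Lemma RmThT u : Rm u *m (Th u)^T = 0.
Proof.
rewrite /Th /Rm tr_row_mx mul_row_col linearN /= !tr_diag_mx mulmxN !mulmx_diag.
rewrite addrC -[X in _ - X](_ : diag_mx (\row_j (rsubmx u 0 j * lsubmx u 0 j)) = _) ?subrr //.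
by congr diag_mx; apply/rowP => j; rewrite !mxE mulrC.
Qed.

Lemma ThThT u : Th u *m (Th u)^T = Dm u.
Proof.
rewrite -{2}RmJ0 trmx_mul trJ0 mulmxA mulmxN ThJ0 opprK; exact: RmRmT.
Qed.

Lemma ThRmT u : Th u *m (Rm u)^T = 0.
Proof. by rewrite -[LHS]trmxK trmx_mul trmxK RmThT trmx0. Qed.

Lemma DmDi u : regp u -> Dm u *m Di u = 1%:M.
Proof.
move=> ru; rewrite mulmx_diag; apply/matrixP => i j; rewrite !mxE.
by rewrite divff // ; exact: ru.
Qed.

Lemma DiDm u : regp u -> Di u *m Dm u = 1%:M.
Proof. by move=> ru; apply: mulmx1C; exact: DmDi. Qed.

(** The radial and angular fields are orthogonal with squared lengths [sqn], so [Di] normalizes them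
    to a resolution of the identity. *)
Lemma frame_complete u : regp u ->
  (Rm u)^T *m Di u *m Rm u + (Th u)^T *m Di u *m Th u = 1%:M.
Proof.
move=> ru; pose f := col_mx (Rm u) (Th u).
pose g := row_mx ((Rm u)^T *m Di u) ((Th u)^T *m Di u).
have fg : f *m g = 1%:M.
  rewrite /f /g mul_col_row !mulmxA RmRmT RmThT ThRmT ThThT !mul0mx !DmDi //.
  by rewrite -scalar_mx_block.
by rewrite -(mulmx1C fg) /f /g mul_row_col.
Qed.

(* On regular points the rows of Rm and Th form a basis. *)
Lemma frame_eq u p (A B : 'M[R]_(n + n, p)) : regp u ->
  Rm u *m A = Rm u *m B -> Th u *m A = Th u *m B -> A = B.
Proof.
move=> ru RAB TAB; rewrite -[A]mul1mx -[B]mul1mx -(frame_complete ru) !mulmxDl.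
by rewrite -!(mulmxA _ (Rm u)) -!(mulmxA _ (Th u)) RAB TAB.
Qed.

Lemma frame_eq2 u (A B : 'M[R]_(n + n)) : regp u ->
  Rm u *m A *m (Rm u)^T = Rm u *m B *m (Rm u)^T ->
  Rm u *m A *m (Th u)^T = Rm u *m B *m (Th u)^T ->
  Th u *m A *m (Rm u)^T = Th u *m B *m (Rm u)^T ->
  Th u *m A *m (Th u)^T = Th u *m B *m (Th u)^T -> A = B.
Proof.
move=> ru RR RT TR TT.
have H (X Y : 'M[R]_(n, n + n)) : X *m (Rm u)^T = Y *m (Rm u)^T ->
    X *m (Th u)^T = Y *m (Th u)^T -> X = Y.
  move=> /(congr1 trmx) HR /(congr1 trmx) HT; apply: trmx_inj; apply: (frame_eq ru).
    by rewrite !trmx_mul !trmxK in HR.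
  by rewrite !trmx_mul !trmxK in HT.
by apply: (frame_eq ru); apply: H.
Qed.

Lemma frame_comb u (a b : 'I_n -> R) :
  (\row_k a k) *m Rm u + (\row_k b k) *m Th u =
  zrow (fun k => (a k +i* b k) * zc u k).
Proof.
rewrite /Th /Rm !mul_mx_row add_row_mx mulmxN !mul_mx_diag /zrow; congr row_mx;
  by apply/rowP => k; rewrite !mxE /= ?lsubmxEsub ?mxE // addrC.
Qed.

Lemma zrow_polar_diff (r : 'I_n -> R -> R) (r' b c : 'I_n -> R) :
  (forall k, is_derive (0 : R) 1 (r k) (r' k)) ->
  is_diff (0 : R) (fun t => zrow (fun k => (r k t)%:C * expi (b k + t * c k)))
    (fun t => t *: zrow (fun k =>
       (r' k +i* (r k 0 * (2 * pi * c k))) * expi (b k))).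
Proof.
move=> dr; apply: is_diff_mx => i j; rewrite ord1 -(splitK j).
have phi k : is_derive (0 : R) 1 (fun t : R => 2 * pi * (b k + t * c k)) (2 * pi * c k).
  apply: is_derive_eq. by rewrite /GRing.scale /=; ring.
case: (fintype.split j) => k /=; rewrite /zrow.
  under [X in is_diff _ X]funext do rewrite row_mxEl mxE /= mul0r subr0.
  under [X in is_diff _ _ X]funext do rewrite mxE row_mxEl mxE /=.
  apply: is_diff_eq; first apply: is_derive_is_diff.
  apply/funext => t; rewrite /= mul0r addr0 /GRing.scale /=; ring.
under [X in is_diff _ X]funext do rewrite row_mxEr mxE /= mul0r addr0.
under [X in is_diff _ _ X]funext do rewrite mxE row_mxEr mxE /=.
apply: is_diff_eq; first apply: is_derive_is_diff.
apply/funext => t; rewrite /= mul0r addr0 /GRing.scale /=; ring.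
Qed.

End Frames.

(** * Action-angle coordinates and the changes of charts *)

Section ToricCalculus.
Context {R : realType} {n e : nat} (D : toric_data R n e).
Implicit Types (i : facets D) (I J : charts D) (j k : 'I_n)
  (x th xi : 'rV[R]_e) (u v : 'rV[R]_(n + n)).
Local Notation M := (tmanifold D).

(** The velocity of a curve whose values [ell] move by y and whose chart angles move by phi: since
    |z_k|^2 is the k-th value, the radial coefficient is y_k / (2 |z_k|^2), while 2 pi comes from
    angles of period one. *)
Definition dpol u (y phi : 'rV[R]_n) : 'rV[R]_(n + n) :=
  (2^-1 *: y *m Di u) *m Rm u + (2 * pi) *: phi *m Th u.

Lemma is_diff_pol I x th x' th' :
  (forall k, 0 < ell (fac I k) x) ->
  is_diff (0 : R) (fun t => pol I (x + t *: x') (th + t *: th'))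
    (fun t => t *: dpol (pol I x th) (x' *m (nmx I)^T) (th' *m (dual I)^T)).
Proof.
move=> l0; set u := pol I x th.
have sq k : sqn u k = ell (fac I k) x by rewrite sqn_pol // ltW.
pose r k (t : R) := Num.sqrt (ell (fac I k) x + t * dot x' (normal (fac I k))).
pose r' k := (2 * Num.sqrt (ell (fac I k) x))^-1 * dot x' (normal (fac I k)).
have dr k : is_derive (0 : R) 1 (r k) (r' k).
  apply: (@is_derive1_comp _ Num.sqrt (fun t => ell (fac I k) x + t * dot x' (normal (fac I k)))).
    by rewrite mul0r addr0; apply: is_derive1_sqrt.
  by apply: is_derive_eq; rewrite /GRing.scale /=; ring.
have H := zrow_polar_diff (fun k => dot (row k (dual I)) th) (fun k => dot (row k (dual I)) th') dr.
rewrite (_ : (fun t => pol _ _ _) = fun t => zrow (fun k =>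
   (r k t)%:C * expi (dot (row k (dual I)) th + t * dot (row k (dual I)) th'))); last first.
  apply/funext => t; rewrite /pol; congr zrow; apply/funext => k.
  by rewrite ellD dotZl dotDr dotZr.
rewrite (_ : dpol _ _ _ = zrow (fun k =>
       (r' k +i* (r k 0 * (2 * pi * dot (row k (dual I)) th'))) * expi (dot (row k (dual I)) th))) //.
rewrite /dpol.
have -> : (2^-1 *: (x' *m (nmx I)^T)) *m Di u =
          \row_k (2^-1 * dot x' (normal (fac I k)) / sqn u k).
  apply/rowP => k; rewrite mul_mx_diag mxE [RHS]mxE dot_fac.
  by congr (_ * _); rewrite mxE.
have -> : (2 * pi) *: (th' *m (dual I)^T) = \row_k (2 * pi * dot (row k (dual I)) th').
  by apply/rowP => k; rewrite [LHS]mxE [RHS]mxE [dot _ th']dotC dot_row_mul.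
rewrite frame_comb; congr zrow; apply/funext => k.
rewrite zc_zrow mulrA; congr (_ * _).
have s0 : Num.sqrt (ell (fac I k) x) != 0 by rewrite gt_eqF // sqrtr_gt0.
rewrite mulc_real /r' /r mul0r addr0 sq; congr (_ +i* _); last by rewrite mulrC.
rewrite -[X in _ / X](sqr_sqrtr (ltW (l0 k))); move: s0; set q := Num.sqrt _ => s0; by field.
Qed.

(** The radii do not move, so this also holds over the boundary of the polytope, where the square
    roots of [is_diff_pol] are not differentiable. *)
Lemma is_diff_pol_angle I x th th' :
  (forall k, 0 <= ell (fac I k) x) ->
  is_diff (0 : R) (fun t => pol I x (th + t *: th'))
    (fun t => t *: ((2 * pi) *: (th' *m (dual I)^T) *m Th (pol I x th))).
Proof.
move=> l0; set u := pol I x th.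
pose r k (t : R) := Num.sqrt (ell (fac I k) x).
have dr k : is_derive (0 : R) 1 (r k) 0 by exact: is_derive_cst.
have H := zrow_polar_diff (fun k => dot (row k (dual I)) th) (fun k => dot (row k (dual I)) th') dr.
rewrite (_ : (fun t => pol _ _ _) = fun t => zrow (fun k =>
   (r k t)%:C * expi (dot (row k (dual I)) th + t * dot (row k (dual I)) th'))); last first.
  apply/funext => t; rewrite /pol; congr zrow; apply/funext => k.
  by rewrite dotDr dotZr.
rewrite (_ : (2 * pi) *: _ *m _ = zrow (fun k =>
       (0 +i* (r k 0 * (2 * pi * dot (row k (dual I)) th'))) * expi (dot (row k (dual I)) th))) //.
have -> : (2 * pi) *: (th' *m (dual I)^T) = \row_k (2 * pi * dot (row k (dual I)) th').
  by apply/rowP => k; rewrite [LHS]mxE [RHS]mxE [dot _ th']dotC dot_row_mul.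
have := frame_comb u (fun=> 0) (fun k => 2 * pi * dot (row k (dual I)) th').
rewrite (_ : \row_k 0 = 0) ?mul0mx ?add0r; last by apply/rowP => k; rewrite !mxE.
move=> ->; congr zrow; apply/funext => k.
rewrite zc_zrow mulrA; congr (_ * _).
by rewrite mulc_real mul0r /r [in RHS]mulrC.
Qed.

Lemma act_par_chart xi I J u th : imgI I u -> u = pol I (xI I u) th ->
  domI J (act xi (parI I u)) -> loc (M := M) (act xi) I J u = pol J (xI I u) (th + xi).
Proof.
move=> Iu uE; have px := imgI_tpoly Iu.
have pE : parI I u = pt D (xI I u) th by rewrite {1}uE; exact: par_pol.
by rewrite /loc /= pE act_pt // => Ju; apply: chart_pt.
Qed.

Lemma imgME I : img (M := M) I = imgI I.
Proof. exact: imgE. Qed.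

Lemma loc_domE xi I J u :
  loc_dom (M := M) (act xi) I J u <-> imgI I u /\ domI J (act xi (parI I u)).
Proof. by rewrite /loc_dom imgME. Qed.

Lemma loc_dom_smooth xi I J :
  open (loc_dom (M := M) (act xi) I J) /\
  smooth_on (loc_dom (M := M) (act xi) I J) (loc (M := M) (act xi) I J).
Proof.
have oI : open (imgI I) by exact: open_imgI.
have [cf sf] := smooth_act_par oI (I := I) (xi := fun=> xi) (u := id)
  (smooth_cst _ _) (smooth_id _) (fun _ => id).
have E : loc_dom (M := M) (act xi) I J =
    imgI I `&` ((fun u => act xi (parI I u)) @^-1` domI J).
  by apply/funext => u; apply/propext; rewrite loc_domE.
split; rewrite E; last exact: sf.
rewrite openE => v [Uv Jv]; rewrite /interior; apply: filterI.
  exact: open_nbhs_nbhs.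
by apply: cf => //; apply: open_nbhs_nbhs; split=> //; exact: open_domI.
Qed.

(** The Jacobian acts on row vectors from the right. For xi = 0 it belongs to the change of
    charts. *)
Definition Dloc xi I J u : 'M[R]_(n + n) := lin1_mx ('d (loc (M := M) (act xi) I J) u).

Lemma DlocE xi I J u v : 'd (loc (M := M) (act xi) I J) u v = v *m Dloc xi I J u.
Proof. by rewrite /Dloc mul_rV_lin1. Qed.

Lemma all_pos I u : imgI I u -> regp u -> forall i, 0 < ell i (xI I u).
Proof.
move=> Iu ru i; case: (boolP (outI I i)) => [/Iu //|].
rewrite negbK => /codomP[k ->]; rewrite ell_xI lt0r sqn_ge0 andbT; exact: ru.
Qed.

Lemma regp_pol J x th : (forall i, 0 < ell i x) -> regp (pol J x th).
Proof. by move=> lx k; rewrite sqn_pol ?gt_eqF // ltW. Qed.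

Lemma regp_loc xi I J u : loc_dom (M := M) (act xi) I J u -> regp u ->
  regp (loc (M := M) (act xi) I J u).
Proof.
move=> /loc_domE[Iu Ju] ru; have [th uE] := polarI I u.
by rewrite (act_par_chart Iu uE Ju); apply: regp_pol; exact: all_pos.
Qed.

Lemma imgI_loc xi I J u : loc_dom (M := M) (act xi) I J u ->
  imgI J (loc (M := M) (act xi) I J u) /\
  xI J (loc (M := M) (act xi) I J u) = xI I u.
Proof.
move=> /loc_domE[Iu Ju]; have px := imgI_tpoly Iu; have [th uE] := polarI I u.
have E : xI J (loc (M := M) (act xi) I J u) = xI I u.
  by rewrite (act_par_chart Iu uE Ju) xI_pol.
split=> // i oi; rewrite E.
by have := Ju i oi; rewrite [in act _ _]uE par_pol // act_pt // xof_pt.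
Qed.

(** The same affine curve in (x, th) is read in both charts; differentiating the two readings
    determines the Jacobian on the open orbit. *)
Lemma Dloc_dpol xi I J u y phi : loc_dom (M := M) (act xi) I J u -> regp u ->
  dpol u (y *m (nmx I)^T) (phi *m (dual I)^T) *m Dloc xi I J u =
  dpol (loc (M := M) (act xi) I J u) (y *m (nmx J)^T) (phi *m (dual J)^T).
Proof.
move=> Lu ru; have [Iu Ju] := (loc_domE _ _ _ _).1 Lu.
have [th uE] := polarI I u; have lx := all_pos Iu ru; set x := xI I u in uE lx.
have tE : loc (M := M) (act xi) I J u = pol J x (th + xi) by exact: act_par_chart.
have [oL sL] := loc_dom_smooth xi I J.
have dI := @is_diff_pol I x th y phi (fun k => lx _).
have dJ := @is_diff_pol J x (th + xi) y phi (fun k => lx _).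
rewrite -uE in dI.
have dtau : is_diff (pol I (x + 0 *: y) (th + 0 *: phi)) (loc (M := M) (act xi) I J)
    ('d (loc (M := M) (act xi) I J) u).
  rewrite !scale0r !addr0 -uE; apply: differentiableP.
  exact: smooth_differentiable sL Lu.
have dcomp := is_diff_comp dI dtau.
have near_eq : \forall t \near (0 : R),
    (loc (M := M) (act xi) I J \o (fun t => pol I (x + t *: y) (th + t *: phi))) t
    = pol J (x + t *: y) (th + xi + t *: phi).
  have near_pos : \forall t \near (0 : R), forall i, 0 < ell i (x + t *: y).
    have ct : forall i, predT i -> continuous (fun t : R => ell i (x + t *: y)).
      move=> i _; under [X in continuous X]funext do rewrite ellD dotZl.
      move=> t.
      by apply: cvgD; [exact: cvg_cst|apply: cvgMr_tmp; exact: cvg_id].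
    have := open_finite_pos ct; rewrite openE => /(_ (0 : R)) H.
    by apply: filterS (H _) => [t lt i|i _]; [exact: lt|rewrite scale0r addr0].
  apply: filterS near_pos => t lt /=.
  have pt_ : tpoly D (x + t *: y) by move=> i; exact: ltW.
  rewrite par_pol // act_pt // addrAC; apply: chart_pt => // i oi.
  by rewrite xof_pt.
have E1 := is_diffE (1 : R) (near_eq_is_diff near_eq dcomp).
have := etrans (esym E1) (is_diffE (1 : R) dJ).
by rewrite /= !scale1r DlocE -tE.
Qed.

(** In action-angle coordinates every change of charts is linear. The rows of [Th] are multiples of
    the angular fields and those of [Di *m Rm] are twice the derivations along the values [ell], so
    both change by constant matrices. *)
Lemma frames_Dloc xi I J u : loc_dom (M := M) (act xi) I J u -> regp u ->
  let u' := loc (M := M) (act xi) I J u in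
  Th u *m Dloc xi I J u = nmx I *m (dual J)^T *m Th u' /\
  Di u *m Rm u *m Dloc xi I J u = dual I *m (nmx J)^T *m Di u' *m Rm u'.
Proof.
move=> Lu ru u'.
have p0 : 2 * pi != 0 :> R by rewrite mulf_neq0 // gt_eqF // pi_gt0.
have HT (w : 'rV[R]_n) : w *m (Th u *m Dloc xi I J u) =
    w *m (nmx I *m (dual J)^T *m Th u').
  have := @Dloc_dpol xi I J u 0 ((2 * pi)^-1 *: (w *m nmx I)) Lu ru.
  rewrite /dpol !mul0mx !scaler0 !mul0mx !add0r -!scalemxAl !scalerA divff // !scale1r.
  by rewrite -(mulmxA w) normal_dual mulmx1 -!mulmxA.
have HR (w : 'rV[R]_n) : w *m (Di u *m Rm u *m Dloc xi I J u) =
    w *m (dual I *m (nmx J)^T *m Di u' *m Rm u').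
  have := @Dloc_dpol xi I J u (2 *: (w *m dual I)) 0 Lu ru.
  rewrite /dpol !mul0mx !scaler0 !mul0mx !addr0 -!scalemxAl !scalerA mulVf // !scale1r.
  by rewrite -(mulmxA w) dual_nmxT mulmx1 -!mulmxA.
by split; apply/row_matrixP => k; rewrite !rowE; [exact: HT|exact: HR].
Qed.

End ToricCalculus.

(** * The symplectic form and the moment map *)

Section ToricHamiltonian.
Context {R : realType} {n e : nat} (D : toric_data R n e).
Implicit Types (i : facets D) (I J : charts D) (j k : 'I_n)
  (x th xi : 'rV[R]_e) (u v : 'rV[R]_(n + n)).
Local Notation M := (tmanifold D).

Lemma toric_torus_action : torus_action (M := M) (@act R n e D).
Proof.
split.
- move=> xi p ixi; have [x [th [px ->]]] := ptP p.
  by rewrite act_pt // pt_lattice.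
- move=> xi eta p; have [x [th [px ->]]] := ptP p.
  by rewrite !act_pt // -addrA [eta + xi]addrC.
- exact: continuous_act.
- move=> I.
  have oU : open ([set: 'rV[R]_e] `*` imgI I).
    rewrite (_ : _ `*` _ = snd @^-1` imgI I); last first.
      by apply/seteqP; split=> [z []|z Iz].
    by apply: open_comp; [move=> z _; exact: cvg_snd|exact: open_imgI].
  rewrite imgME /smooth_into.
  by apply: (smooth_act_par oU (xi := fst) (u := snd));
    [apply: smooth_fst => //; exact: smooth_id
    |apply: smooth_snd => //; exact: smooth_id|move=> v []].
Qed.

(** Over the interior all coordinates of a chart are nonzero and determine the chart angles modulo
    integers; the integer matrix [nmx I] carries this back to th. *)
Lemma pt_eqP x th th' : (forall i, 0 < ell i x) ->
  pt D x th = pt D x th' -> Defs.integral (th' - th) .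
Proof.
move=> lx; have px : tpoly D x by move=> i; exact: ltW.
move=> E b; have [I _] := charts_cover (@tpoly0 _ _ _ D).
have HE k : dot (row k (dual I)) (th' - th) \is a Num.int.
  apply: expi_eq1; have := congr1 (fun p => zc (chartI I p) k) E.
  have dI th0 : domI I (pt D x th0) by move=> i _; rewrite xof_pt.
  rewrite !chart_pt //= !zc_zrow => /(congr1 (fun z => z / (Num.sqrt (ell (fac I k) x))%:C)).
  have s0 : (Num.sqrt (ell (fac I k) x))%:C != 0.
    by rewrite eq_complex /= eqxx andbT gt_eqF // sqrtr_gt0.
  rewrite ![_ * expi _]mulrC !mulfK // => E'.
  by rewrite dotDr dotNr expiD -E' -expiD subrr expi0.
rewrite (row_expandN I (th' - th)) mxE rpred_sum // => k _; rewrite rpredM //.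
  by rewrite -dot_row_mul dotC; exact: HE.
by rewrite mxE; exact: normal_integral.
Qed.

Lemma toric_effective : effective (M := M) (@act R n e D).
Proof.
move=> xi H; have := H (pt D 0 0); rewrite act_pt; last exact: tpoly0.
rewrite add0r => /esym /pt_eqP; rewrite subr0; apply => i.
by rewrite ell0.
Qed.

(** As |z_k|^2 is a value of [ell] and angles have period one, 1/pi is the factor that turns r dr /\
    d(arg) into d(ell) /\ d(angle). *)
Definition tomega : twoform M := fun=> fun=> pi^-1 *: J0.

Lemma ev2E (A : 'M[R]_(n + n)) v w : ev2 A v w = (v *m A *m w^T) 0 0.
Proof. by []. Qed.

(** [J0] pairs the frame [Th] with the frame [Di *m Rm], and the matrices by which these two change
    are inverse transposes of each other. *)
Lemma Dloc_J0 xi I J u : loc_dom (M := M) (act xi) I J u -> regp u ->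
  Dloc xi I J u *m J0 *m (Dloc xi I J u)^T = J0.
Proof.
move=> Lu ru; have [HT HR] := frames_Dloc Lu ru.
set u' := loc _ _ _ _ in HT HR; set Dt := Dloc _ _ _ _ in HT HR *.
have ru' : regp u' by exact: regp_loc.
set c := nmx I *m _ in HT; set c' := dual I *m _ in HR.
have cc : c' *m c^T = 1%:M.
  rewrite /c /c' trmx_mul trmxK -mulmxA (mulmxA (nmx J)^T) nmxT_dual mul1mx.
  exact: dual_nmxT.
have cc' : c *m c'^T = 1%:M by rewrite -[LHS]trmxK trmx_mul trmxK cc trmx1.
set P := Dm u *m c' *m Di u'.
have HR' : Rm u *m Dt = P *m Rm u'.
  have -> : Rm u *m Dt = Dm u *m (Di u *m Rm u *m Dt) by rewrite !mulmxA DmDi // mul1mx.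
  by rewrite HR /P !mulmxA.
have conj (A B : 'M[R]_(n, n + n)) : A *m (Dt *m J0 *m Dt^T) *m B^T =
    (A *m Dt) *m J0 *m (B *m Dt)^T by rewrite trmx_mul !mulmxA.
have conj' (P' Q' : 'M[R]_n) (A B : 'M[R]_(n, n + n)) :
    (P' *m A) *m J0 *m (Q' *m B)^T = P' *m (A *m J0 *m B^T) *m Q'^T.
  by rewrite trmx_mul !mulmxA.
have PDc : P *m Dm u' *m c^T = Dm u.
  by rewrite /P -(mulmxA _ (Di u')) DiDm // mulmx1 -mulmxA cc mulmx1.
clearbody P c; apply: (frame_eq2 ru); rewrite conj ?HR' ?HT conj' ?RmJ0 ?ThJ0 ?mulNmx
  ?RmRmT ?ThThT ?RmThT ?ThRmT ?mulmx0 ?mul0mx ?oppr0 //.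
  rewrite mulmxN mulNmx -[X in _ = - X]tr_diag_mx -[in RHS]/(Dm u) -PDc.
  have tD w : (Dm w)^T = Dm w :> 'M[R]_n by exact: tr_diag_mx.
  by rewrite !trmx_mul !trmxK tD mulmxA.
by rewrite mulmx0 mul0mx.
Qed.

Lemma open_loc_dom xi I J : open (loc_dom (M := M) (act xi) I J).
Proof. by have [] := loc_dom_smooth xi I J. Qed.

Lemma smooth_Dloc xi I J : smooth_on (loc_dom (M := M) (act xi) I J) (Dloc xi I J).
Proof.
have [oL sL] := loc_dom_smooth xi I J.
apply: smooth_mx => // a b; under [X in smooth_on _ X]funext do rewrite mxE.
by apply: smooth_coord => //; exact: smooth_diff.
Qed.

Lemma DlocJ0 xi I J u : loc_dom (M := M) (act xi) I J u ->
  Dloc xi I J u *m J0 *m (Dloc xi I J u)^T = J0.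
Proof.
have oL := @open_loc_dom xi I J; have sD := @smooth_Dloc xi I J.
move: u; apply: (@dense_eq _ _ _ _ (fun u => Dloc xi I J u *m J0 *m (Dloc xi I J u)^T) (cst J0) oL);
  [move=> u Lu|move=> u Lu; exact: cst_continuous|move=> u Lu ru; exact: Dloc_J0].
apply: (smooth_continuous _ Lu); apply: smooth_mulmx => //; last exact: smooth_trmx.
by apply: smooth_mulmx => //; exact: smooth_cst.
Qed.

Lemma act_preserves_form xi : preserves_form (M := M) (act xi) tomega.
Proof.
move=> I J u Lu v w; rewrite !DlocE !ev2E /tomega -!scalemxAr -!scalemxAl trmx_mul.
by rewrite mxE [RHS]mxE -{1}(DlocJ0 Lu) !mulmxA.
Qed.

Lemma act0 : act (0 : 'rV[R]_e) = id :> (M -> M).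
Proof.
by apply/funext => p; have [x [th [px ->]]] := ptP p; rewrite act_pt // addr0.
Qed.

Lemma tomega_symplectic : symplectic tomega.
Proof.
split.
- split=> [I|I u _|]; first exact: smooth_cst.
  + by rewrite /tomega linearZ /= trJ0 scalerN.
  (* A change of charts is the action of 0 read in two charts. *)
  + by rewrite -act0; exact: act_preserves_form.
- move=> I u _ v w z; rewrite /tomega !diff_cst /= /ev2 !mulmx0 /dot !mul0mx !mxE.
  by rewrite !addr0.
- move=> I u _; rewrite unitmxZ ?unitfE ?invr_eq0 ?gt_eqF ?pi_gt0 //.
  have : J0 *m (- J0) = 1%:M :> 'M[R]_(n + n) by rewrite mulmxN J0J0 opprK.
  by move=> /mulmx1_unit[].
Qed.

Lemma mul_RmT u v k : (v *m (Rm u)^T) 0 k =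
  u 0 (lshift n k) * v 0 (lshift n k) + u 0 (rshift n k) * v 0 (rshift n k).
Proof.
rewrite /Rm tr_row_mx -{1}(hsubmxK v) mul_row_col !tr_diag_mx !mul_mx_diag !mxE.
by rewrite !(mulrC (v _ _)).
Qed.

Lemma diff_sqn u v k :
  'd (fun u : 'rV[R]_(n + n) => sqn u k) u v = 2 * (v *m (Rm u)^T) 0 k.
Proof.
have dc c : is_diff u (fun y : 'rV[R]_(n + n) => y 0 c) (fun v => v 0 c).
  apply: DiffDef; first exact: differentiable_coord.
  apply/funext => w.
  have := @diff_mxE _ _ _ _ id u w 0 c; rewrite diff_val => /(_ _)/esym; exact.
have d2 : is_diff u (fun u : 'rV[R]_(n + n) => sqn u k)
   (fun v => 2 * (u 0 (lshift n k) * v 0 (lshift n k) + u 0 (rshift n k) * v 0 (rshift n k))).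
  apply: is_diff_eq; apply/funext => w.
  set a := lshift n k; set b := rshift n k.
  rewrite -[LHS]/(u 0 a * w 0 a + u 0 a * w 0 a + (u 0 b * w 0 b + u 0 b * w 0 b)).
  by ring.
rewrite (is_diffE v d2) mul_RmT; ring.
Qed.

Lemma diff_xI I u v : 'd (xI I) u v = 2 *: (v *m (Rm u)^T) *m dual I.
Proof.
have dx : differentiable (fun u : 'rV[R]_(n + n) => \row_k (sqn u k - 1)) u.
  apply: differentiable_mx => a k; under [X in differentiable X _]funext do rewrite mxE.
  apply: differentiableB => //.
  have oT : open [set: 'rV[R]_(n + n)] := openT.
  apply: (smooth_differentiable (U := setT) (f := fun u => sqn u k)) => //.
  by apply: (smooth_sqn oT (u := id)); exact: smooth_id.
pose L : {linear 'rV[R]_n -> 'rV[R]_e} := mulmxr (dual I).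
have cL : continuous L.
  have oT : open [set: 'rV[R]_n] := openT.
  move=> z; apply: (smooth_continuous (U := setT) (f := fun w => w *m dual I)) => //.
  by apply: smooth_mulmx => //; [exact: smooth_id|exact: smooth_cst].
have -> : xI I = L \o (fun u : 'rV[R]_(n + n) => \row_k (sqn u k - 1)) by [].
rewrite (diff_linE v cL dx) /=; congr (_ *m _); apply/rowP => k.
rewrite (diff_mxE _ _ _ dx) [RHS]mxE -diff_sqn.
have ds : differentiable (fun u : 'rV[R]_(n + n) => sqn u k) u.
  have oT : open [set: 'rV[R]_(n + n)] := openT.
  apply: (smooth_differentiable (U := setT) (f := fun u => sqn u k)) => //.
  by apply: (smooth_sqn oT (u := id)); exact: smooth_id.
have -> : (fun y : 'rV[R]_(n + n) => (\row_k0 (sqn y k0 - 1)) 0 k : R) =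
    (fun u : 'rV[R]_(n + n) => sqn u k) - cst 1.
  by apply/funext => y; rewrite mxE.
have dc : differentiable (cst (1 : R)) u by [].
by rewrite (diffB ds dc) /= diff_cst /= subr0.
Qed.

Lemma xof_par_near I u : imgI I u ->
  \forall w \near u, xI I w = (xof (D := D) \o parI I) w.
Proof.
move=> Iu; have oI := @open_imgI _ _ _ D I.
by apply: (open_near oI Iu) => w Iw; rewrite /= xof_par.
Qed.

Lemma diff_xof_par I u v : imgI I u ->
  'd (xof (D := D) \o parI I) u v = 2 *: (v *m (Rm u)^T) *m dual I.
Proof.
move=> Iu; have oT : open [set: 'rV[R]_(n + n)] := openT.
have dx : differentiable (xI I) u.
  apply: (smooth_differentiable (U := setT)) => //.
  by apply: (smooth_xI oT I (u := id)); exact: smooth_id.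
by rewrite (near_eq_diff (xof_par_near Iu) dx) diff_xI.
Qed.

Lemma fundamental_fieldE xi I u : imgI I u ->
  fundamental_field (M := M) (@act R n e D) xi (I : idx M) u =
  (2 * pi) *: (xi *m (dual I)^T) *m Th u.
Proof.
move=> Iu; have [th [uE px pE]] := parE Iu.
have Ix th0 : domI I (pt D (xI I u) th0) by move=> i oi; rewrite xof_pt //; exact: Iu.
rewrite /fundamental_field /= (_ : (fun t : R => _) =
  fun t => pol I (xI I u) (th + t *: xi)); last first.
  by apply/funext => t; rewrite pE act_pt // chart_pt.
have l0 k : 0 <= ell (fac I k) (xI I u) by exact: px.
have := is_diff_pol_angle th xi l0; rewrite -uE => dP.
rewrite derive1E'; last by case: dP.
by rewrite (is_diffE (1 : R) dP) scale1r.
Qed.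

Lemma toric_moment_map : moment_map (M := M) tomega (@act R n e D) (@xof R n e D).
Proof.
split.
- move=> I; rewrite imgME; have oI : open (imgI I) by exact: open_imgI.
  apply: (smooth_ext oI (f := xI I)) => [u Iu|]; first by rewrite /= xof_par.
  by apply: (smooth_xI oI I (u := id)); exact: smooth_id.
- move=> xi p; have [x [th [px ->]]] := ptP p.
  by rewrite act_pt // !xof_pt.
- move=> xi I u; rewrite imgME => Iu v.
  rewrite diff_xof_par // fundamental_fieldE // ev2E /tomega.
  set a := v *m (Rm u)^T; set b := xi *m (dual I)^T.
  have -> : dot (2 *: a *m dual I) xi = 2 * (a *m b^T) 0 0.
    by rewrite /dot /b trmx_mul trmxK -!scalemxAl mxE mulmxA.
  have -> : (2 * pi) *: b *m Th u *m (pi^-1 *: J0) *m v^T =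
      2 *: (b *m (Th u *m J0) *m v^T).
    rewrite -!scalemxAl -scalemxAr -!scalemxAl scalerA -mulrA divff ?mulr1 ?mulmxA //.
    by rewrite gt_eqF // pi_gt0.
  rewrite ThJ0 mulmxN mulNmx scalerN [X in - X]mxE opprK [RHS]mxE; congr (_ * _).
  have -> : (a *m b^T) 0 0 = ((a *m b^T)^T) 0 0 by rewrite [RHS]mxE.
  by rewrite trmx_mul trmxK /a trmx_mul trmxK mulmxA.
Qed.

Lemma toric_hamiltonian :
  hamiltonian_action (M := M) tomega (@act R n e D) (@xof R n e D).
Proof.
split; [exact: toric_torus_action|exact: toric_effective| |exact: toric_moment_map].
by move=> xi; exact: act_preserves_form.
Qed.

End ToricHamiltonian.

(** * The compatible complex structure *)

Section PositiveMatrices.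
Context {R : realType} {n : nat}.
Implicit Types (A S T : 'M[R]_n) (v w : 'rV[R]_n).

Lemma trmxD p q (A B : 'M[R]_(p, q)) : (A + B)^T = A^T + B^T.
Proof. by apply/matrixP => i j; rewrite !mxE. Qed.

Lemma dot_self_ge0 d (v : 'rV[R]_d) : 0 <= (v *m v^T) 0 0.
Proof. by rewrite mxE sumr_ge0 // => i _; rewrite mxE -expr2 sqr_ge0. Qed.

Lemma dot_self_gt0 d (v : 'rV[R]_d) : v != 0 -> 0 < (v *m v^T) 0 0.
Proof.
move=> v0; rewrite lt0r dot_self_ge0 andbT; apply: contraNneq v0 => vv0.
apply/eqP/rowP => i; rewrite mxE; apply/eqP; rewrite -sqrf_eq0.
move: vv0; rewrite mxE => /psumr_eq0P H; rewrite expr2.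
have /= := H (fun k _ => _) i isT; rewrite mxE => -> // k.
by rewrite mxE -expr2 sqr_ge0.
Qed.

(* [1 + T S] is invertible for a diagonal [T] and a symmetric [S] that are both
   positive semidefinite: if [x = - x T S] then [x T x^T = - (x T) S (x T)^T]. *)
Lemma unit_1DTS (t : 'rV[R]_n) S :
  (forall k, 0 <= t 0 k) -> S^T = S -> (forall v, 0 <= (v *m S *m v^T) 0 0) ->
  1%:M + diag_mx t *m S \in unitmx.
Proof.
move=> t0 sS pS; rewrite -row_free_unit -kermx_eq0; apply/rowV0P => x /sub_kermxP.
rewrite mulmxDr mulmx1 mulmxA => xE; set T := diag_mx t in xE.
have tT : T^T = T by exact: tr_diag_mx.
have H : (x *m T *m x^T) 0 0 + ((x *m T) *m S *m (x *m T)^T) 0 0 = 0.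
  have E : x *m T *m x^T + (x *m T) *m S *m (x *m T)^T = 0.
    by rewrite -[X in X + _]mulmxA -{1}tT -trmx_mul -mulmxDl xE mul0mx.
  by have := congr1 (fun A : 'M[R]_1 => A 0 0) E; rewrite mxE [RHS]mxE.
have xTx : (x *m T *m x^T) 0 0 = \sum_k t 0 k * (x 0 k) ^+ 2.
  rewrite mxE; apply: eq_bigr => k _; rewrite mul_mx_diag !mxE; ring.
have tx0 k : 0 <= t 0 k * (x 0 k) ^+ 2 by rewrite mulr_ge0 ?sqr_ge0.
have xTx0 : \sum_k t 0 k * (x 0 k) ^+ 2 = 0.
  apply/eqP; rewrite eq_le sumr_ge0 // andbT -xTx.
  by have := pS (x *m T); move: H; lra.
have xT0 : x *m T = 0.
  apply/rowP => k; rewrite mul_mx_diag !mxE; move/psumr_eq0P : xTx0 => /(_ (fun k _ => tx0 k)) /(_ k isT).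
  by move/eqP; rewrite mulf_eq0 sqrf_eq0 => /orP[]/eqP->; rewrite ?mulr0 ?mul0r.
by move: xE; rewrite xT0 mul0mx addr0.
Qed.

End PositiveMatrices.

(** * Linear algebra of a compatible complex structure *)

Section CompatibleAlgebra.
Context {R : realType} {n : nat}.
Variables (Rm Th : 'M[R]_(n, n + n)) (D S S' : 'M[R]_n).
Hypotheses (RJ : Rm *m J0 = Th) (TJ : Th *m J0 = - Rm).
Hypotheses (RR : Rm *m Rm^T = D) (TT : Th *m Th^T = D).
Hypotheses (RT : Rm *m Th^T = 0) (TR : Th *m Rm^T = 0).
Hypotheses (sS : S^T = S) (sS' : S'^T = S').
Hypotheses (SE : S' + S' *m D *m S = S) (SE' : S' + S *m D *m S' = S).

(** In the frame this is Rm -> (1 + D S) Th and Th -> - (1 - D S') Rm, where the two factors are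
    inverse to each other by [SE]. Written as a perturbation of [J0] it stays defined where the
    frame degenerates. *)
Definition Jmx : 'M[R]_(n + n) := J0 + Rm^T *m S *m Th + Th^T *m S' *m Rm.

Lemma RmJmx : Rm *m Jmx = Th + D *m S *m Th.
Proof. by rewrite /Jmx !mulmxDr !mulmxA RJ RR RT !mul0mx addr0. Qed.

Lemma ThJmx : Th *m Jmx = - Rm + D *m S' *m Rm.
Proof. by rewrite /Jmx !mulmxDr !mulmxA TJ TT TR !mul0mx addr0. Qed.

Lemma J0RmT : J0 *m Rm^T = - Th^T.
Proof. by rewrite -RJ trmx_mul trJ0 mulNmx opprK. Qed.

Lemma J0ThT : J0 *m Th^T = Rm^T.
Proof. by rewrite -[Rm]opprK -TJ linearN /= trmx_mul trJ0 mulNmx opprK. Qed.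

Lemma JmxJmx : Jmx *m Jmx = - 1%:M.
Proof.
rewrite {1}/Jmx !mulmxDl -!(mulmxA _ _ Jmx) RmJmx ThJmx.
rewrite /Jmx !mulmxDr J0J0 !mulmxA J0RmT J0ThT.
have E1 : Rm^T *m S *m Rm = Rm^T *m S' *m Rm + Rm^T *m S *m D *m S' *m Rm.
  by rewrite -{1}SE' mulmxDr mulmxDl !mulmxA.
have E2 : Th^T *m S *m Th = Th^T *m S' *m Th + Th^T *m S' *m D *m S *m Th.
  by rewrite -{1}SE mulmxDr mulmxDl !mulmxA.
rewrite !mulNmx !mulmxN E1 E2.
set a := Th^T *m S' *m Th; set b := Th^T *m _ *m _ *m _ *m _.
set c := Rm^T *m S' *m Rm; set d := Rm^T *m _ *m _ *m _ *m _.
apply/matrixP => i j; rewrite !mxE; ring.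
Qed.

(** The matrix of the metric omega(_, J _) up to the factor 1/pi. *)
Definition gmx : 'M[R]_(n + n) := 1%:M + Rm^T *m S *m Rm - Th^T *m S' *m Th.

Lemma J0JmxT : J0 *m Jmx^T = gmx.
Proof.
rewrite /Jmx !trmxD !trmx_mul !trmxK sS sS' trJ0 !mulmxDr mulmxN J0J0 opprK.
by rewrite !mulmxA J0ThT J0RmT !mulNmx.
Qed.

Lemma gmxT : gmx^T = gmx.
Proof.
by rewrite /gmx raddfB raddfD /= trmx1 !trmx_mul !trmxK sS sS' !mulmxA.
Qed.

Lemma JmxJ0 : Jmx *m J0 = - gmx.
Proof. by rewrite -gmxT -J0JmxT trmx_mul trmxK trJ0 mulmxN opprK. Qed.

Lemma JmxJ0JmxT : Jmx *m J0 *m Jmx^T = J0.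
Proof.
by rewrite -mulmxA J0JmxT -[gmx]opprK -JmxJ0 mulmxN mulmxA JmxJmx mulNmx mul1mx opprK.
Qed.

(** The term in S' has the wrong sign, but 1 - Th^T S' Th is the inverse of the positive matrix 1 +
    Th^T S Th. Substituting v = w (1 + Th^T S Th) leaves only nonnegative terms and |w|^2. *)
Lemma gmx_gt0 (pS : forall w : 'rV[R]_n, 0 <= (w *m S *m w^T) 0 0)
  (v : 'rV[R]_(n + n)) : v != 0 -> 0 < (v *m gmx *m v^T) 0 0.
Proof.
move=> v0; pose F := 1%:M - Th^T *m S' *m Th.
pose E := 1%:M + Th^T *m S *m Th.
have EF : E *m F = 1%:M.
  rewrite /E /F mulmxDl mul1mx mulmxBr mulmx1 !mulmxA -(mulmxA _ Th Th^T) TT.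
  have -> : Th^T *m S *m Th = Th^T *m S' *m Th + Th^T *m S *m D *m S' *m Th.
    by rewrite -{1}SE' mulmxDr mulmxDl !mulmxA.
  set a := Th^T *m S' *m Th; set b := Th^T *m _ *m _ *m _ *m _.
  apply/matrixP => i j; rewrite !mxE; ring.
have FE := mulmx1C EF.
pose w := v *m F; have vE : v = w *m E by rewrite /w -mulmxA FE mulmx1.
have w0 : w != 0 by apply: contraNneq v0 => w0; rewrite vE w0 mul0mx.
have tE : E^T = E by rewrite /E raddfD /= trmx1 !trmx_mul trmxK sS mulmxA.
have -> : (v *m gmx *m v^T) 0 0 =
  ((v *m Rm^T) *m S *m (v *m Rm^T)^T) 0 0 + (w *m w^T) 0 0 +
  ((w *m Th^T) *m S *m (w *m Th^T)^T) 0 0.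
  have -> : gmx = F + Rm^T *m S *m Rm by rewrite /gmx /F addrAC.
  have Fv : v *m F *m v^T = w *m w^T + (w *m Th^T) *m S *m (w *m Th^T)^T.
    rewrite -/w {1}vE trmx_mul tE /E mulmxDl mul1mx mulmxDr.
    by rewrite !trmx_mul trmxK !mulmxA.
  have Rv : v *m (Rm^T *m S *m Rm) *m v^T = (v *m Rm^T) *m S *m (v *m Rm^T)^T.
    by rewrite trmx_mul trmxK !mulmxA.
  rewrite mulmxDr mulmxDl Fv Rv [LHS]mxE [X in X + _ = _]mxE; ring.
have := pS (v *m Rm^T); have := pS (w *m Th^T); have := dot_self_gt0 w0; lra.
Qed.

End CompatibleAlgebra.

Section ToricComplexStructure.
Context {R : realType} {n e : nat} (D : toric_data R n e).
Implicit Types (i : facets D) (I J : charts D) (j k : 'I_n)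
  (x th xi : 'rV[R]_e) (u v : 'rV[R]_(n + n)).
Local Notation M := (tmanifold D).

Definition Bfac I i : 'rV[R]_n := \row_k dot (normal i) (row k (dual I)).

Lemma BfacE I i : Bfac I i = normal i *m (dual I)^T.
Proof. by apply/rowP => k; rewrite mxE dot_row_mul. Qed.

(* [Dm^-1 + Smx] is the Hessian [Gmx] of Guillemin's symplectic potential in the
   coordinates of the chart I, and [tJ] is its complex structure, for which
   [Rm *m tJ = Dm *m Gmx *m Th] on the open orbit. The pole [Dm^-1] only enters
   through [Qmx = Dm *m Gmx], which is defined on the whole chart. *)
Definition Smx I u : 'M[R]_n :=
  \sum_(i | outI I i) (ell i (xI I u))^-1 *: ((Bfac I i)^T *m Bfac I i).
Definition Qmx I u : 'M[R]_n := 1%:M + Dm u *m Smx I u.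
(** The correction in the inverse Hessian: by the Woodbury identity the inverse of Dm^-1 + Smx is Dm
    - Dm Smx' Dm. *)
Definition Smx' I u : 'M[R]_n := Smx I u *m invmx (Qmx I u).
Definition tJ : endofield M := fun I u => Jmx (Rm u) (Th u) (Smx I u) (Smx' I u).

Lemma tr_Smx I u : (Smx I u)^T = Smx I u.
Proof.
rewrite /Smx raddf_sum; apply: eq_bigr => i _.
by rewrite /= linearZ /= trmx_mul trmxK.
Qed.

Lemma Smx_ge0 I u (w : 'rV[R]_n) : imgI I u -> 0 <= (w *m Smx I u *m w^T) 0 0.
Proof.
move=> Iu; rewrite /Smx mulmx_sumr mulmx_suml summxE sumr_ge0 // => i /Iu/ltW li.
rewrite -scalemxAr -scalemxAl mxE mulr_ge0 ?invr_ge0 //.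
have -> : w *m ((Bfac I i)^T *m Bfac I i) *m w^T =
  (w *m (Bfac I i)^T) *m (w *m (Bfac I i)^T)^T.
  by rewrite [(w *m _)^T]trmx_mul trmxK !mulmxA.
exact: dot_self_ge0.
Qed.

Lemma Qmx_unit I u : imgI I u -> Qmx I u \in unitmx.
Proof.
move=> Iu; apply: unit_1DTS; [|exact: tr_Smx|by move=> w; exact: Smx_ge0].
by move=> k; rewrite mxE sqn_ge0.
Qed.

Lemma tr_Dm u : (Dm u)^T = Dm u. Proof. exact: tr_diag_mx. Qed.

Lemma SmxE I u : imgI I u -> Smx' I u + Smx' I u *m Dm u *m Smx I u = Smx I u.
Proof.
move=> Iu; rewrite -{1}[Smx' I u]mulmx1 -mulmxA -mulmxDr -/(Qmx I u).
by rewrite /Smx' mulmxKV // Qmx_unit.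
Qed.

Lemma SmxE' I u : imgI I u -> Smx' I u + Smx I u *m Dm u *m Smx' I u = Smx I u.
Proof.
move=> Iu; rewrite -{1}[Smx' I u]mul1mx -mulmxDl /Smx' mulmxA.
have -> : (1%:M + Smx I u *m Dm u) *m Smx I u = Smx I u *m Qmx I u.
  by rewrite /Qmx mulmxDl mulmxDr mul1mx mulmx1 mulmxA.
by rewrite mulmxK // Qmx_unit.
Qed.

Lemma tr_Smx' I u : imgI I u -> (Smx' I u)^T = Smx' I u.
Proof.
move=> Iu; have Qu := Qmx_unit Iu.
have QuT : (Qmx I u)^T \in unitmx by rewrite unitmx_tr.
have E : (Qmx I u)^T *m Smx' I u = Smx I u.
  rewrite -[RHS](SmxE' Iu) /Qmx raddfD /= trmx1 trmx_mul tr_Smx tr_Dm.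
  by rewrite mulmxDl mul1mx.
apply: (can_inj (mulKmx QuT)); rewrite E /Smx' trmx_mul tr_Smx trmx_inv.
by rewrite mulKVmx.
Qed.

Lemma Rm_tJ I u : Rm u *m tJ I u = Th u + Dm u *m Smx I u *m Th u.
Proof. by apply: RmJmx; [exact: RmJ0|exact: RmRmT|exact: RmThT]. Qed.

Lemma Rm_tJ_Q I u : Rm u *m tJ I u = Qmx I u *m Th u.
Proof. by rewrite Rm_tJ /Qmx mulmxDl mul1mx. Qed.

Lemma Th_tJ I u : Th u *m tJ I u = - Rm u + Dm u *m Smx' I u *m Rm u.
Proof. by apply: ThJmx; [exact: ThJ0|exact: ThThT|exact: ThRmT]. Qed.

Lemma tJ_sqr I u : imgI I u -> tJ I u *m tJ I u = - 1%:M.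
Proof.
move=> Iu; apply: JmxJmx; rewrite ?RmJ0 ?ThJ0 ?RmRmT ?ThThT ?RmThT ?ThRmT //.
- exact: SmxE.
- exact: SmxE'.
Qed.

Lemma smooth_Rm : smooth_on setT (@Rm R n).
Proof.
have oT : open [set: 'rV[R]_(n + n)] := openT.
apply: smooth_mx => // a c; rewrite -(splitK c).
have sc b (r : R) : smooth_on setT (fun u : 'rV[R]_(n + n) => u 0 b * r).
  apply: smoothM => //; last exact: smooth_cst.
  by apply: smooth_coord => //; exact: smooth_id.
case: (fintype.split c) => k /=; rewrite /Rm.
  rewrite (_ : (fun _ => _) = fun u : 'rV[R]_(n + n) => u 0 (lshift n a) * (a == k)%:R) //.
  by apply/funext => u; rewrite row_mxEl !mxE mulr_natr.
rewrite (_ : (fun _ => _) = fun u : 'rV[R]_(n + n) => u 0 (rshift n a) * (a == k)%:R) //.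
by apply/funext => u; rewrite row_mxEr !mxE mulr_natr.
Qed.

Lemma smooth_Th : smooth_on setT (@Th R n).
Proof.
under [X in smooth_on _ X]funext do rewrite -RmJ0.
by apply: smooth_mulmx; [exact: openT|exact: smooth_Rm|exact: smooth_cst].
Qed.

Lemma smooth_Dm : smooth_on setT (@Dm R n).
Proof.
have oT : open [set: 'rV[R]_(n + n)] := openT.
under [X in smooth_on _ X]funext do rewrite -RmRmT.
by apply: smooth_mulmx => //; [|apply: smooth_trmx => //]; exact: smooth_Rm.
Qed.

Lemma smooth_Smx I : smooth_on (imgI I) (Smx I).
Proof.
have oI := @open_imgI _ _ _ D I.
apply: smooth_sum => // i oi; apply: smooth_scalemx => //; last exact: smooth_cst.
apply: smoothV => // [u Iu|]; first by rewrite gt_eqF //; exact: Iu.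
by apply: smooth_ell => //; apply: (smooth_xI oI I (u := id)); exact: smooth_id.
Qed.

Lemma smooth_Qmx I : smooth_on (imgI I) (Qmx I).
Proof.
have oI := @open_imgI _ _ _ D I.
apply: smoothD => //; first exact: smooth_cst.
apply: smooth_mulmx => //; last exact: smooth_Smx.
by apply: smooth_sub smooth_Dm.
Qed.

Lemma smooth_Smx' I : smooth_on (imgI I) (Smx' I).
Proof.
have oI := @open_imgI _ _ _ D I.
apply: smooth_mulmx => //; first exact: smooth_Smx.
by apply: smooth_invmx => // [u Iu|]; [exact: Qmx_unit|exact: smooth_Qmx].
Qed.

Lemma smooth_tJ I : smooth_on (imgI I) (tJ I).
Proof.
have oI := @open_imgI _ _ _ D I.
have sR : smooth_on (imgI I) (@Rm R n) by apply: smooth_sub smooth_Rm.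
have sT : smooth_on (imgI I) (@Th R n) by apply: smooth_sub smooth_Th.
apply: smoothD => //; [apply: smoothD => //; first exact: smooth_cst|];
  (apply: smooth_mulmx => //; apply: smooth_mulmx => //; first exact: smooth_trmx).
  exact: smooth_Smx.
exact: smooth_Smx'.
Qed.

Lemma Bfac_fac I k : Bfac I (fac I k) = delta_mx 0 k.
Proof.
apply/rowP => j; rewrite !mxE dotC dual_fac eqxx /=.
by rewrite eq_sym.
Qed.

Definition Gmx I u : 'M[R]_n :=
  \sum_i (ell i (xI I u))^-1 *: ((Bfac I i)^T *m Bfac I i).

(** On the facets of the chart [Bfac] is a standard basis vector, so they contribute exactly the
    pole [Di] to the Hessian. *)
Lemma QmxE I u : regp u -> Qmx I u = Dm u *m Gmx I u.
Proof.
move=> ru; rewrite /Qmx -(DmDi ru) -mulmxDr; congr (_ *m _).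
rewrite /Gmx (bigID (outI I)) /= addrC; congr (_ + _).
rewrite (eq_bigl (fun i => i \in [set fac I k | k in 'I_n]%SET)); last first.
  by move=> i; rewrite negbK; apply/codomP/imsetP => [[k ->]|[k _ ->]]; exists k.
rewrite big_imset => [|j k _ _]; last exact: fac_inj.
rewrite /Di diag_mx_sum_delta; apply: eq_bigr => k _.
by rewrite Bfac_fac trmx_delta mul_delta_mx ell_xI mxE.
Qed.

(** J sends the radial frame to Dm Gmx Th. The Hessian changes as a quadratic form under the
    constant matrix c, and the two frames change by inverse transposes, so the factors cancel. *)
Lemma Dloc_tJ_reg xi I J u : loc_dom (M := M) (act xi) I J u -> regp u ->
  tJ I u *m Dloc xi I J u = Dloc xi I J u *m tJ J (loc (M := M) (act xi) I J u).
Proof.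
move=> Lu ru; have [HT HR] := frames_Dloc Lu ru.
have [Iu' xE] := imgI_loc Lu; have [Iu _] := (loc_domE _ _ _ _).1 Lu.
set u' := loc _ _ _ _ in HT HR Iu' xE *; set Dt := Dloc _ _ _ _ in HT HR *.
have ru' : regp u' by exact: regp_loc.
set c := nmx I *m _ in HT; set c' := dual I *m _ in HR.
have cc : c' *m c^T = 1%:M.
  rewrite /c /c' trmx_mul trmxK -mulmxA (mulmxA (nmx J)^T) nmxT_dual mul1mx.
  exact: dual_nmxT.
have GE : Gmx J u' = c^T *m Gmx I u *m c.
  rewrite /Gmx xE mulmx_sumr mulmx_suml; apply: eq_bigr => i _.
  rewrite -scalemxAr -scalemxAl; congr (_ *: _).
  have -> : Bfac J i = Bfac I i *m c.
    by rewrite !BfacE /c mulmxA -(mulmxA (normal i)) dual_normal mulmx1.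
  by rewrite trmx_mul !mulmxA.
have HR' : Rm u *m Dt = Dm u *m c' *m Di u' *m Rm u'.
  have -> : Rm u *m Dt = Dm u *m (Di u *m Rm u *m Dt) by rewrite !mulmxA DmDi // mul1mx.
  by rewrite HR !mulmxA.
clearbody c c'.
have RE : Rm u *m (tJ I u *m Dt) = Rm u *m (Dt *m tJ J u').
  rewrite !mulmxA HR' Rm_tJ_Q -!mulmxA HT Rm_tJ_Q !QmxE // GE.
  rewrite -!(mulmxA (Dm u)); congr (_ *m _).
  by rewrite -!mulmxA (mulmxA (Di u')) DiDm // mul1mx (mulmxA c') cc mul1mx.
apply: (frame_eq ru) => //.
(* [Th] is a multiple of Rm J, so the angular half of the frame follows from the radial half and J^2
   = -1. *)
have ThE : Th u = invmx (Qmx I u) *m (Rm u *m tJ I u).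
  by rewrite Rm_tJ_Q mulKmx // Qmx_unit.
rewrite ThE -!mulmxA; congr (_ *m _); rewrite (mulmxA (tJ I u) (tJ I u)) tJ_sqr //.
rewrite [in RHS](mulmxA (tJ I u)) (mulmxA (Rm u) (tJ I u *m Dt)) RE -!mulmxA tJ_sqr //.
by rewrite mulNmx mul1mx !mulmxN mulmx1.
Qed.

Lemma Dloc_tJ xi I J u : loc_dom (M := M) (act xi) I J u ->
  tJ I u *m Dloc xi I J u = Dloc xi I J u *m tJ J (loc (M := M) (act xi) I J u).
Proof.
have [oL sL] := loc_dom_smooth xi I J; have sD := @smooth_Dloc _ _ _ D xi I J.
have LI : loc_dom (M := M) (act xi) I J `<=` imgI I.
  by move=> w /loc_domE[].
have sJI : smooth_on (loc_dom (M := M) (act xi) I J) (tJ I).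
  by apply: smooth_sub (@smooth_tJ I).
have sJJ : smooth_on (loc_dom (M := M) (act xi) I J) (tJ J \o loc (M := M) (act xi) I J).
  apply: (smooth_comp_mx oL (@open_imgI _ _ _ D J) _ sL (@smooth_tJ J)).
  by move=> w /imgI_loc[].
move: u; apply: (@dense_eq _ _ _ _ (fun u => tJ I u *m Dloc xi I J u)
  (fun u => Dloc xi I J u *m (tJ J \o loc (M := M) (act xi) I J) u) oL) => u Lu.
- by apply: (smooth_continuous _ Lu); exact: smooth_mulmx.
- by apply: (smooth_continuous _ Lu); exact: smooth_mulmx.
- exact: Dloc_tJ_reg.
Qed.

Lemma tJ_preserved xi : preserves_endo (M := M) (act xi) tJ.
Proof. by move=> I J u Lu v; rewrite !DlocE -!mulmxA Dloc_tJ. Qed.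

Lemma tJ_almost_complex : almost_complex tJ.
Proof.
split=> [I|I u|]; rewrite ?imgME; [exact: smooth_tJ|exact: tJ_sqr|].
by rewrite -(act0 D); exact: tJ_preserved.
Qed.

Lemma tJ_g I u : imgI I u ->
  J0 *m (tJ I u)^T = gmx (Rm u) (Th u) (Smx I u) (Smx' I u).
Proof.
by move=> Iu; apply: J0JmxT; rewrite ?RmJ0 ?ThJ0 //; [exact: tr_Smx|exact: tr_Smx'].
Qed.

Lemma tJ_compatible : compatible (@tomega R n e D) tJ.
Proof.
move=> I u; rewrite imgME => Iu; split=> [v v0|v w]; rewrite /tomega !ev2E.
  rewrite -scalemxAr -scalemxAl mxE mulr_gt0 ?invr_gt0 ?pi_gt0 //.
  rewrite trmx_mul mulmxA -(mulmxA v) tJ_g //.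
  apply: (@gmx_gt0 _ _ (Rm u) (Th u) (Dm u)) => //.
  - exact: ThThT.
  - exact: tr_Smx.
  - exact: SmxE'.
  - by move=> z; exact: Smx_ge0.
have E : tJ I u *m J0 *m (tJ I u)^T = J0.
  apply: (@JmxJ0JmxT _ _ _ _ (Dm u)); rewrite ?RmJ0 ?ThJ0 ?RmRmT ?ThThT ?RmThT ?ThRmT //.
  - exact: tr_Smx.
  - exact: tr_Smx'.
  - exact: SmxE.
  - exact: SmxE'.
by rewrite -!scalemxAr -!scalemxAl mxE [RHS]mxE trmx_mul -{2}E !mulmxA.
Qed.

End ToricComplexStructure.

(** * Derivatives of matrix-valued functions *)

Section MatrixCalculus.
Context {R : realType} {V : normedModType R}.
Implicit Types (x v : V).

Lemma diff_addE (W : normedModType R) (A B : V -> W) x v :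
  differentiable A x -> differentiable B x ->
  'd (fun u => A u + B u) x v = 'd A x v + 'd B x v.
Proof. by move=> dA dB; exact: (congr1 (fun h : V -> W => h v) (diffD dA dB)). Qed.

Lemma diff_subE (W : normedModType R) (A B : V -> W) x v :
  differentiable A x -> differentiable B x ->
  'd (fun u => A u - B u) x v = 'd A x v - 'd B x v.
Proof. by move=> dA dB; exact: (congr1 (fun h : V -> W => h v) (diffB dA dB)). Qed.

Lemma diff_mulE (A B : V -> R) x v : differentiable A x -> differentiable B x ->
  'd (fun u => A u * B u) x v = A x * 'd B x v + B x * 'd A x v.
Proof. by move=> dA dB; exact: (congr1 (fun h : V -> R => h v) (diffM dA dB)). Qed.

Lemma diff_cstE (W : normedModType R) (w : W) x v : 'd (fun=> w) x v = 0.
Proof. exact: (congr1 (fun h : V -> W => h v) (diff_cst w x)). Qed.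

Lemma diff_sumE (W : normedModType R) (I : Type) (r : seq I) (A : I -> V -> W) x v :
  (forall i, differentiable (A i) x) ->
  'd (fun u => \sum_(i <- r) A i u) x v = \sum_(i <- r) 'd (A i) x v.
Proof.
move=> dA; suff [] : differentiable (fun u => \sum_(i <- r) A i u) x /\
  'd (fun u => \sum_(i <- r) A i u) x v = \sum_(i <- r) 'd (A i) x v by [].
elim: r => [|i r [IHd IHv]].
  under [X in differentiable X _]funext do rewrite big_nil.
  by rewrite big_nil; split=> //; rewrite -[RHS](diff_cstE (0 : W) x v); congr ('d _ x v);
   apply/funext => u; rewrite big_nil.
have E : (fun u => \sum_(j <- i :: r) A j u) = fun u => A i u + \sum_(j <- r) A j u.
  by apply/funext => u; rewrite big_cons.
rewrite E big_cons -IHv; split; first exact: differentiableD.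
by apply: diff_addE.
Qed.

Lemma differentiable_coordE p q (A : V -> 'M[R]_(p, q)) x i j :
  differentiable A x -> differentiable (fun u => A u i j) x.
Proof.
move=> dA; apply: (@differentiable_comp _ _ _ _ A (fun M : 'M[R]_(p, q) => M i j)) => //.
exact: differentiable_coord.
Qed.

Lemma differentiable_mulmx p q r (A : V -> 'M[R]_(p, q)) (B : V -> 'M[R]_(q, r)) x :
  differentiable A x -> differentiable B x -> differentiable (fun u => A u *m B u) x.
Proof.
move=> dA dB; apply: differentiable_mx => i j.
under [X in differentiable X _]funext do rewrite mxE.
rewrite (_ : (fun _ => _) = \sum_k (fun u => A u i k * B u k j)); last first.
  by apply/funext => u; rewrite fct_sumE.
apply: differentiable_sum => k.
by apply: differentiableM; exact: differentiable_coordE.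
Qed.

Lemma diff_mulmxE p q r (A : V -> 'M[R]_(p, q)) (B : V -> 'M[R]_(q, r)) x v :
  differentiable A x -> differentiable B x ->
  'd (fun u => A u *m B u) x v = 'd A x v *m B x + A x *m 'd B x v.
Proof.
move=> dA dB; apply/matrixP => i j.
rewrite diff_mxE; last exact: differentiable_mulmx.
have E : (fun y => (A y *m B y) i j) = (fun y => \sum_k A y i k * B y k j).
  by apply/funext => y; rewrite mxE.
rewrite E diff_sumE => [|k]; last by apply: differentiableM; exact: differentiable_coordE.
rewrite !mxE -big_split /=; apply: eq_bigr => k _.
apply: etrans (diff_mulE v _ _) _; try exact: differentiable_coordE.
rewrite addrC [B x k j * _]mulrC; congr (_ * _ + _ * _); apply/esym; exact: diff_mxE.
Qed.

Lemma diff_cst_mulmxE p q r (A : 'M[R]_(p, q)) (B : V -> 'M[R]_(q, r)) x v :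
  differentiable B x -> 'd (fun u => A *m B u) x v = A *m 'd B x v.
Proof.
move=> dB; have dA : differentiable (fun _ : V => A) x by exact: differentiable_cst.
apply: etrans (diff_mulmxE v dA dB) _.
apply: etrans (congr1 (fun z => z *m B x + _) (diff_cstE A x v)) _.
by rewrite mul0mx add0r.
Qed.

Lemma diff_trE p (A : V -> 'M[R]_p) x v :
  differentiable A x -> 'd (fun u => \tr (A u)) x v = \tr ('d A x v).
Proof.
move=> dA; rewrite /mxtrace diff_sumE => [|k]; last exact: differentiable_coordE.
by apply: eq_bigr => k _; rewrite diff_mxE.
Qed.

Lemma diff_col_mxE p q r (A : V -> 'M[R]_(p, r)) (B : V -> 'M[R]_(q, r)) x v :
  differentiable A x -> differentiable B x ->
  differentiable (fun u => col_mx (A u) (B u)) x /\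
  'd (fun u => col_mx (A u) (B u)) x v = col_mx ('d A x v) ('d B x v).
Proof.
move=> dA dB; have d : differentiable (fun u => col_mx (A u) (B u)) x.
  apply: differentiable_mx => i j; rewrite -(splitK i); case: (fintype.split i) => k /=.
    by under [X in differentiable X _]funext do rewrite col_mxEu; exact: differentiable_coordE.
  by under [X in differentiable X _]funext do rewrite col_mxEd; exact: differentiable_coordE.
split=> //; apply/matrixP => i j; rewrite diff_mxE // -(splitK i).
case: (fintype.split i) => k /=.
  rewrite col_mxEu diff_mxE //; congr ('d _ x v); apply/funext => u.
  by rewrite col_mxEu.
rewrite col_mxEd diff_mxE //; congr ('d _ x v); apply/funext => u.
by rewrite col_mxEd.
Qed.

Lemma eq_diff (W : normedModType R) (U : set V) (A B : V -> W) x v :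
  open U -> (forall u, U u -> A u = B u) -> U x -> differentiable A x ->
  'd A x v = 'd B x v.
Proof.
move=> oU AB Ux dA.
have nAB : \forall u \near x, A u = B u by exact: open_near AB.
by rewrite (near_eq_diff nAB dA).
Qed.

Lemma diff_compE (W X : normedModType R) (f : V -> W) (g : W -> X) x v :
  differentiable f x -> differentiable g (f x) ->
  'd (fun y => g (f y)) x v = 'd g (f x) ('d f x v).
Proof. by move=> df dg; exact: (congr1 (fun h : V -> X => h v) (diff_comp df dg)). Qed.

Lemma diff_linP (W : normedModType R) (f : V -> W) x a v w :
  'd f x (a *: v + w) = a *: 'd f x v + 'd f x w.
Proof. by rewrite linearP. Qed.

Lemma eq_diff_mul p q r (U : set V) (A : V -> 'M[R]_(p, r)) (B : V -> 'M[R]_(p, q))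
    (C : V -> 'M[R]_(q, r)) x v :
  open U -> U x -> (forall u, U u -> A u = B u *m C u) ->
  differentiable A x -> differentiable B x -> differentiable C x ->
  'd A x v = 'd B x v *m C x + B x *m 'd C x v.
Proof.
move=> oU Ux E dA dB dC; apply: etrans (diff_mulmxE v dB dC).
exact: eq_diff oU E Ux dA.
Qed.

Lemma eq_diff_mul2 p q s r (U : set V) (A : V -> 'M[R]_(p, s)) (A' : V -> 'M[R]_(s, r))
    (B : V -> 'M[R]_(p, q)) (C : V -> 'M[R]_(q, r)) x v :
  open U -> U x -> (forall u, U u -> A u *m A' u = B u *m C u) ->
  differentiable A x -> differentiable A' x -> differentiable B x -> differentiable C x ->
  'd A x v *m A' x + A x *m 'd A' x v = 'd B x v *m C x + B x *m 'd C x v.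
Proof.
move=> oU Ux E dA dA' dB dC; apply: etrans (esym (diff_mulmxE v dA dA')) _.
by apply: eq_diff_mul oU Ux E _ dB dC; exact: differentiable_mulmx.
Qed.

End MatrixCalculus.

Section Pullback.
Context {R : realType} {m : nat}.

Lemma jac_comp p (U : set 'rV[R]_m) (f : 'rV[R]_m -> 'rV[R]_m) (g h : 'rV[R]_m -> 'rV[R]_p) u :
  open U -> U u -> (forall w, U w -> h w = g (f w)) ->
  differentiable f u -> differentiable g (f u) ->
  lin1_mx ('d h u) = lin1_mx ('d f u) *m lin1_mx ('d g (f u)).
Proof.
move=> oU Uu E df dg; apply/row_matrixP => i; rewrite !rowE mulmxA !mul_rV_lin1.
apply: etrans (diff_compE _ df dg); apply/esym.
apply: (@eq_diff _ _ _ U (fun w => g (f w)) h u _ oU _ Uu) => [w /E //|].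
exact: differentiable_comp.
Qed.

Lemma connection_transition (f : 'rV[R]_m -> 'rV[R]_m) (T : 'rV[R]_m -> 'M[R]_m)
    (G G' : 'M[R]_m) u v s :
  (forall u v, 'd f u v = v *m T u) -> differentiable T u ->
  G *m T u = 'd T u v + T u *m G' ->
  'd f u (s *m G) = 'd (fun x => 'd f x s) u v + 'd f u s *m G'.
Proof.
move=> fT dT E; have FE : (fun x => 'd f x s) = fun x => s *m T x by apply/funext => x; exact: fT.
apply: etrans (fT u _) _; rewrite -mulmxA E mulmxDr mulmxA.
congr (_ + _); last by congr (_ *m _); exact/esym/fT.
by rewrite FE; exact/esym/diff_cst_mulmxE.
Qed.

End Pullback.

(* For a J-linear connection [dJ v = [Gamma v, J]]; both uses of this identity
   compare a curvature-like trace with [tr (J dJ v dJ w)]. *)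
Lemma trace_J_commutators (R : realType) p (J A B : 'M[R]_p) :
  J *m J = - 1%:M ->
  \tr (J *m (J *m A - A *m J) *m (J *m B - B *m J)) =
  2 * \tr ((A *m B - B *m A) *m J).
Proof.
move=> JJ.
have E1 : \tr (A *m J *m B) = \tr (B *m A *m J).
  by rewrite mxtrace_mulC mulmxA.
have E2 : J *m A *m J *m J *m B = - (J *m (A *m B)).
  by rewrite -(mulmxA _ J J) JJ mulmxN mulNmx mulmx1 -mulmxA.
have E3 : \tr (J *m A *m J *m B *m J) = - \tr (B *m A *m J).
  by rewrite mxtrace_mulC !mulmxA JJ !mulNmx mul1mx -E1; exact: raddfN.
have E4 : \tr (J *m (A *m B)) = \tr (A *m B *m J) by rewrite mxtrace_mulC.
have -> : J *m (J *m A - A *m J) *m (J *m B - B *m J) =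
   A *m B *m J + J *m (A *m B) + J *m A *m J *m B *m J - A *m J *m B.
  rewrite !mulmxBr !mulmxBl !mulmxA !JJ !mulNmx !mul1mx E2 opprK !opprD !opprK.
  by rewrite mulmxA [LHS](AC (2*2) (3*2*4*1)).
have -> (C1 C2 C3 C4 : 'M[R]_p) : \tr (C1 + C2 + C3 - C4) =
    \tr C1 + \tr C2 + \tr C3 - \tr C4.
  by rewrite raddfB /= !mxtraceD.
have -> (C1 C2 : 'M[R]_p) : \tr ((C1 - C2) *m J) = \tr (C1 *m J) - \tr (C2 *m J).
  by rewrite mulmxBl raddfB.
rewrite E1 E3 E4; ring.
Qed.

Section JLinearConnection.
Context {R : realType} {m : nat} (M : manifold R m).

Lemma christoffel_lin1 (g : 'rV[R]_m -> 'M[R]_m) (v : 'rV[R]_m) :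
  linear g -> vec_mx (v *m \matrix_a mxvec (g (delta_mx 0 a))) = g v.
Proof.
move=> lg; pose gM := GRing.isLinear.Build _ _ _ _ _ lg.
pose gL : {linear 'rV[R]_m -> 'M[R]_m} := HB.pack g gM.
rewrite -[g v]/(gL v) [in RHS](row_sum_delta v) linear_sum /=.
rewrite mulmx_sum_row linear_sum /=; apply: eq_bigr => a _.
by rewrite linearZ /= rowK mxvecK -[RHS]/(gL _) linearZ.
Qed.

End JLinearConnection.

(** * A complex linear connection *)

Section Jacobians.
Context {R : realType} {m : nat}.

Lemma mul_jac p (f : 'rV[R]_m -> 'rV[R]_p) u v : v *m lin1_mx ('d f u) = 'd f u v.
Proof. by rewrite mul_rV_lin1. Qed.

Lemma smooth_jac p (U : set 'rV[R]_m) (f : 'rV[R]_m -> 'rV[R]_p) :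
  open U -> smooth_on U f -> smooth_on U (fun u => lin1_mx ('d f u)).
Proof.
move=> oU sf; apply: smooth_mx => // i j.
under [X in smooth_on _ X]funext do rewrite mxE.
by apply: smooth_coord => //; exact: smooth_diff.
Qed.

Lemma diff_lin_idE (u v : 'rV[R]_m) : 'd (fun w : 'rV[R]_m => w) u v = v.
Proof. exact: (is_diffE v (is_diff_id u)). Qed.

Lemma eq_mulrV p q (A B : 'M[R]_(p, q)) :
  (forall v : 'rV[R]_p, v *m A = v *m B) -> A = B.
Proof. by move=> AB; apply/row_matrixP => i; rewrite !rowE AB. Qed.

(** If v E E^T = 0 then |v E|^2 = 0, and the right inverse K gives v = 0. *)
Lemma gram_unit p q (E : 'M[R]_(p, q)) (K : 'M[R]_(q, p)) :
  E *m K = 1%:M -> E *m E^T \in unitmx.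
Proof.
move=> EK; rewrite -row_free_unit; apply: inj_row_free => v vE.
have vE0 : v *m E = 0.
  apply/eqP; apply: contraT => /dot_self_gt0.
  by rewrite trmx_mul mulmxA -(mulmxA v) vE mul0mx mxE ltxx.
by rewrite -[v]mulmx1 -EK mulmxA vE0 mul0mx.
Qed.

Lemma smooth_mxvec (V : normedModType R) (U : set V) p q (f : V -> 'M[R]_(p, q)) :
  open U -> smooth_on U f -> smooth_on U (fun u => mxvec (f u)).
Proof.
move=> oU sf; apply: smooth_mx => // a j; case/mxvec_indexP: j => i j.
rewrite [a]ord1; under [X in smooth_on _ X]funext do rewrite mxvecE.
exact: smooth_coord.
Qed.

End Jacobians.

Section ConnectionAlgebra.
Context {R : realType} {p q : nat}.

(* [G0] is a connection matrix, [dJ] the derivative of [J]: averaging with the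
   conjugate connection makes [J] parallel. *)
Definition Jpart (G0 dJ J : 'M[R]_p) : 'M[R]_p :=
  2^-1 *: (G0 - dJ *m J - J *m G0 *m J).

Lemma Jpart_linear a (G G' dJ dJ' J : 'M[R]_p) :
  Jpart (a *: G + G') (a *: dJ + dJ') J = a *: Jpart G dJ J + Jpart G' dJ' J.
Proof.
rewrite /Jpart mulmxDr !mulmxDl -scalemxAr -!scalemxAl.
move: (J *m G *m J) (J *m G' *m J) (dJ *m J) (dJ' *m J) => A B A' B'.
by apply/matrixP => i j; rewrite !mxE; ring.
Qed.

Lemma Jpart_parallel (G0 dJ J : 'M[R]_p) : J *m J = - 1%:M ->
  dJ *m J + J *m dJ = 0 ->
  dJ + J *m Jpart G0 dJ J - Jpart G0 dJ J *m J = 0.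
Proof.
move=> JJ /eqP; rewrite addr_eq0 => /eqP dJJ.
rewrite /Jpart -scalemxAr -scalemxAl !mulmxBr !mulmxBl.
have E1 : J *m (dJ *m J) = dJ.
  by rewrite mulmxA -[J *m dJ]opprK -dJJ mulNmx -mulmxA JJ mulmxN opprK mulmx1.
have E2 : J *m (J *m G0 *m J) = - (G0 *m J).
  by rewrite !mulmxA JJ mulNmx mul1mx mulNmx.
have E3 : dJ *m J *m J = - dJ by rewrite -mulmxA JJ mulmxN mulmx1.
have E4 : J *m G0 *m J *m J = - (J *m G0) by rewrite -mulmxA JJ mulmxN mulmx1.
rewrite E1 E2 E3 E4 !opprK; move: (J *m G0) (G0 *m J) => a b.
rewrite -addrA -scalerBr.
have -> : a - dJ + b - (b + dJ + a) = (- 2 : R) *: dJ.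
  by apply/matrixP => i j; rewrite !mxE; ring.
by rewrite scalerA mulrN mulVf ?pnatr_eq0 // scaleN1r subrr.
Qed.

(** Each of the two averaged connections contributes one half of the inhomogeneous term dT; the
    terms J dT J' cancel. *)
Lemma Jpart_transition (T dT G0 G0' dJ dJ' J J' : 'M[R]_p) :
  J *m J = - 1%:M -> J' *m J' = - 1%:M -> J *m T = T *m J' ->
  dJ *m T + J *m dT = dT *m J' + T *m dJ' ->
  G0 *m T = dT + T *m G0' ->
  Jpart G0 dJ J *m T = dT + T *m Jpart G0' dJ' J'.
Proof.
move=> JJ JJ' JT dJT GT; rewrite /Jpart -scalemxAl -scalemxAr !mulmxBl !mulmxBr GT.
have E1 : dJ *m J *m T = - dT + T *m dJ' *m J' - J *m dT *m J'.
  rewrite -mulmxA JT mulmxA.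
  have -> : dJ *m T = dT *m J' + T *m dJ' - J *m dT by rewrite -dJT addrK.
  by rewrite mulmxBl mulmxDl -(mulmxA dT) JJ' mulmxN mulmx1.
have E2 : J *m G0 *m J *m T = J *m dT *m J' + T *m (J' *m G0' *m J').
  rewrite -!mulmxA JT !mulmxA -(mulmxA J G0) GT mulmxDr mulmxDl; congr (_ + _).
  by rewrite [J *m (T *m _)]mulmxA JT.
rewrite E1 E2 -!mulmxA.
move: (T *m G0') (T *m (dJ' *m J')) (J *m (dT *m J')) (T *m _) => a b c g.
by apply/matrixP => i j; rewrite !mxE; field.
Qed.

Lemma pinv_transition (T : 'M[R]_p) (E E' : 'M[R]_(p, q)) :
  T \in unitmx -> E = T *m E' -> E' *m E'^T \in unitmx ->
  E^T *m invmx (E *m E^T) *m T = E'^T *m invmx (E' *m E'^T).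
Proof.
move=> uT -> uE; have uTt : T^T \in unitmx by rewrite unitmx_tr.
rewrite trmx_mul !mulmxA -(mulmxA T) -(mulmxA T).
move: uE; set G := E' *m E'^T; clearbody G => uG.
have -> : invmx (T *m (G *m T^T)) = invmx T^T *m (invmx G *m invmx T).
  have uX : T *m (G *m T^T) \in unitmx by rewrite !unitmx_mul uT uG uTt.
  apply: (can_inj (mulKmx uX)); rewrite mulmxV // -!mulmxA (mulKVmx uTt).
  by rewrite (mulKVmx uG) mulmxV.
by rewrite -!mulmxA (mulKVmx uTt) mulVmx // mulmx1.
Qed.

End ConnectionAlgebra.

Section Transitions.
Context {R : realType} {m q : nat}.
Variables (U : set 'rV[R]_m) (f : 'rV[R]_m -> 'rV[R]_m) (T : 'rV[R]_m -> 'M[R]_m).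
Variables (u v : 'rV[R]_m).
Hypotheses (oU : open U) (Uu : U u) (fT : forall u v, 'd f u v = v *m T u).
Hypotheses (df : differentiable f u) (dT : differentiable T u).

Lemma pull_diff p r (A : 'rV[R]_m -> 'M[R]_(p, r)) :
  differentiable A (f u) -> differentiable (fun w => A (f w)) u /\
  'd (fun w => A (f w)) u v = 'd A (f u) (v *m T u).
Proof.
move=> dA; split; first exact: (@differentiable_comp _ _ _ _ f A).
by rewrite -fT; exact: (diff_compE v df dA).
Qed.

Lemma gram_connection_transition (E E' : 'rV[R]_m -> 'M[R]_(m, q)) :
  (forall w, U w -> E w = T w *m E' (f w)) ->
  differentiable E u -> differentiable E' (f u) ->
  T u \in unitmx -> E' (f u) *m (E' (f u))^T \in unitmx ->
  'd E u v *m ((E u)^T *m invmx (E u *m (E u)^T)) *m T u =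
  'd T u v + T u *m ('d E' (f u) (v *m T u) *m
     ((E' (f u))^T *m invmx (E' (f u) *m (E' (f u))^T))).
Proof.
move=> ET dE dE' uT uE; have [dEf EE] := pull_diff dE'.
rewrite -mulmxA (pinv_transition uT (ET _ Uu) uE).
have ED : 'd E u v = 'd T u v *m E' (f u) + T u *m 'd E' (f u) (v *m T u).
  apply: etrans (@eq_diff_mul _ _ _ _ _ U E T (fun w => E' (f w)) u v oU Uu ET dE dT dEf) _.
  exact: (congr1 (fun z => 'd T u v *m E' (f u) + T u *m z) EE).
apply: etrans (congr1 (fun z => z *m _) ED) _.
rewrite mulmxDl; congr (_ + _); last exact/esym/mulmxA.
by rewrite -mulmxA [E' _ *m (_ *m _)]mulmxA mulmxV ?mulmx1.
Qed.

End Transitions.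

Section Transitions2.
Context {R : realType} {m : nat}.
Variables (U : set 'rV[R]_m) (f : 'rV[R]_m -> 'rV[R]_m) (T : 'rV[R]_m -> 'M[R]_m).
Variables (u v : 'rV[R]_m).
Hypotheses (oU : open U) (Uu : U u) (fT : forall u v, 'd f u v = v *m T u).
Hypotheses (df : differentiable f u) (dT : differentiable T u).

Lemma Jpart_connection_transition (J J' : 'rV[R]_m -> 'M[R]_m) (G G' : 'M[R]_m) :
  (forall w, U w -> J w *m T w = T w *m J' (f w)) ->
  differentiable J u -> differentiable J' (f u) ->
  J u *m J u = - 1%:M -> J' (f u) *m J' (f u) = - 1%:M ->
  G *m T u = 'd T u v + T u *m G' ->
  Jpart G ('d J u v) (J u) *m T u =
  'd T u v + T u *m Jpart G' ('d J' (f u) (v *m T u)) (J' (f u)).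
Proof.
move=> JT dJ dJ' JJ JJ' GT; have [dJf EJ] := pull_diff v fT df dJ'.
apply: Jpart_transition => //; first exact: JT.
apply: etrans (@eq_diff_mul2 _ _ _ _ _ _ U J T T (fun w => J' (f w)) u v oU Uu JT dJ dT dT dJf) _.
exact: (congr1 (fun z => 'd T u v *m J' (f u) + T u *m z) EJ).
Qed.

End Transitions2.

Section Connection.
Context {R : realType} {n e : nat} (D : toric_data R n e).
Local Notation q := #|tidx D|.
Local Notation M := (tmanifold D).
Local Notation tau I J := (loc (M := M) id I J).

Lemma Dloc0 I J u : Dloc (D := D) 0 I J u = lin1_mx ('d (tau I J) u).
Proof. by rewrite /Dloc act0. Qed.

Lemma Dloc0E I J u v : 'd (tau I J) u v = v *m Dloc (D := D) 0 I J u.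
Proof. by rewrite -DlocE act0. Qed.

Definition Emx I u : 'M[R]_(n + n, q) := lin1_mx ('d (@imm R n e D I) u).

Lemma imm_smooth I : smooth_on (imgI I) (@imm R n e D I).
Proof.
have oI := @open_imgI _ _ _ D I.
by apply: (smooth_imm oI (u := id)) => //; exact: smooth_id.
Qed.

Lemma Emx_smooth I : smooth_on (imgI I) (Emx I).
Proof. by apply: smooth_jac; [exact: open_imgI|exact: imm_smooth]. Qed.

(** [kap I] inverts [imm I] and is smooth near its image, so [imm I] is an immersion. *)
Lemma Emx_gram I u : imgI I u -> Emx I u *m (Emx I u)^T \in unitmx.
Proof.
move=> Iu; have oI := @open_imgI _ _ _ D I.
apply: (gram_unit (K := lin1_mx ('d (@kap R n e D I) (imm I u)))).
pose U := [set y : 'rV[R]_q | forall i, outI I i -> 0 < ell i (cx (D := D) y)].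
have oU : open U by apply: open_finite_pos => i _; exact: continuous_ell_cx.
have Uu : U (imm I u) by move=> i oi; rewrite /imm cx_emb; exact: Iu.
have dk : differentiable (@kap R n e D I) (imm I u).
  apply: (smooth_differentiable (U := U)) => //.
  by apply: (smooth_kap oU (y := id)) => //; exact: smooth_id.
have di := smooth_differentiable (@imm_smooth I) Iu.
apply: eq_mulrV => v; rewrite mulmxA !mul_jac mulmx1.
apply: etrans (esym (diff_compE v di dk)) _; apply: etrans (diff_lin_idE u v).
apply/esym; apply: (@eq_diff _ _ _ (imgI I) (fun w => w) (fun w => kap I (imm I w)) u v oI _ Iu).
  by move=> w Iw; rewrite kap_imm.
exact: (smooth_differentiable (@smooth_id _ _ (imgI I)) Iu).
Qed.

Definition Ginv I u : 'M[R]_(q, n + n) :=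
  (Emx I u)^T *m invmx (Emx I u *m (Emx I u)^T).

Lemma Ginv_smooth I : smooth_on (imgI I) (Ginv I).
Proof.
have oI := @open_imgI _ _ _ D I; have sE := @Emx_smooth I.
apply: smooth_mulmx => //; first exact: smooth_trmx.
apply: smooth_invmx => // [u|]; first exact: Emx_gram.
by apply: smooth_mulmx => //; exact: smooth_trmx.
Qed.

(** A matrix that preserves the nondegenerate form [J0] is invertible. *)
Lemma Dloc0_unit I J u : loc_dom (M := M) id I J u -> Dloc (D := D) 0 I J u \in unitmx.
Proof.
move=> Lu; have L0 : loc_dom (M := M) (act 0) I J u by rewrite act0.
have := DlocJ0 L0; set T := Dloc _ _ _ _ => E.
have : (T *m J0 *m T^T) \in unitmx.
  by rewrite E; apply: (proj1 (mulmx1_unit (B := - J0) _)); rewrite mulmxN J0J0 opprK.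
by rewrite !unitmx_mul => /andP[/andP[]].
Qed.

Lemma imm_tau I J u : loc_dom (M := M) id I J u ->
  imm I u = @imm R n e D J (tau I J u).
Proof.
move=> Lu; have L0 : loc_dom (M := M) (act 0) I J u by rewrite act0.
have [Iu Ju] := (loc_domE _ _ _ _).1 L0.
have := imgI_loc L0; rewrite act0 => -[I' _].
rewrite /= -(val_par Iu) -(val_par I').
congr set_val; rewrite -[LHS](par_chart (I := J)) //.
by move: Ju; rewrite act0.
Qed.

Lemma Emx_loc I J u : loc_dom (M := M) id I J u ->
  Emx I u = Dloc (D := D) 0 I J u *m Emx J (tau I J u).
Proof.
move=> Lu; have L0 : loc_dom (M := M) (act 0) I J u by rewrite act0.
have oL : open (loc_dom (M := M) id I J) by have := @open_loc_dom _ _ _ D 0 I J; rewrite act0.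
have dt : differentiable (tau I J) u.
  by have [_] := @loc_dom_smooth _ _ _ D 0 I J; rewrite act0 => /smooth_differentiable; exact.
have := imgI_loc L0; rewrite act0 => -[I' _].
have di := smooth_differentiable (@imm_smooth J) I'.
rewrite Dloc0; have E w : loc_dom (M := M) id I J w -> imm I w = @imm R n e D J (tau I J w).
  exact: imm_tau.
exact: (@jac_comp _ _ _ _ (tau I J) (@imm R n e D J) (@imm R n e D I) u oL Lu E dt di).
Qed.

(* The Levi-Civita connection of the metric induced by the embedding [imm]: the
   second derivative, projected to the tangent space. *)
Definition Chris0 I u v : 'M[R]_(n + n) := 'd (Emx I) u v *m Ginv I u.
Definition Chris I u v : 'M[R]_(n + n) :=
  Jpart (Chris0 I u v) ('d (tJ I) u v) (tJ (D := D) I u).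
Definition tconn : connform M :=
  fun I u => \matrix_a mxvec (Chris I u (delta_mx 0 a)).

Lemma Chris_linear I u : linear (Chris I u).
Proof.
move=> a v w; rewrite /Chris /Chris0.
by rewrite (diff_linP (Emx I)) (diff_linP (@tJ _ _ _ D I)) mulmxDl -scalemxAl Jpart_linear.
Qed.

Lemma christoffel_tconn I u v : christoffel tconn I u v = Chris I u v.
Proof. exact: (christoffel_lin1 v (@Chris_linear I u)). Qed.

Lemma Chris_smooth I v : smooth_on (imgI I) (fun u => Chris I u v).
Proof.
have oI := @open_imgI _ _ _ D I; have sE := @Emx_smooth I; have sJ := @smooth_tJ _ _ _ D I.
have s0 : smooth_on (imgI I) (fun u => Chris0 I u v).
  by apply: smooth_mulmx => //; [exact: smooth_diff|exact: Ginv_smooth].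
apply: smooth_scalemx => //; first exact: smooth_cst.
apply: smoothB => //; first apply: smoothB => //.
  by apply: smooth_mulmx => //; exact: smooth_diff.
by apply: smooth_mulmx => //; exact: smooth_mulmx.
Qed.

Lemma tconn_smooth I : smooth_on (imgI I) (tconn I).
Proof.
have oI := @open_imgI _ _ _ D I.
apply: smooth_mx => // a b; under [X in smooth_on _ X]funext do rewrite mxE.
apply: smooth_coord => //; apply: smooth_mxvec => //; exact: Chris_smooth.
Qed.

Lemma dtJ_anticomm I u v : imgI I u ->
  'd (tJ I) u v *m tJ (D := D) I u + tJ I u *m 'd (tJ I) u v = 0.
Proof.
move=> Iu; have oI := @open_imgI _ _ _ D I.
have dJ := smooth_differentiable (@smooth_tJ _ _ _ D I) Iu.
rewrite -(diff_mulmxE _ dJ dJ) (eq_diff (U := imgI I) (B := cst (- 1%:M))) //.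
- exact: diff_cstE.
- by move=> w Iw; rewrite /= tJ_sqr.
- exact: differentiable_mulmx.
Qed.

Lemma Chris_parallel I u v : imgI I u ->
  'd (tJ I) u v + tJ (D := D) I u *m Chris I u v - Chris I u v *m tJ I u = 0.
Proof. by move=> Iu; apply: Jpart_parallel; [exact: tJ_sqr|exact: dtJ_anticomm]. Qed.

Section Transition.
Variables (I J : charts D) (u : 'rV[R]_(n + n)).
Hypothesis Lu : loc_dom (M := M) id I J u.
Local Notation T := (Dloc (D := D) 0 I J).

Lemma loc_facts : [/\ open (loc_dom (M := M) id I J), differentiable (tau I J) u,
  differentiable T u, imgI I u & imgI J (tau I J u)].
Proof.
have L0 : loc_dom (M := M) (act 0) I J u by rewrite act0.
have [I' _] := imgI_loc L0; have [Iu _] := (loc_domE _ _ _ _).1 L0.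
have [oL sL] := @loc_dom_smooth _ _ _ D 0 I J; have sD := @smooth_Dloc _ _ _ D 0 I J.
have := smooth_differentiable sL L0; have := smooth_differentiable sD L0.
by move: I' oL; rewrite act0.
Qed.

Lemma Chris0_loc v : Chris0 I u v *m T u = 'd T u v + T u *m Chris0 J (tau I J u) (v *m T u).
Proof.
have [oL dt dT Iu I'] := loc_facts.
have dE := smooth_differentiable (@Emx_smooth J) I'.
have dE' := smooth_differentiable (@Emx_smooth I) Iu.
apply: (gram_connection_transition v oL Lu (@Dloc0E I J) dt dT (@Emx_loc I J) dE' dE).
  exact: Dloc0_unit.
exact: Emx_gram.
Qed.

Lemma Chris_loc v : Chris I u v *m T u = 'd T u v + T u *m Chris J (tau I J u) (v *m T u).
Proof.
have [oL dt dT Iu I'] := loc_facts.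
have TJ w : loc_dom (M := M) id I J w ->
    tJ (D := D) I w *m T w = T w *m tJ J (tau I J w).
  by move=> Lw; have := @Dloc_tJ _ _ _ D 0 I J w; rewrite act0; apply.
have dJ := smooth_differentiable (@smooth_tJ _ _ _ D J) I'.
have dJ' := smooth_differentiable (@smooth_tJ _ _ _ D I) Iu.
apply: (Jpart_connection_transition oL Lu (@Dloc0E I J) dt dT TJ dJ' dJ (tJ_sqr Iu) (tJ_sqr I')).
exact: Chris0_loc.
Qed.

End Transition.

Lemma tconn_is_connection : is_connection tconn.
Proof.
split=> [I|I J u Lu v s]; first by rewrite imgME; exact: tconn_smooth.
have [oL dt dT Iu I'] := loc_facts Lu.
have E : christoffel tconn I u v *m Dloc (D := D) 0 I J u = 'd (Dloc (D := D) 0 I J) u v +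
    Dloc (D := D) 0 I J u *m christoffel tconn J (tau I J u) ('d (tau I J) u v).
  by rewrite !christoffel_tconn (Chris_loc Lu v) (@Dloc0E I J u v).
exact: (connection_transition s (@Dloc0E I J) dT E).
Qed.

Lemma tconn_complex_linear : complex_linear tconn (@tJ R n e D).
Proof. by move=> I u; rewrite imgME => Iu v; rewrite christoffel_tconn; exact: Chris_parallel. Qed.

End Connection.

(** * The first Chern form *)

Lemma mxtraceN (R : pzRingType) p (A : 'M[R]_p) : \tr (- A) = - \tr A.
Proof. exact: raddfN. Qed.

Lemma mxtraceB (R : pzRingType) p (A B : 'M[R]_p) : \tr (A - B) = \tr A - \tr B.
Proof. exact: raddfB. Qed.

Section ParallelTrace.
Context {R : realType} {m : nat}.

Lemma trace_curvature_mx (A B Gv Gw J Jv Jw : 'M[R]_m) : J *m J = - 1%:M ->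
  Jv + J *m Gv - Gv *m J = 0 -> Jw + J *m Gw - Gw *m J = 0 ->
  \tr ((A - B + Gw *m Gv - Gv *m Gw) *m J) =
  \tr (A *m J) + \tr (Gw *m Jv) - (\tr (B *m J) + \tr (Gv *m Jw))
    + 2^-1 * \tr (J *m Jv *m Jw).
Proof.
move=> JJ /eqP; rewrite -addrA addr_eq0 => /eqP -> /eqP; rewrite -addrA addr_eq0 => /eqP ->.
rewrite !mulmxN mulNmx opprK (trace_J_commutators _ _ JJ).
rewrite !mulmxBr !mulmxBl !mulmxDl !mulNmx !mxtraceN !mxtraceB !mxtraceD !mxtraceN !mulmxA.
have C1 : \tr (Gw *m J *m Gv) = \tr (Gv *m Gw *m J) by rewrite mxtrace_mulC mulmxA.
have C2 : \tr (Gv *m J *m Gw) = \tr (Gw *m Gv *m J) by rewrite mxtrace_mulC mulmxA.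
by rewrite C1 C2; lra.
Qed.

(* For a [J]-linear connection, the trace of the curvature against [J] is the
   exterior derivative of the trace of the connection form against [J], up to a
   term that involves [J] only. *)
Lemma trace_curvature (G : 'rV[R]_m -> 'rV[R]_m -> 'M[R]_m) (J : 'rV[R]_m -> 'M[R]_m) u v w :
  differentiable (fun x => G x v) u -> differentiable (fun x => G x w) u ->
  differentiable J u -> J u *m J u = - 1%:M ->
  (forall z, 'd J u z + J u *m G u z - G u z *m J u = 0) ->
  \tr (('d (fun x => G x w) u v - 'd (fun x => G x v) u w
     + G u w *m G u v - G u v *m G u w) *m J u) =
  'd (fun x => \tr (G x w *m J x)) u v - 'd (fun x => \tr (G x v *m J x)) u w
    + 2^-1 * \tr (J u *m 'd J u v *m 'd J u w).
Proof.
move=> dGv dGw dJ JJ par.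
have E z1 z2 (d1 : differentiable (fun x => G x z1) u) :
    'd (fun x => \tr (G x z1 *m J x)) u z2 =
    \tr ('d (fun x => G x z1) u z2 *m J u) + \tr (G u z1 *m 'd J u z2).
  have dGJ : differentiable (fun x => G x z1 *m J x) u by exact: differentiable_mulmx.
  apply: etrans (diff_trE z2 dGJ) _.
  by apply: etrans (congr1 mxtrace (diff_mulmxE z2 d1 dJ)) _; exact: mxtraceD.
apply: etrans (trace_curvature_mx _ _ JJ (par v) (par w)) _.
exact: (esym (congr2 (fun a b => a - b + 2^-1 * _) (E w v dGw) (E v w dGv))).
Qed.

End ParallelTrace.

(** * Traces in a frame that makes J constant *)

Section FlatFrame.
Context {R : realType} {n : nat}.
Implicit Types (A B C E p q : 'M[R]_n) (r f : 'rV[R]_n).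

Lemma mxtrace_block_J0 A B C E : \tr (block_mx A B C E *m J0) = \tr C - \tr B.
Proof.
rewrite /J0 mulmx_block mxtrace_block !mulmx0 !mulmx1 !mulmxN !mulmx1 add0r addr0.
by rewrite mxtraceN addrC.
Qed.

(** The logarithmic derivative of the frame with rows p Rm and Th, along a vector with radial
    coefficients r and angular coefficients f; q stands for the inverse of p. *)
Definition frame_form p q (dp : 'M[R]_n) r f : 'M[R]_(n + n) :=
  block_mx ((dp + p *m diag_mx r) *m q) (p *m diag_mx f) (- (diag_mx f *m q)) (diag_mx r).

Lemma trace_frame_form p q dp r f : p *m q = 1%:M ->
  \tr (frame_form p q dp r f *m J0) = - \tr (diag_mx f *m (p + q)).
Proof.
move=> pq; rewrite mxtrace_block_J0 mulmxDr mxtraceD [\tr (p *m _)]mxtrace_mulC.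
by rewrite mxtraceN opprD addrC.
Qed.

(** As q is the inverse of p, the radial coefficients cancel and p, q enter only through the
    derivatives of p + q. *)
Lemma trace_frame_commutator p q (pv pw qv qw : 'M[R]_n) rv rw fv fw :
  q *m p = 1%:M -> pv *m q + p *m qv = 0 -> pw *m q + p *m qw = 0 ->
  let X := frame_form p q pv rv fv in let Y := frame_form p q pw rw fw in
  \tr ((X *m Y - Y *m X) *m J0) =
  \tr (diag_mx fv *m (pw + qw)) - \tr (diag_mx fw *m (pv + qv)).
Proof.
move=> qp Ev Ew X Y.
have Eq (dp dq : 'M[R]_n) : dp *m q + p *m dq = 0 -> q *m dp *m q = - dq.
  move=> /eqP; rewrite addr_eq0 => /eqP E.
  by rewrite -mulmxA E mulmxN mulmxA qp mul1mx.
rewrite /X /Y /frame_form !mulmx_block opp_block_mx add_block_mx mxtrace_block_J0.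
have K1 (x : 'M[R]_n) r f : (x + p *m diag_mx r) *m q *m (p *m diag_mx f) =
    x *m diag_mx f + p *m (diag_mx r *m diag_mx f).
  by rewrite -mulmxA [q *m (p *m _)]mulmxA qp mul1mx mulmxDl mulmxA.
have K2 (x y : 'M[R]_n) f r : x *m q + p *m y = 0 ->
    diag_mx f *m q *m ((x + p *m diag_mx r) *m q) =
    - (diag_mx f *m y) + diag_mx f *m diag_mx r *m q.
  move=> E; rewrite mulmxDl mulmxDr; congr (_ + _).
    by rewrite -!mulmxA [q *m (x *m q)]mulmxA (Eq _ _ E) mulmxN.
  by rewrite -!mulmxA [q *m (p *m _)]mulmxA qp mul1mx.
rewrite !mulNmx !mulmxN !K1 (K2 _ _ _ _ Ev) (K2 _ _ _ _ Ew) -!(mulmxA p) !(mulmxA (diag_mx _) (diag_mx _) q).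
rewrite (diag_mxC fv rw) (diag_mxC fw rv) (mulmxDr _ pw) (mulmxDr _ pv) (mxtraceD (_ *m pw)) (mxtraceD (_ *m pv)).
rewrite [\tr (diag_mx fv *m pw)]mxtrace_mulC [\tr (diag_mx fw *m pv)]mxtrace_mulC.
move: (pv *m diag_mx fw) (pw *m diag_mx fv) (p *m (diag_mx rv *m _)) (p *m (diag_mx rw *m _)) => a b c d.
move: (diag_mx fv *m qw) (diag_mx fw *m qv) (diag_mx rw *m diag_mx fv *m q) (diag_mx rv *m diag_mx fw *m q) => a' b' c' d'.
have -> : - (- a' + c') - d' - (- (- b' + d') - c') = a' - b'.
  by apply/matrixP => i j; rewrite !mxE; ring.
have -> : a + c + d - (b + d + c) = a - b.
  by apply/matrixP => i j; rewrite !mxE; ring.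
by rewrite !mxtraceB; ring.
Qed.

(** Since J = F^-1 J0 F, a derivative of J is the commutator of J0 with the logarithmic derivative
    of F, conjugated by F. This reduces the trace to [trace_J_commutators] for J0. *)
Lemma conj_trace (F J X Y : 'M[R]_(n + n)) mv mw : F \in unitmx -> F *m J = J0 *m F ->
  mv *m F *m J + F *m X = J0 *m (mv *m F) -> mw *m F *m J + F *m Y = J0 *m (mw *m F) ->
  \tr (J *m X *m Y) = 2 * \tr ((mv *m mw - mw *m mv) *m J0).
Proof.
move=> uF FJ.
have E (Z m : 'M[R]_(n + n)) : m *m F *m J + F *m Z = J0 *m (m *m F) ->
    Z = invmx F *m ((J0 *m m - m *m J0) *m F).
  move=> H; apply: (can_inj (mulKmx uF)); rewrite (mulKVmx uF) mulmxBl -!mulmxA -FJ -H.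
  by rewrite !mulmxA addrC addKr.
move=> /E -> /E ->.
have -> : J = invmx F *m (J0 *m F) by rewrite -FJ mulKmx.
rewrite -(trace_J_commutators _ _ (@J0J0 _ _)).
rewrite -!mulmxA !(mulKVmx uF) mxtrace_mulC -!mulmxA mulmxV // mulmx1.
by rewrite !mulmxA.
Qed.

Lemma flat_frame_trace (V : normedModType R) (U : set V) (f J : V -> 'M[R]_(n + n)) u v w mv mw :
  open U -> U u -> (forall x, U x -> f x *m J x = J0 *m f x) ->
  differentiable f u -> differentiable J u -> f u \in unitmx ->
  'd f u v = mv *m f u -> 'd f u w = mw *m f u ->
  \tr (J u *m 'd J u v *m 'd J u w) = 2 * \tr ((mv *m mw - mw *m mv) *m J0).
Proof.
move=> oU Uu fJ df dJ uf fv fw.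
have P (a b c F m K : 'M[R]_(n + n)) : a = m *m F -> c = 0 ->
    a *m K + F *m b = c *m F + J0 *m a -> m *m F *m K + F *m b = J0 *m (m *m F).
  by move=> -> ->; rewrite mul0mx add0r.
have E z mz : 'd f u z = mz *m f u ->
    mz *m f u *m J u + f u *m 'd J u z = J0 *m (mz *m f u).
  move=> fz; have d0 : differentiable (fun _ : V => J0 : 'M[R]_(n + n)) u.
    exact: differentiable_cst.
  exact: P fz (diff_cstE _ u z) (eq_diff_mul2 z oU Uu fJ df dJ d0 df).
exact: conj_trace uf (fJ _ Uu) (E _ _ fv) (E _ _ fw).
Qed.

End FlatFrame.

Section ChernForm.
Context {R : realType} {n e : nat} (D : toric_data R n e).
Local Notation M := (tmanifold D).
Local Notation tau I J := (loc (M := M) id I J).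
Implicit Types (I J : charts D) (u v w : 'rV[R]_(n + n)).

(** The values on v of the forms d(log |z_k|) and, in [acoef], d(arg z_k). *)
Definition rcoef u v : 'rV[R]_n := v *m (Rm u)^T *m Di u.
Definition acoef u v : 'rV[R]_n := v *m (Th u)^T *m Di u.

Lemma frame_coef u v : regp u -> v = rcoef u v *m Rm u + acoef u v *m Th u.
Proof.
move=> ru; rewrite -{1}[v]mulmx1 -(frame_complete ru) mulmxDr !mulmxA //.
Qed.

Lemma diag_mul_Di u (x : 'rV[R]_n) : diag_mx x *m Di u = diag_mx (x *m Di u).
Proof.
rewrite /Di mulmx_diag; congr diag_mx; apply/rowP => k.
by rewrite [LHS]mxE mul_mx_diag [RHS]mxE.
Qed.

Lemma Rm_mul_RmT u v : Rm v *m (Rm u)^T = diag_mx (v *m (Rm u)^T).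
Proof.
rewrite /Rm !tr_row_mx !tr_diag_mx mul_row_col !mulmx_diag -[v in RHS]hsubmxK mul_row_col.
rewrite !mul_mx_diag -linearD /=; congr diag_mx.
by apply/rowP => k; rewrite !mxE.
Qed.

Lemma Rm_mul_ThT u v : Rm v *m (Th u)^T = diag_mx (v *m (Th u)^T).
Proof.
rewrite /Th /Rm !tr_row_mx linearN /= !tr_diag_mx mul_row_col mulmxN !mulmx_diag -[v in RHS]hsubmxK mul_row_col.
rewrite mulmxN !mul_mx_diag; apply/matrixP => i j; rewrite !mxE.
by case: eqP => [->|]; rewrite ?mulr0n ?oppr0 ?addr0.
Qed.

Lemma Rm_coef u v : regp u ->
  Rm v = diag_mx (rcoef u v) *m Rm u + diag_mx (acoef u v) *m Th u.
Proof.
move=> ru; rewrite -{1}[Rm v]mulmx1 -(frame_complete ru) mulmxDr !mulmxA.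
by rewrite Rm_mul_RmT Rm_mul_ThT !diag_mul_Di.
Qed.

Lemma Th_coef u v : regp u ->
  Th v = diag_mx (rcoef u v) *m Th u - diag_mx (acoef u v) *m Rm u.
Proof.
by move=> ru; rewrite -RmJ0 (Rm_coef v ru) mulmxDl -!mulmxA RmJ0 ThJ0 mulmxN.
Qed.

Lemma is_linear_Rm : linear (@Rm R n).
Proof.
by move=> a v w; rewrite /Rm !linearP /= scale_row_mx add_row_mx.
Qed.

Lemma diff_linear (V W : normedModType R) (f : V -> W) (u v : V) :
  linear f -> continuous f -> 'd f u v = f v.
Proof.
move=> lf cf; pose fM := GRing.isLinear.Build _ _ _ _ _ lf.
pose fL : {linear V -> W} := HB.pack f fM.
exact: (congr1 (fun h : V -> W => h v) (@diff_lin _ _ _ fL u cf)).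
Qed.

Lemma diff_Rm u v : 'd (@Rm R n) u v = Rm v.
Proof.
apply: diff_linear; first exact: is_linear_Rm.
by move=> w; exact: (smooth_continuous (@smooth_Rm R n)).
Qed.

Lemma diff_Th u v : 'd (@Th R n) u v = Th v.
Proof.
apply: diff_linear => [a x y|w]; last exact: (smooth_continuous (@smooth_Th R n)).
by rewrite -!RmJ0 is_linear_Rm mulmxDl -scalemxAl.
Qed.

Definition pmx I u : 'M[R]_n := 1%:M - Dm u *m Smx' I u.

Lemma pmx_Qmx I u : imgI I u -> pmx I u *m Qmx I u = 1%:M.
Proof.
move=> Iu; rewrite /pmx {1}/Qmx mulmxBl mul1mx mulmxDr mulmx1.
by rewrite -(mulmxA (Dm u)) -mulmxDr (mulmxA (Smx' I u)) SmxE // addrK.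
Qed.

Lemma Qmx_pmx I u : imgI I u -> Qmx I u *m pmx I u = 1%:M.
Proof. by move/pmx_Qmx/mulmx1C. Qed.

Lemma pmx_smooth I : smooth_on (imgI I) (pmx I).
Proof.
have oI := @open_imgI _ _ _ D I.
apply: smoothB => //; first exact: smooth_cst.
by apply: smooth_mulmx => //; [apply: smooth_sub smooth_Dm|exact: smooth_Smx'].
Qed.

Definition frame I u : 'M[R]_(n + n) := col_mx (- (Th u *m tJ I u)) (Th u).

Lemma frame_tJ I u : imgI I u -> frame I u *m tJ I u = J0 *m frame I u.
Proof.
move=> Iu; rewrite /frame /J0 mul_col_mx mul_block_col !mul0mx !mul1mx add0r addr0.
by rewrite mulNmx -mulmxA tJ_sqr // mulmxN mulmx1 opprK mulNmx mul1mx opprK.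
Qed.

Lemma frameE I u : frame I u = col_mx (pmx I u *m Rm u) (Th u).
Proof. by rewrite /frame Th_tJ opprD opprK mulmxBl mul1mx. Qed.

Lemma frame_unit I u : imgI I u -> regp u -> frame I u \in unitmx.
Proof.
move=> Iu ru; apply: (proj1 (mulmx1_unit (B := row_mx ((Rm u)^T *m Di u *m Qmx I u) ((Th u)^T *m Di u)) _)).
rewrite frameE mul_col_row -!(mulmxA (pmx I u)) !(mulmxA (Rm u)) !(mulmxA (Th u)).
rewrite RmRmT RmThT ThThT ThRmT !mul0mx mulmx0 DmDi // mul1mx pmx_Qmx //.
by rewrite -scalar_mx_block.
Qed.

Lemma frame_smooth I : smooth_on (imgI I) (frame I).
Proof.
have oI := @open_imgI _ _ _ D I.
have sT : smooth_on (imgI I) (@Th R n) by apply: smooth_sub smooth_Th.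
have sTJ : smooth_on (imgI I) (fun u => - (Th u *m tJ I u)).
  by apply: smoothN => //; apply: smooth_mulmx => //; exact: smooth_tJ.
apply: smooth_mx => // i j; rewrite -(splitK i); case: (fintype.split i) => k /=.
  by under [X in smooth_on _ X]funext do rewrite col_mxEu; exact: smooth_coord.
by under [X in smooth_on _ X]funext do rewrite col_mxEd; exact: smooth_coord.
Qed.

Lemma diff_frame I u v : imgI I u -> regp u ->
  'd (frame I) u v =
  frame_form (pmx I u) (Qmx I u) ('d (pmx I) u v) (rcoef u v) (acoef u v) *m frame I u.
Proof.
move=> Iu ru; have oI := @open_imgI _ _ _ D I.
have dp := smooth_differentiable (@pmx_smooth I) Iu.
have dR : differentiable (@Rm R n) u by exact: (smooth_differentiable (@smooth_Rm R n)).
have dT : differentiable (@Th R n) u by exact: (smooth_differentiable (@smooth_Th R n)).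
have FE : frame I = fun x => col_mx (pmx I x *m Rm x) (Th x).
  by apply/funext => x; exact: frameE.
have dpR : differentiable (fun x => pmx I x *m Rm x) u by exact: differentiable_mulmx.
apply: etrans (congr1 (fun f : 'rV[R]_(n + n) -> 'M[R]_(n + n) => 'd f u v) FE) _.
apply: etrans (diff_col_mxE v dpR dT).2 _.
apply: etrans (congr2 col_mx (diff_mulmxE v dp dR) (diff_Th u v)) _.
apply: etrans (congr1 (fun z => col_mx (_ + _ *m z) _) (diff_Rm u v)) _.
rewrite frameE /frame_form mul_block_col; congr col_mx; last first.
  by rewrite (Th_coef v ru) addrC mulNmx -mulmxA [Qmx I u *m (_ *m _)]mulmxA Qmx_pmx // mul1mx.
rewrite -mulmxA [Qmx I u *m (_ *m _)]mulmxA Qmx_pmx // mul1mx [in RHS]mulmxDl (Rm_coef v ru).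
by rewrite (mulmxDr (pmx I u)) !mulmxA addrA.
Qed.

Definition smx I u : 'M[R]_n := Smx I u - Smx' I u.

Lemma smx_smooth I : smooth_on (imgI I) (smx I).
Proof. by apply: smoothB; [exact: open_imgI|exact: smooth_Smx|exact: smooth_Smx']. Qed.

Lemma pmxD I u : pmx I u + Qmx I u = 2%:M + Dm u *m smx I u.
Proof.
rewrite /pmx /Qmx /smx mulmxBr addrACA [- _ + _]addrC; congr (_ + _).
by rewrite -[2%:M]/((1 + 1)%:M) raddfD.
Qed.

Lemma diff_Dm u v : 'd (@Dm R n) u v = 2 *: diag_mx (v *m (Rm u)^T).
Proof.
have dR : differentiable (@Rm R n) u by exact: (smooth_differentiable (@smooth_Rm R n)).
have dRT : differentiable (fun x => (@Rm R n x)^T) u.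
  apply: (smooth_differentiable (U := setT)) => //.
  by apply: smooth_trmx; [exact: openT|exact: smooth_Rm].
have E : @Dm R n = fun x => Rm x *m (Rm x)^T by apply/funext => x; rewrite RmRmT.
apply: etrans (congr1 (fun f : 'rV[R]_(n + n) -> 'M[R]_n => 'd f u v) E) _.
apply: etrans (diff_mulmxE v dR dRT) _.
have ET : 'd (fun x => (@Rm R n x)^T) u v = (Rm v)^T.
  apply: diff_linear => [a x y|w].
    by rewrite is_linear_Rm linearP.
  apply: (smooth_continuous (U := setT)) => //.
  by apply: smooth_trmx; [exact: openT|exact: smooth_Rm].
apply: etrans (congr2 (fun a b => a *m _ + _ *m b) (diff_Rm u v) ET) _.
rewrite -[Rm u *m _]trmxK trmx_mul trmxK Rm_mul_RmT tr_diag_mx.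
by rewrite scaler_nat mulr2n.
Qed.

Lemma diff_pmxD I u v : imgI I u ->
  'd (pmx I) u v + 'd (Qmx I) u v =
  2 *: (diag_mx (v *m (Rm u)^T) *m smx I u) + Dm u *m 'd (smx I) u v.
Proof.
move=> Iu; have oI := @open_imgI _ _ _ D I.
have dp := smooth_differentiable (@pmx_smooth I) Iu.
have dq := smooth_differentiable (@smooth_Qmx _ _ _ D I) Iu.
have ds := smooth_differentiable (@smx_smooth I) Iu.
have dD : differentiable (@Dm R n) u by exact: (smooth_differentiable (@smooth_Dm R n)).
have dDs : differentiable (fun x => Dm x *m smx I x) u by exact: differentiable_mulmx.
apply: etrans (esym (diff_addE v dp dq)) _.
have E : (fun x => pmx I x + Qmx I x) = fun x => 2%:M + Dm x *m smx I x.
  by apply/funext => x; exact: pmxD.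
apply: etrans (congr1 (fun f : 'rV[R]_(n + n) -> 'M[R]_n => 'd f u v) E) _.
have d0 : differentiable (fun _ : 'rV[R]_(n + n) => 2%:M : 'M[R]_n) u by exact: differentiable_cst.
apply: etrans (diff_addE v d0 dDs) _.
apply: etrans (congr2 (fun a b => a + b) (diff_cstE _ u v) (diff_mulmxE v dD ds)) _.
rewrite add0r; congr (_ + _).
by apply: etrans (congr1 (fun a => a *m _) (diff_Dm u v)) _; rewrite scalemxAl.
Qed.

Lemma diff_pq I u v : imgI I u ->
  'd (pmx I) u v *m Qmx I u + pmx I u *m 'd (Qmx I) u v = 0.
Proof.
move=> Iu; have oI := @open_imgI _ _ _ D I.
have dp := smooth_differentiable (@pmx_smooth I) Iu.
have dq := smooth_differentiable (@smooth_Qmx _ _ _ D I) Iu.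
apply: etrans (esym (diff_mulmxE v dp dq)) _.
apply: etrans _ (diff_cstE (1%:M : 'M[R]_n) u v).
apply: (@eq_diff _ _ _ (imgI I) (fun x => pmx I x *m Qmx I x) (fun=> 1%:M)) => //.
  by move=> w Iw; rewrite pmx_Qmx.
exact: differentiable_mulmx.
Qed.

Lemma trace_diag (x : 'rV[R]_n) (A : 'M[R]_n) : \tr (diag_mx x *m A) = \sum_a x 0 a * A a a.
Proof. by apply: eq_bigr => a _; rewrite mul_diag_mx mxE. Qed.

Lemma mul_diag_mxE (x : 'rV[R]_n) (A : 'M[R]_n) a b : (diag_mx x *m A) a b = x 0 a * A a b.
Proof. by rewrite mul_diag_mx mxE. Qed.

(** The derivative along v of the one-form sum_a smx_aa (w Th^T)_a, with w constant. *)
Definition chern_pot I u v w : R :=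
  \sum_a ('d (smx I) u v a a * (w *m (Th u)^T) 0 a + smx I u a a * (w *m (Th v)^T) 0 a).

Lemma acoefE u v k : acoef u v 0 k = (v *m (Th u)^T) 0 k * (sqn u k)^-1.
Proof. by rewrite /acoef mul_mx_diag [LHS]mxE; congr (_ * _); rewrite mxE. Qed.

Lemma mul_ThT u v k : (v *m (Th u)^T) 0 k =
  v 0 (rshift n k) * u 0 (lshift n k) - v 0 (lshift n k) * u 0 (rshift n k).
Proof.
rewrite /Th tr_row_mx linearN /= !tr_diag_mx -{1}[v]hsubmxK mul_row_col mulmxN.
by rewrite !mul_mx_diag !mxE addrC.
Qed.

(** In the flat frame only the derivatives of p + q = 2 + Dm smx enter. The division by |z_a|^2 in
    [acoef] disappears on antisymmetrizing in v and w, because |z|^2 d(log |z|) /\ d(arg z) is the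
    area form. *)
Lemma tr_J_dJ_dJ_reg I u v w : imgI I u -> regp u ->
  - (2^-1 * \tr (tJ (D := D) I u *m 'd (tJ I) u v *m 'd (tJ I) u w)) =
  chern_pot I u v w - chern_pot I u w v.
Proof.
move=> Iu ru; have oI := @open_imgI _ _ _ D I.
have df := smooth_differentiable (@frame_smooth I) Iu.
have dJ := smooth_differentiable (@smooth_tJ _ _ _ D I) Iu.
rewrite (flat_frame_trace oI Iu (@frame_tJ I) df dJ (frame_unit Iu ru)
  (diff_frame v Iu ru) (diff_frame w Iu ru)).
rewrite mulKf ?pnatr_eq0 // (trace_frame_commutator _ _ _ _ (Qmx_pmx Iu) (diff_pq v Iu) (diff_pq w Iu)).
rewrite !diff_pmxD // opprB !trace_diag -!sumrB; apply: eq_bigr => a _.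
rewrite !acoefE.
have E x y : (2 *: (diag_mx (x *m (Rm u)^T) *m smx I u) + Dm u *m 'd (smx I) u y) a a =
    2 * (x *m (Rm u)^T) 0 a * smx I u a a + sqn u a * 'd (smx I) u y a a.
  rewrite [LHS]mxE; congr (_ + _).
    by rewrite [LHS]mxE mul_diag_mxE mulrA.
  by rewrite mul_diag_mxE; congr (_ * _); rewrite mxE.
rewrite !E !mul_ThT !mul_RmT.
have := ru a; rewrite /sqn; move: ('d (smx I) u v a a) ('d (smx I) u w a a) (smx I u a a) => s1 s2 s0 nz.
field.
exact: nz.
Qed.

Lemma tr_J_dJ_dJ I u v w : imgI I u ->
  - (2^-1 * \tr (tJ (D := D) I u *m 'd (tJ I) u v *m 'd (tJ I) u w)) =
  chern_pot I u v w - chern_pot I u w v.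
Proof.
have oI := @open_imgI _ _ _ D I; have sJ := @smooth_tJ _ _ _ D I.
have ss := @smx_smooth I.
have sT x : smooth_on (imgI I) (fun u : 'rV[R]_(n + n) => x *m (Th u)^T).
  apply: smooth_mulmx => //; first exact: smooth_cst.
  by apply: smooth_trmx => //; apply: smooth_sub (@smooth_Th R n).
have sp x y : smooth_on (imgI I) (fun u => chern_pot I u x y).
  apply: smooth_sum => // a _; apply: smoothD => //; apply: smoothM => //; last exact: smooth_cst.
  - by apply: smooth_coord => //; exact: smooth_diff.
  - by apply: smooth_coord => //; exact: sT.
  - by apply: smooth_coord.
move: u; apply: (@dense_eq _ _ _ _
  (fun u => - (2^-1 * \tr (tJ (D := D) I u *m 'd (tJ I) u v *m 'd (tJ I) u w)))
  (fun u => chern_pot I u v w - chern_pot I u w v) oI) => u Iu.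
- apply: (smooth_continuous (U := imgI I)) => //; apply: smoothN => //.
  apply: smoothM => //; first exact: smooth_cst.
  apply: smooth_mxtrace => //; apply: smooth_mulmx => //; last exact: smooth_diff.
  by apply: smooth_mulmx => //; exact: smooth_diff.
- by apply: (smooth_continuous (U := imgI I)) => //; exact: smoothB.
- exact: tr_J_dJ_dJ_reg.
Qed.

(* Up to a term that is invariant under change of charts, this is the trace of
   the connection form against J in the frame [(- Th J, Th)], see [cprim_frame];
   as the transition matrices [frame_cocycle] of these frames are constant, the
   local expressions glue. *)
Definition cprim I u v : R := (4 * pi)^-1 *
  (\sum_a (2 + smx I u a a) * (v *m (Th u)^T) 0 a - \tr (Chris I u v *m tJ (D := D) I u)).

Definition cform : oneform M := fun I u => \row_a cprim I u (delta_mx 0 a).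

Lemma cprim_linear I u a v w : cprim I u (a *: v + w) = a * cprim I u v + cprim I u w.
Proof.
have EC : \tr (Chris I u (a *: v + w) *m tJ (D := D) I u) =
    a * \tr (Chris I u v *m tJ (D := D) I u) + \tr (Chris I u w *m tJ (D := D) I u).
  by rewrite (@Chris_linear _ _ _ D I u) mulmxDl -scalemxAl mxtraceD mxtraceZ.
rewrite /cprim EC.
have -> : \sum_b (2 + smx I u b b) * ((a *: v + w) *m (Th u)^T) 0 b =
  a * (\sum_b (2 + smx I u b b) * (v *m (Th u)^T) 0 b) +
  \sum_b (2 + smx I u b b) * (w *m (Th u)^T) 0 b.
  rewrite mulr_sumr -big_split /=; apply: eq_bigr => b _.
  have -> : ((a *: v + w) *m (Th u)^T) 0 b = a * (v *m (Th u)^T) 0 b + (w *m (Th u)^T) 0 b.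
    by rewrite mulmxDl -scalemxAl [LHS]mxE; congr (_ + _); rewrite mxE.
  ring.
ring.
Qed.

Lemma dot_cform I u v : dot (cform I u) v = cprim I u v.
Proof.
rewrite dotE {2}[v]row_sum_delta.
have -> : \sum_i v 0 i *: delta_mx 0 i = \sum_(i <- index_enum 'I_(n + n)) v 0 i *: (delta_mx 0 i : 'rV[R]_(n + n)) by [].
elim: (index_enum _) => [|i r IH].
  rewrite !big_nil; have := cprim_linear I u 0 0 0; rewrite scale0r addr0 mul0r add0r => <- //.
  by have := cprim_linear I u 1 0 0; rewrite scale1r addr0 mul1r => /eqP; rewrite -subr_eq subrr eq_sym => /eqP.
by rewrite !big_cons cprim_linear -IH mxE mulrC.
Qed.

Lemma cprim_smooth I v : smooth_on (imgI I) (fun u => cprim I u v).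
Proof.
have oI := @open_imgI _ _ _ D I.
apply: smoothM => //; first exact: smooth_cst.
apply: smoothB => //; last first.
  apply: smooth_mxtrace => //; apply: smooth_mulmx => //; last exact: smooth_tJ.
  exact: Chris_smooth.
apply: smooth_sum => // a _; apply: smoothM => //.
  by apply: smoothD => //; [exact: smooth_cst|apply: smooth_coord => //; exact: smx_smooth].
apply: smooth_coord => //; apply: smooth_mulmx => //; first exact: smooth_cst.
by apply: smooth_trmx => //; apply: smooth_sub (@smooth_Th R n).
Qed.

Lemma cform_smooth I : smooth_on (imgI I) (cform I).
Proof.
have oI := @open_imgI _ _ _ D I.
apply: smooth_mx => // a b; under [X in smooth_on _ X]funext do rewrite mxE.
exact: cprim_smooth.
Qed.

Lemma diff_dot_cst p (A : 'rV[R]_(n + n) -> 'rV[R]_p) u v (w : 'rV[R]_p) :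
  differentiable A u -> dot ('d A u v) w = 'd (fun x => dot (A x) w) u v.
Proof.
move=> dA; have d0 : differentiable (fun _ : 'rV[R]_(n + n) => w^T) u by exact: differentiable_cst.
have E := diff_mulmxE v dA d0; have dM := differentiable_mulmx dA d0.
apply: etrans _ (diff_mxE v 0 0 dM).
apply: etrans _ (congr1 (fun X : 'M[R]_1 => X 0 0) (esym E)).
apply: etrans _ (congr1 (fun X : 'M[R]_(p, 1) => ('d A u v *m w^T + A u *m X) 0 0) (esym (diff_cstE w^T u v))).
by rewrite mulmx0 addr0.
Qed.

Lemma diff_scaleE (V : normedModType R) (c : R) (B : V -> R) (x v : V) : differentiable B x ->
  'd (fun y : V => c * B y) x v = c * 'd B x v.
Proof.
move=> dB; have d0 : differentiable (fun _ : V => c) x by exact: differentiable_cst.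
apply: etrans (diff_mulE v d0 dB) _.
have P (a b z : R) : z = 0 -> a + b * z = a by move=> ->; rewrite mulr0 addr0.
exact: P (diff_cstE c x v).
Qed.

Lemma diff_cprim I u v w : imgI I u ->
  'd (fun x => cprim I x w) u v = (4 * pi)^-1 *
  (2 * \sum_a (w *m (Th v)^T) 0 a + chern_pot I u v w -
   'd (fun x => \tr (Chris I x w *m tJ (D := D) I x)) u v).
Proof.
move=> Iu; have oI := @open_imgI _ _ _ D I.
have sTh : smooth_on (imgI I) (fun u : 'rV[R]_(n + n) => w *m (Th u)^T).
  apply: smooth_mulmx => //; first exact: smooth_cst.
  by apply: smooth_trmx => //; apply: smooth_sub (@smooth_Th R n).
have dTh := smooth_differentiable sTh Iu.
have ETh : 'd (fun u : 'rV[R]_(n + n) => w *m (Th u)^T) u v = w *m (Th v)^T.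
  apply: diff_linear => [a x y|x].
    by rewrite -!RmJ0 is_linear_Rm mulmxDl -scalemxAl linearP mulmxDr -scalemxAr.
  apply: (smooth_continuous (U := setT)) => //.
  apply: smooth_mulmx; [exact: openT|exact: smooth_cst|].
  by apply: smooth_trmx; [exact: openT|exact: smooth_Th].
have sG : smooth_on (imgI I) (fun x => \tr (Chris I x w *m tJ (D := D) I x)).
  apply: smooth_mxtrace => //; apply: smooth_mulmx => //; last exact: smooth_tJ.
  exact: Chris_smooth.
have sa a : smooth_on (imgI I) (fun x => (2 + smx I x a a)).
  by apply: smoothD => //; [exact: smooth_cst|apply: smooth_coord => //; exact: smx_smooth].
have sb a : smooth_on (imgI I) (fun x => (w *m (Th x)^T) 0 a) by exact: smooth_coord.
have sab a : smooth_on (imgI I) (fun x => (2 + smx I x a a) * (w *m (Th x)^T) 0 a).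
  exact: smoothM.
have sS : smooth_on (imgI I) (fun x => \sum_a (2 + smx I x a a) * (w *m (Th x)^T) 0 a).
  by apply: smooth_sum.
have sB : smooth_on (imgI I) (fun x => \sum_a (2 + smx I x a a) * (w *m (Th x)^T) 0 a
     - \tr (Chris I x w *m tJ (D := D) I x)) by exact: smoothB.
apply: etrans (diff_scaleE _ v (smooth_differentiable sB Iu)) _; congr (_ * _).
apply: etrans (diff_subE v (smooth_differentiable sS Iu) (smooth_differentiable sG Iu)) _.
congr (_ - _).
apply: etrans (diff_sumE _ v (fun a => smooth_differentiable (sab a) Iu)) _.
rewrite mulr_sumr /chern_pot -big_split /=; apply: eq_bigr => a _.
apply: etrans (diff_mulE v (smooth_differentiable (sa a) Iu) (smooth_differentiable (sb a) Iu)) _.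
have ds := smooth_differentiable (@smx_smooth I) Iu.
have E1 : 'd (fun x => (w *m (Th x)^T) 0 a) u v = (w *m (Th v)^T) 0 a.
  by apply: etrans (esym (diff_mxE v 0 a dTh)) _; exact: (congr1 (fun X : 'rV[R]_n => X 0 a) ETh).
have E2 : 'd (fun x => 2 + smx I x a a) u v = 'd (smx I) u v a a.
  have d2 : differentiable (fun _ : 'rV[R]_(n + n) => 2 : R) u by exact: differentiable_cst.
  apply: etrans (diff_addE v d2 (differentiable_coordE a a ds)) _.
  apply: etrans (congr2 (fun x y => x + y) (diff_cstE _ u v) (esym (diff_mxE v a a ds))) _.
  by rewrite add0r.
apply: etrans (congr2 (fun x y => _ * x + _ * y) E1 E2) _; ring.
Qed.

(** In the derivative of [cform] the constant 2 gives omega, and the trace of the connection against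
    J gives the curvature up to a term in J alone; [chern_pot], coming from the coefficients [smx],
    accounts for that term. *)
Lemma chern_identity I u v w : imgI I u ->
  ev2 (@tomega R n e D I u) v w - chern_form (@tconn R n e D) (@tJ R n e D) (I : idx M) u v w =
  d_oneform cform (I : idx M) u v w.
Proof.
move=> Iu; have oI := @open_imgI _ _ _ D I.
have db := smooth_differentiable (@cform_smooth I) Iu.
have dJ := smooth_differentiable (@smooth_tJ _ _ _ D I) Iu.
have dG x := smooth_differentiable (@Chris_smooth _ _ _ D I x) Iu.
have CE x : (fun y => christoffel (@tconn R n e D) (I : idx M) y x) = fun y => Chris I y x.
  by apply/funext => y; exact: christoffel_tconn.
have bE x : (fun y => dot (cform I y) x) = fun y => cprim I y x.
  by apply/funext => y; exact: dot_cform.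
have E x y : dot ('d (cform I) u x) y = 'd (fun z => cprim I z y) u x.
  by apply: etrans (diff_dot_cst x y db) _; congr ('d _ u x); exact: bE.
have TC : \tr (curvature (@tconn R n e D) (I : idx M) u v w *m tJ (D := D) I u) =
    'd (fun x => \tr (Chris I x w *m tJ (D := D) I x)) u v
    - 'd (fun x => \tr (Chris I x v *m tJ (D := D) I x)) u w
    + 2^-1 * \tr (tJ (D := D) I u *m 'd (tJ I) u v *m 'd (tJ I) u w).
  rewrite /curvature !CE !christoffel_tconn.
  apply: (trace_curvature (G := fun x y => Chris I x y) (dG v) (dG w) dJ (tJ_sqr Iu)) => z.
  exact: Chris_parallel.
rewrite /chern_form TC /d_oneform.
apply: etrans _ (esym (congr2 (fun a b => a - b) (E v w) (E w v))).
apply: etrans _ (esym (congr2 (fun a b => a - b) (diff_cprim v w Iu) (diff_cprim w v Iu))).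
have := tr_J_dJ_dJ v w Iu.
move: (\tr (_ *m 'd _ u v *m _)) (chern_pot I u v w) (chern_pot I u w v) => t c1 c2 tc.
have -> : ev2 (@tomega R n e D I u) v w =
    (4 * pi)^-1 * (2 * \sum_a (w *m (Th v)^T) 0 a - 2 * \sum_a (v *m (Th w)^T) 0 a).
  rewrite -mulrBr -sumrB /ev2 /tomega -scalemxAr dotZl.
  have -> : (4 * pi)^-1 = pi^-1 * 4^-1 :> R by rewrite invfM mulrC.
  rewrite -mulrA; congr (_ * _).
  have -> : dot (v *m J0) w = \sum_k (v 0 (lshift n k) * w 0 (rshift n k) - v 0 (rshift n k) * w 0 (lshift n k)).
    rewrite /J0 -{1}[v]hsubmxK mul_row_block !mulmx0 !mulmxN !mulmx1 add0r addr0 dotE big_split_ord /=.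
    rewrite -big_split /=; apply: eq_bigr => k _; rewrite row_mxEl row_mxEr !mxE; ring.
  rewrite !mulr_sumr; apply: eq_bigr => k _; rewrite !mul_ThT; by field.
have Q (P X Y d1 d2 : R) : P * (X - Y) - P * (d1 - d2 + 2^-1 * t) =
    P * (X + c1 - d1) - P * (Y + c2 - d2).
  have -> : 2^-1 * t = c2 - c1 by rewrite -[c2 - c1]opprB -tc opprK.
  by ring.
exact: Q.
Qed.

End ChernForm.

Section ChernPrimitive.
Context {R : realType} {n e : nat} (D : toric_data R n e).
Local Notation M := (tmanifold D).
Local Notation tau I J := (loc (M := M) id I J).
Implicit Types (I J : charts D) (u v w : 'rV[R]_(n + n)).

Lemma open_regp : open [set u : 'rV[R]_(n + n) | regp u].
Proof.
have oT : open [set: 'rV[R]_(n + n)] := openT.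
have -> : [set u : 'rV[R]_(n + n) | regp u] = [set u | forall k : 'I_n, xpredT k -> 0 < sqn u k].
  by apply/seteqP; split => u /= ru k; have := ru k; rewrite lt0r sqn_ge0 andbT //; apply.
apply: open_finite_pos => k _ u; apply: (smooth_continuous (U := setT)) => //.
by apply: smooth_sqn => //; exact: smooth_id.
Qed.

Lemma xI_nmxT I u : xI I u *m (nmx I)^T = \row_k (sqn u k - 1).
Proof. by rewrite /xI -mulmxA dual_nmxT mulmx1. Qed.

(** The first term is twice the pairing of x with the angular part of v, the same in every chart.
    Its coefficient 2 (|z_k|^2 - 1) and the coefficient 2 + |z_k|^2 smx_kk of the trace add up to a
    multiple of |z_k|^2, which leaves the regular 2 + smx_kk of [cprim]. *)
Lemma cprim_frame I u v : imgI I u -> regp u ->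
  4 * pi * cprim I u v = 2 * (acoef u v *m nmx I *m (xI I u)^T) 0 0 -
    \tr (('d (frame I) u v + frame I u *m Chris I u v) *m invmx (frame I u) *m J0).
Proof.
move=> Iu ru; have uF := frame_unit Iu ru.
have -> : \tr (('d (frame I) u v + frame I u *m Chris I u v) *m invmx (frame I u) *m J0) =
    - \tr (diag_mx (acoef u v) *m (pmx I u + Qmx I u)) + \tr (Chris I u v *m tJ (D := D) I u).
  have P (X F m G : 'M[R]_(n + n)) : F \in unitmx -> X = m *m F ->
      \tr ((X + F *m G) *m invmx F *m J0) = \tr (m *m J0) + \tr (G *m (invmx F *m (J0 *m F))).
    move=> uX ->; rewrite !mulmxDl mxtraceD mulmxK //; congr (_ + _).
    by rewrite -!mulmxA mxtrace_mulC !mulmxA.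
  rewrite (P _ _ _ _ uF (diff_frame v Iu ru)) (trace_frame_form _ _ _ (pmx_Qmx Iu)).
  by rewrite -(frame_tJ Iu) mulKmx.
rewrite -mulmxA -[nmx I]trmxK -trmx_mul xI_nmxT pmxD trace_diag /cprim.
have p0 : 4 * pi != 0 :> R by rewrite mulf_neq0 ?pnatr_eq0 // gt_eqF // pi_gt0.
rewrite mulVKf // opprD opprK addrA; congr (_ - _).
rewrite mxE !mulr_sumr -big_split /=; apply: eq_bigr => a _.
have -> : (2%:M + Dm u *m smx I u) a a = 2 + sqn u a * smx I u a a.
  rewrite [LHS]mxE mul_diag_mxE; congr (_ + _ * _); last by rewrite mxE.
  by rewrite mxE eqxx mulr1n.
rewrite acoefE [(_^T) a 0]mxE [(\row__ _) 0 a]mxE.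
by have := ru a; move: (sqn u a) (smx I u a a) ((v *m _) 0 a) => l s x l0; field.
Qed.

Lemma acoef_loc I J u v : loc_dom (M := M) id I J u -> regp u ->
  acoef (tau I J u) (v *m Dloc (D := D) 0 I J u) = acoef u v *m (nmx I *m (dual J)^T).
Proof.
move=> Lu ru; have L0 : loc_dom (M := M) (act 0) I J u by rewrite act0.
have := frames_Dloc L0 ru; rewrite act0 => -[ET ER].
have ru' := regp_loc L0 ru; rewrite act0 in ru'.
rewrite {1}(frame_coef v ru) mulmxDl -!mulmxA ET /acoef mulmxDl.
rewrite /rcoef -!mulmxA [Di u *m (Rm u *m _)]mulmxA [Di u *m Rm u *m _]mulmxA ER.
move: (tau I J u) ru' => u' ru'.
rewrite -(mulmxA _ (Rm u')) RmThT !mulmx0 add0r ThThT -!mulmxA DmDi // mulmx1.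
by [].
Qed.

Definition frame_cocycle I J : 'M[R]_(n + n) :=
  block_mx (nmx I *m (dual J)^T) 0 0 (nmx I *m (dual J)^T).

Lemma frame_loc I J u : loc_dom (M := M) id I J u -> regp u ->
  frame I u *m Dloc (D := D) 0 I J u = frame_cocycle I J *m frame J (tau I J u).
Proof.
move=> Lu ru; have L0 : loc_dom (M := M) (act 0) I J u by rewrite act0.
have := frames_Dloc L0 ru; have := Dloc_tJ L0; rewrite act0 => EJ [ET _].
rewrite /frame /frame_cocycle mul_col_mx mul_block_col !mul0mx add0r addr0 ET.
by rewrite mulNmx mulmxN -(mulmxA (Th u)) EJ (mulmxA (Th u)) ET !mulmxA.
Qed.

(** H F^-1 changes by conjugation with C, which commutes with [J0]. *)
Lemma trace_cocycle (F F' T C H H' : 'M[R]_(n + n)) :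
  F \in unitmx -> F' \in unitmx -> T \in unitmx -> C *m J0 = J0 *m C ->
  F *m T = C *m F' -> H *m T = C *m H' ->
  \tr (H *m invmx F *m J0) = \tr (H' *m invmx F' *m J0).
Proof.
move=> uF uF' uT CJ FT HT.
have uC : C \in unitmx.
  have : F *m T \in unitmx by rewrite unitmx_mul uF.
  by rewrite FT unitmx_mul => /andP[].
have -> : H *m invmx F = C *m (H' *m invmx F') *m invmx C.
  have uFT : F *m T \in unitmx by rewrite unitmx_mul uF.
  apply: (can_inj (mulmxK uFT)); rewrite !mulmxA mulmxKV // HT -(mulmxA _ F) FT.
  by rewrite mulmxA mulmxKV // -!mulmxA mulVmx // mulmx1.
move: (H' *m invmx F') => X.
by rewrite -mulmxA mxtrace_mulC -mulmxA (mulmxA J0 C) -CJ -(mulmxA C) (mulKmx uC) mxtrace_mulC.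
Qed.

(** The cocycle is constant, so its derivative drops out and the covariant derivatives of the frames
    change by the same matrix as the frames. *)
Lemma frame_connection_loc I J u v : loc_dom (M := M) id I J u -> regp u ->
  ('d (frame I) u v + frame I u *m Chris I u v) *m Dloc (D := D) 0 I J u =
  frame_cocycle I J *m
    ('d (frame J) (tau I J u) (v *m Dloc (D := D) 0 I J u) +
     frame J (tau I J u) *m Chris J (tau I J u) (v *m Dloc (D := D) 0 I J u)).
Proof.
move=> Lu ru; have [oL dt dT Iu I'] := loc_facts Lu.
have dF := smooth_differentiable (@frame_smooth _ _ _ D I) Iu.
have dF' := smooth_differentiable (@frame_smooth _ _ _ D J) I'.
have [dFt EF] := pull_diff v (@Dloc0E _ _ _ D I J) dt dF'.
have d0 : differentiable (fun _ : 'rV[R]_(n + n) => frame_cocycle I J) u.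
  exact: differentiable_cst.
have oU : open (loc_dom (M := M) id I J `&` [set u | regp u]).
  by apply: openI => //; exact: open_regp.
have FL w : (loc_dom (M := M) id I J `&` [set u | regp u]) w ->
    frame I w *m Dloc (D := D) 0 I J w = frame_cocycle I J *m frame J (tau I J w).
  by case=> Lw rw; exact: frame_loc.
have P (A A' A'' B C C0 F F' G G' T : 'M[R]_(n + n)) : A *m T + F *m B = C0 *m F' + C *m A'' -> A'' = A' -> C0 = 0 ->
    F *m T = C *m F' -> G *m T = B + T *m G' -> (A + F *m G) *m T = C *m (A' + F' *m G').
  move=> E E1 E0 FT GT; rewrite mulmxDl -mulmxA GT mulmxDr addrA E E1 E0 mul0mx add0r.
  by rewrite mulmxA FT mulmxDr mulmxA.
apply: (P _ _ _ _ _ _ _ _ _ _ _ (eq_diff_mul2 v oU (conj Lu ru) FL dF dT d0 dFt) EF).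
- exact: diff_cstE.
- exact: frame_loc.
- exact: Chris_loc.
Qed.

Lemma cprim_loc_reg I J u v : loc_dom (M := M) id I J u -> regp u ->
  cprim I u v = cprim J (tau I J u) (v *m Dloc (D := D) 0 I J u).
Proof.
move=> Lu ru; have L0 : loc_dom (M := M) (act 0) I J u by rewrite act0.
have [oL dt dT Iu I'] := loc_facts Lu.
have := regp_loc L0 ru; rewrite act0 => ru'.
have := imgI_loc L0; rewrite act0 => -[_ Ex].
have p0 : 4 * pi != 0 :> R by rewrite mulf_neq0 ?pnatr_eq0 // gt_eqF // pi_gt0.
apply: (mulfI p0); rewrite !cprim_frame // Ex acoef_loc //; congr (_ * _ - _).
  have dn : (dual J)^T *m nmx J = 1%:M.
    by rewrite -[_ *m _]trmxK trmx_mul trmxK nmxT_dual trmx1.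
  by rewrite -!mulmxA [(dual J)^T *m (_ *m _)]mulmxA dn mul1mx.
apply: trace_cocycle (frame_unit Iu ru) (frame_unit I' ru') (Dloc0_unit Lu) _ (frame_loc Lu ru)
  (frame_connection_loc v Lu ru).
rewrite /frame_cocycle /J0 !mulmx_block !mulmx0 !mul0mx !mulmx1 !mul1mx !mulmxN !mulNmx.
by rewrite !mulmx1 !mul1mx !addr0 !add0r ?oppr0.
Qed.

Lemma cprim_loc I J u v : loc_dom (M := M) id I J u ->
  cprim I u v = cprim J (tau I J u) (v *m Dloc (D := D) 0 I J u).
Proof.
have := @loc_dom_smooth _ _ _ D 0 I J; rewrite act0 => -[oL sL].
have := @smooth_Dloc _ _ _ D 0 I J; rewrite act0 => sT.
have LI : loc_dom (M := M) id I J `<=` imgI I.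
  by move=> w Lw; have [_ _ _ ] := loc_facts Lw.
have LJ w : loc_dom (M := M) id I J w -> imgI J (tau I J w).
  by move=> Lw; have [_ _ _ ] := loc_facts Lw.
have sJ x : smooth_on (loc_dom (M := M) id I J)
    (fun w => cprim J (tau I J w) (x *m Dloc (D := D) 0 I J w)).
  have -> : (fun w => cprim J (tau I J w) (x *m Dloc (D := D) 0 I J w)) =
      fun w => ((x *m Dloc (D := D) 0 I J w) *m (cform J (tau I J w))^T) 0 0.
    by apply/funext => w; rewrite -dot_cform dotC.
  apply: smooth_coord => //; apply: smooth_mulmx => //.
    by apply: smooth_mulmx => //; exact: smooth_cst.
  apply: smooth_trmx => //.
  exact: (smooth_comp_mx oL (@open_imgI _ _ _ D J) LJ sL (@cform_smooth _ _ _ D J)).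
move: u; apply: (@dense_eq _ _ _ _ (fun u => cprim I u v)
   (fun u => cprim J (tau I J u) (v *m Dloc (D := D) 0 I J u)) oL) => u Lu.
- apply: (smooth_continuous (U := loc_dom (M := M) id I J)) => //.
  exact: (smooth_sub LI (@cprim_smooth _ _ _ D I v)).
- by apply: (smooth_continuous (U := loc_dom (M := M) id I J)).
- exact: cprim_loc_reg.
Qed.

Lemma cform_is_oneform : is_oneform (@cform R n e D).
Proof.
split=> [I|I J u Lu v]; first by rewrite imgME; exact: cform_smooth.
apply: etrans (dot_cform _ _ _) _; apply: etrans (cprim_loc v Lu) _.
apply: etrans (esym (dot_cform _ _ _)) _.
by rewrite -(@Dloc0E _ _ _ D I J).
Qed.

Lemma toric_c1 : c1_eq (@tomega R n e D).
Proof.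
exists (@tJ R n e D), (@tconn R n e D), (@cform R n e D); split.
- by split; [exact: tJ_almost_complex|exact: tJ_compatible].
- exact: tconn_is_connection.
- exact: tconn_complex_linear.
- exact: cform_is_oneform.
- by move=> I u; rewrite imgME => Iu v w; exact: chern_identity.
Qed.

End ChernPrimitive.

(** * The action of a subtorus *)

Lemma eq_fundamental_field (R : realType) m (M : manifold R m) d d'
    (a : 'rV[R]_d -> M -> M) (b : 'rV[R]_d' -> M -> M) xi eta I u :
  (forall t p, a (t *: xi) p = b (t *: eta) p) ->
  fundamental_field a xi I u = fundamental_field b eta I u.
Proof.
move=> ab; apply: (congr1 (fun f => derive1 f 0)).
by apply/funext => t; rewrite ab.
Qed.

Section Subtorus.
Context {R : realType} {n d r : nat} (D : toric_data R n (d + r)).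
Local Notation M := (tmanifold D).
Implicit Types (I : charts D) (u v : 'rV[R]_(n + n)) (xi : 'rV[R]_d).

Definition sub_act xi (p : M) : M := act (row_mx xi 0) p.
Definition sub_moment (p : M) : 'rV[R]_d := lsubmx (xof p).

Lemma dot_row_mx0 (y : 'rV[R]_(d + r)) xi : dot y (row_mx xi 0) = dot (lsubmx y) xi.
Proof. by rewrite /dot -{1}[y]hsubmxK tr_row_mx mul_row_col trmx0 mulmx0 addr0. Qed.

Lemma integral_row_mx0 xi : Defs.integral (row_mx xi (0 : 'rV[R]_r)) <-> Defs.integral xi.
Proof.
split=> [H i|H i]; first by have := H (lshift r i); rewrite row_mxEl.
rewrite -(splitK i); case: (fintype.split i) => k /=; first by rewrite row_mxEl.
by rewrite row_mxEr mxE.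
Qed.

Lemma row_mx0D xi eta : row_mx (xi + eta) (0 : 'rV[R]_r) = row_mx xi 0 + row_mx eta 0.
Proof. by rewrite add_row_mx addr0. Qed.

Lemma row_mx0Z (t : R) xi : row_mx (t *: xi) (0 : 'rV[R]_r) = t *: row_mx xi 0.
Proof. by rewrite scale_row_mx scaler0. Qed.

Lemma smooth_row_mx0 (V : normedModType R) (U : set V) (f : V -> 'rV[R]_d) :
  open U -> smooth_on U f -> smooth_on U (fun x => row_mx (f x) (0 : 'rV[R]_r)).
Proof.
move=> oU sf; apply: smooth_mx => // a i; rewrite -(splitK i); case: (fintype.split i) => k /=.
  by under [X in smooth_on _ X]funext do rewrite row_mxEl; exact: smooth_coord.
by under [X in smooth_on _ X]funext do rewrite row_mxEr mxE; exact: smooth_cst.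
Qed.

Lemma continuous_row_mx0 : continuous (fun xi : 'rV[R]_d => row_mx xi (0 : 'rV[R]_r)).
Proof.
move=> xi; apply: (smooth_continuous (U := setT)) => //.
by apply: smooth_row_mx0; [exact: openT|exact: smooth_id].
Qed.

Lemma diff_lsubmx (V : normedModType R) (f : V -> 'rV[R]_(d + r)) (x v : V) :
  differentiable f x -> 'd (fun y => lsubmx (f y)) x v = lsubmx ('d f x v).
Proof.
move=> df; have df' : differentiable (fun y => lsubmx (f y)) x.
  apply: differentiable_mx => a b; under [X in differentiable X _]funext do rewrite mxE.
  exact: differentiable_coordE.
apply/rowP => j; rewrite [RHS]mxE (diff_mxE v 0 j df') (diff_mxE v 0 (lshift r j) df).
by congr ('d _ x v); apply/funext => y; rewrite mxE.
Qed.

Lemma sub_torus_action : torus_action (M := M) sub_act.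
Proof.
have [H1 H2 H3 _] := toric_torus_action D; split.
- by move=> xi p ixi; apply: H1; apply/integral_row_mx0.
- by move=> xi eta p; rewrite /sub_act row_mx0D; exact: H2.
- move=> z; apply: (@continuous_comp _ _ _ (fun z : 'rV[R]_d * M => (row_mx z.1 (0 : 'rV[R]_r), z.2))
    (fun z : 'rV[R]_(d + r) * M => act z.1 z.2)); last exact: H3.
  apply: continuous_pairat; last exact: cvg_snd.
  apply: (@continuous_comp _ _ _ fst (fun xi : 'rV[R]_d => row_mx xi (0 : 'rV[R]_r))).
    exact: cvg_fst.
  exact: continuous_row_mx0.
- move=> I.
  have oU : open ([set: 'rV[R]_d] `*` imgI I).
    rewrite (_ : _ `*` _ = snd @^-1` imgI I); last first.
      by apply/seteqP; split=> [z []|z Iz].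
    by apply: open_comp; [move=> z _; exact: cvg_snd|exact: open_imgI].
  rewrite imgME /smooth_into.
  apply: (smooth_act_par oU (xi := fun z => row_mx z.1 (0 : 'rV[R]_r)) (u := snd));
    [|by apply: smooth_snd => //; exact: smooth_id|by move=> v []].
  by apply: smooth_row_mx0 => //; apply: smooth_fst => //; exact: smooth_id.
Qed.

Lemma sub_hamiltonian :
  hamiltonian_action (M := M) (@tomega R n (d + r) D) sub_act sub_moment.
Proof.
have [_ Heff Hpres [Hsm Hinv Hmom]] := toric_hamiltonian D; split.
- exact: sub_torus_action.
- by move=> xi H; apply/integral_row_mx0; exact: Heff.
- by move=> xi; exact: Hpres.
- split.
  + move=> I; have oI : open (img (M := M) I) by rewrite imgME; exact: open_imgI.
    apply: smooth_mx => // a j; under [X in smooth_on _ X]funext do rewrite mxE.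
    by apply: smooth_coord => //; exact: Hsm.
  + by move=> xi p; rewrite /sub_moment Hinv.
  + move=> xi I u Iu v.
    have df : differentiable (xof (D := D) \o par (I : idx M)) u.
      exact: smooth_differentiable (Hsm I) Iu.
    apply: etrans (congr1 (fun y => dot y xi) (diff_lsubmx v df)) _.
    have FF : fundamental_field sub_act xi I u =
        fundamental_field (M := M) (@act _ _ _ D) (row_mx xi 0) I u.
      by apply: eq_fundamental_field => t p; rewrite /sub_act row_mx0Z.
    apply: etrans (esym (dot_row_mx0 _ _)) _; apply: etrans (Hmom _ _ _ Iu v) _.
    by rewrite FF.
Qed.

Lemma sub_compact_space :
  compact_hamiltonian_space (M := M) (@tomega R n (d + r) D) sub_act sub_moment.
Proof.
split; [exact: compact_tspace|exact: connected_tspace|exact: tomega_symplectic|].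
exact: sub_hamiltonian.
Qed.

(** An orbit of the subtorus lies in one level of the full moment map, so two points of the polytope
    over the same value give two different orbits. *)
Lemma sub_tall :
  (forall x, tpoly D x -> exists x', [/\ tpoly D x', lsubmx x' = lsubmx x & x' != x]) ->
  tall (M := M) sub_act sub_moment.
Proof.
move=> H p; have [x' [Px' E ne]] := H _ (tpoly_xof p).
exists (pt D x' 0); split; first by rewrite /sub_moment xof_pt.
case=> xi xiE; move: ne; rewrite -(xof_pt 0 Px') xiE.
by have [_ _ _ [_ -> _]] := toric_hamiltonian D; rewrite eqxx.
Qed.

Lemma range_sub_moment : range sub_moment = [set lsubmx x | x in tpoly D].
Proof.
apply/seteqP; split=> [w [p _ <-]|w [x Px <-]].
  by exists (xof p) => //; exact: tpoly_xof.
by exists (pt D x 0) => //; rewrite /sub_moment xof_pt.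
Qed.

End Subtorus.

(** 1 - J J0 intertwines J and J0. A vector in its kernel satisfies v J = - v J0, which makes the
    positive form equal to - |v|^2. It is used to pass from J to the standard structure at a fixed
    point. *)
Lemma JJ0_unit (R : realType) n (J : 'M[R]_(n + n)) :
  (forall v : 'rV[R]_(n + n), v != 0 -> 0 < ev2 J0 v (v *m J)) -> 1%:M - J *m J0 \in unitmx.
Proof.
move=> HJ; rewrite -row_free_unit; apply: inj_row_free => v.
rewrite mulmxBr mulmx1 => /eqP; rewrite subr_eq0 => /eqP vE.
apply/eqP; apply: contraT => v0; have := HJ _ v0.
have {}vE : v *m J = - (v *m J0) by rewrite {2}vE -!mulmxA J0J0 !mulmxN mulmx1 opprK.
have -> : ev2 J0 v (v *m J) = - (v *m v^T) 0 0.
  rewrite vE /ev2 dotNr /dot trmx_mul trJ0 mulNmx mulmxN -mulmxA (mulmxA J0) J0J0.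
  by rewrite mulNmx mul1mx mulmxN opprK.
by rewrite oppr_gt0 ltNge dot_self_ge0.
Qed.

Section Isotropy.
Context {R : realType} {n e : nat} (D : toric_data R n e).
Local Notation M := (tmanifold D).
Implicit Types (I : charts D) (u v : 'rV[R]_(n + n)) (xi : 'rV[R]_e).

Definition rotc I xi v : 'rV[R]_(n + n) :=
  zrow (fun k => expi (dot (row k (dual I)) xi) * zc v k).

Lemma loc_rotc I xi u : loc_dom (M := M) (act xi) I I u ->
  loc (M := M) (act xi) I I u = rotc I xi u.
Proof.
case/loc_domE => Iu Ju; have [th uE] := polarI I u.
rewrite (act_par_chart Iu uE Ju) {2}uE /rotc /pol; congr zrow; apply/funext => k.
by rewrite zc_zrow dotDr expiD mulrA mulrC.
Qed.

Lemma rotc_linear I xi : linear (rotc I xi).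
Proof.
move=> a v w; apply/rowP => j; rewrite -(splitK j).
case: (fintype.split j) => k /=; rewrite /rotc /zrow /zc.
  by rewrite row_mxEl [RHS]mxE [X in _ = X + _]mxE !row_mxEl !mxE /=; ring.
by rewrite row_mxEr [RHS]mxE [X in _ = X + _]mxE !row_mxEr !mxE /=; ring.
Qed.

Lemma rotc_continuous I xi : continuous (rotc I xi).
Proof.
move=> v; apply: (smooth_continuous (U := setT)) => //.
have oT : open [set: 'rV[R]_(n + n)] := openT.
apply: smooth_zrow => // k; apply: csmoothM => //; first exact: csmooth_cst.
by apply: smooth_zc => //; exact: smooth_id.
Qed.

Lemma Dloc_rotc I xi u v : loc_dom (M := M) (act xi) I I u ->
  v *m Dloc (D := D) xi I I u = rotc I xi v.
Proof.
move=> Lu; rewrite -DlocE; have [oL sL] := @loc_dom_smooth _ _ _ D xi I I.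
apply: etrans _ (diff_linear u v (@rotc_linear I xi) (@rotc_continuous I xi)).
apply: (eq_diff (U := loc_dom (M := M) (act xi) I I)) => //.
  by move=> w Lw; exact: loc_rotc.
exact: smooth_differentiable sL Lu.
Qed.

Lemma zc_J0 v k : zc (v *m J0) k = 'i%C * zc v k.
Proof.
have E : v *m J0 = row_mx (- rsubmx v) (lsubmx v).
  rewrite -{1}[v]hsubmxK /J0 mul_row_block.
  by rewrite !mulmx0 !mulmx1 mulmxN mulmx1 add0r addr0.
rewrite E /zc row_mxEl row_mxEr !mxE; apply/eqP; rewrite eq_complex /=.
by rewrite !mul0r !mul1r !add0r !eqxx.
Qed.

Lemma rotc_J0 I xi v : rotc I xi (v *m J0) = rotc I xi v *m J0.
Proof. by apply: zrowP => k; rewrite zc_J0 !zc_zrow zc_J0 mulrCA. Qed.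

End Isotropy.

Section Monotone.
Context {R : realType} {n d r : nat} (D : toric_data R n (d + r)).
Local Notation M := (tmanifold D).
Implicit Types (I : charts D) (xi : 'rV[R]_d).

(** A point fixed by the subtorus may have nonzero coordinates z_k; the subtorus then acts trivially
    on that coordinate, so its weight restricts to 0. *)
Lemma sub_fixed_dual I (p : M) k : domI I p -> (forall xi, sub_act xi p = p) ->
  ell (fac I k) (xof p) != 0 -> lsubmx (row k (dual I)) = 0.
Proof.
move=> Ip fp; have [x [th [px pE]]] := ptP p; rewrite pE xof_pt // => lk.
apply/rowP => j; rewrite [RHS]mxE; apply/eqP; apply: contraT => aj.
set c := lsubmx (row k (dual I)) 0 j in aj.
have H xi : expi (dot (lsubmx (row k (dual I))) xi) = 1.
  have := fp xi; rewrite /sub_act pE act_pt // => E.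
  have Ip' : domI I (pt D x th) by rewrite -pE.
  have := chart_pt px Ip'; rewrite -{1}E chart_pt //; last by rewrite E.
  move/(congr1 (fun v => zc v k)); rewrite !zc_zrow dotDr expiD mulrA dot_row_mx0.
  move=> H; apply: (@mulfI _ ((Num.sqrt (ell (fac I k) x))%:C * expi (dot (row k (dual I)) th))).
    rewrite mulf_neq0 ?expi_neq0 // eq_complex /= negb_and eqxx orbF sqrtr_eq0 -ltNge.
    by rewrite lt0r lk; exact: px.
  by rewrite mulr1.
(* This element pairs to 1/2 with the weight, while fixedness makes every such pairing an
   integer. *)
have := expi_eq1 (H ((2^-1 / c) *: delta_mx 0 j)).
have -> : dot (lsubmx (row k (dual I))) ((2^-1 / c) *: delta_mx 0 j) = 2^-1.
  rewrite dotZr dotE (bigD1 j) //= big1 => [|i ij]; last first.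
    by rewrite [X in _ * X]mxE (negPf ij) andbF mulr0.
  by rewrite addr0 [X in _ * (_ * X)]mxE !eqxx mulr1 -/c divfK.
case/intrP => m /(congr1 (fun z => 2 * z)); rewrite mulfV ?pnatr_eq0 // => mE.
have : (1 : int) = 2 * m by apply: (@intr_inj R); rewrite intrM -mE.
by move/(congr1 (fun z : int => odd `|z|%N)); rewrite abszM oddM.
Qed.

Lemma sub_normalized : normalized_monotone (M := M) (@tomega R n (d + r) D) (sub_act (D := D)) (sub_moment (D := D)).
Proof.
split=> [|p fp]; first exact: toric_c1.
have [I Ip] := charts_cover_tspace p.
exists (fun k => lsubmx (row k (dual I))); last first.
  (* x is the sum of the (|z_k|^2 - 1) times the dual vectors. Where z_k = 0 this contributes minus
     the weight; elsewhere the restricted weight is 0 by [sub_fixed_dual]. *)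
  rewrite /sub_moment -(xI_chart Ip) /xI mulmx_sum_row linear_sum /= -sumrN.
  apply: eq_bigr => k _; rewrite linearZ /= mxE.
  have := @sub_fixed_dual I p k Ip fp; rewrite -(xI_chart Ip) ell_xI.
  case: eqP => [-> _|_ ->//]; last by rewrite scaler0 oppr0.
  by rewrite sub0r scaleN1r.
split=> [k i|]; first by rewrite mxE; exact: dual_integral.
exists (@tJ R n (d + r) D); split.
- exact: tJ_almost_complex.
- exact: tJ_compatible.
- by move=> xi; exact: tJ_preserved.
pose u := chartI I p; have Iu : imgI I u by rewrite -imgE; exists p.
(* [tJ] and [J0] may differ here when some z_k is nonzero. The isotropy representation commutes with
   both, hence with the intertwiner K, so the weights can be read off for [J0]. *)
pose K := 1%:M - tJ (D := D) I u *m J0.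
have JK : tJ (D := D) I u *m K = K *m J0.
  rewrite /K mulmxBr mulmxBl mulmx1 mul1mx mulmxA tJ_sqr // -mulmxA J0J0 mulNmx mul1mx mulmxN mulmx1.
  by rewrite !opprK addrC.
exists I, (K *m col_mx 1%:M 0), (K *m col_mx 0 1%:M); rewrite /= -/u; split=> //.
- rewrite -mul_mx_row unitmx_mul; apply/andP; split.
    apply: JJ0_unit => v v0; have := (tJ_compatible (i := I)).
    rewrite imgME => /(_ _ Iu) [/(_ _ v0)].
    by rewrite !ev2E /tomega -scalemxAr -scalemxAl mxE pmulr_rgt0 // invr_gt0 pi_gt0.
  by rewrite -block_mxEh -scalar_mx_block unitmx1.
- rewrite !mulmxA JK -!mulmxA /J0 !mul_block_col.
  rewrite !(mul0mx, mulNmx, mul1mx, mulmx0, oppr0, addr0, add0r).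
  by rewrite -mulmxN opp_col_mx oppr0.
move=> xi v j.
have Lu : loc_dom (M := M) (act (row_mx xi 0)) I I u.
  apply/loc_domE; split => //; rewrite par_chart //.
  by have := fp xi; rewrite /sub_act => ->.
have fu : loc (M := M) (act (row_mx xi 0)) I I u = u.
  by rewrite /loc /= par_chart //; have := fp xi; rewrite /sub_act => ->.
have -> : 'd (loc (M := M) (sub_act xi) I I) u v = v *m Dloc (D := D) (row_mx xi 0) I I u.
  exact: DlocE.
have rT y : y *m Dloc (D := D) (row_mx xi 0) I I u = rotc I (row_mx xi 0) y by exact: Dloc_rotc.
have TJ := Dloc_tJ Lu; rewrite fu in TJ.
move: (Dloc (row_mx xi 0) I I u) rT TJ => T rT TJ.
have TJ0 : T *m J0 = J0 *m T.
  by apply: eq_mulrV => y; rewrite !mulmxA !rT rotc_J0.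
have TK : T *m K = K *m T.
  by rewrite /K mulmxBr mulmxBl mulmx1 mul1mx mulmxA -TJ -!mulmxA TJ0.
have KA (z : 'rV[R]_(n + n)) (B : 'M[R]_(n + n, n)) : z *m (K *m B) = z *m K *m B.
  by rewrite mulmxA.
have {}TK : v *m T *m K = rotc I (row_mx xi 0) (v *m K) by rewrite -rT -!mulmxA TK.
rewrite !KA.
rewrite TK; move: (v *m K) => y.
have E1 (z : 'rV[R]_(n + n)) : (z *m col_mx 1%:M 0) 0 j = z 0 (lshift n j).
  by rewrite -{1}[z]hsubmxK mul_row_col mulmx1 mulmx0 addr0 mxE.
have E2 (z : 'rV[R]_(n + n)) : (z *m col_mx 0 1%:M) 0 j = z 0 (rshift n j).
  by rewrite -{1}[z]hsubmxK mul_row_col mulmx1 mulmx0 add0r mxE.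
rewrite !E1 !E2; set z := expi (dot (row j (dual I)) (row_mx xi 0)) * zc y j.
have -> : rotc I (row_mx xi 0) y 0 (lshift n j) = Re z by rewrite /rotc /zrow row_mxEl mxE.
have -> : rotc I (row_mx xi 0) y 0 (rshift n j) = Im z by rewrite /rotc /zrow row_mxEr mxE.
rewrite /z /= dot_row_mx0.
by split=> //; rewrite addrC.
Qed.

End Monotone.

(** * Corners of polyhedra *)

Section Polyhedron.
Context {R : realType}.

(** The ratio test of the simplex method: t is the least a_j / - b_j over the j with b_j < 0. *)
Lemma first_zero (J : finType) (a b : J -> R) :
  (forall j, 0 <= a j) -> (forall j, a j = 0 -> 0 <= b j) -> (exists j, b j < 0) ->
  exists t, [/\ 0 < t, forall j, 0 <= a j + t * b j
    & exists2 j, a j != 0 & a j + t * b j = 0].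
Proof.
move=> a0 ab [j0 bj0].
case: (@arg_minP _ R J j0 (fun j => b j < 0) (fun j => a j / - b j) bj0) => j bj jmin.
have aj : 0 < a j.
  by rewrite lt0r a0 andbT; apply/eqP => /ab; rewrite leNgt bj.
have nb : 0 < - b j by rewrite oppr_gt0.
exists (a j / - b j); split; first by rewrite divr_gt0.
- move=> i; case: (ltP (b i) 0) => bi; last first.
    by rewrite addr_ge0 // mulr_ge0 // divr_ge0 // ltW.
  have := jmin i bi; rewrite (ler_pdivlMr _ _ (_ : 0 < - b i)) ?oppr_gt0 // mulrN.
  by rewrite -subr_ge0 opprK.
- by exists j; rewrite ?gt_eqF // invrN mulrN mulNr divfK ?subrr // lt_eqF.
Qed.

Lemma small_step (J : finType) (a b : J -> R) :
  (forall j, 0 <= a j) -> (forall j, a j = 0 -> 0 <= b j) ->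
  exists2 t, 0 < t & forall j, 0 <= a j + t * b j.
Proof.
move=> a0 ab; case: (pselect (exists j, b j < 0)) => [/(first_zero a0 ab)[t [t0 H _]]|H].
  by exists t.
exists 1 => // j; rewrite mul1r addr_ge0 // leNgt; apply/negP => bj.
by apply: H; exists j.
Qed.

Context {d : nat} {J : finType} (mu : J -> 'rV[R]_d).
Implicit Types (v w x c : 'rV[R]_d) (j : J).

Definition polyh : set 'rV[R]_d := [set w | forall j, -1 <= dot w (mu j)].
Definition active w j := dot w (mu j) == -1.
Definition corner v := polyh v /\
  forall x, (forall j, active v j -> dot x (mu j) = 0) -> x = 0.

Lemma slack_ge0 w j : polyh w -> 0 <= 1 + dot w (mu j).
Proof. by move=> /(_ j); rewrite -subr_ge0 opprK addrC. Qed.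

Lemma slack_eq0 w j : (1 + dot w (mu j) == 0) = active w j.
Proof. by rewrite addrC addr_eq0. Qed.

Lemma dot_move w x t j : 1 + dot (w + t *: x) (mu j) = 1 + dot w (mu j) + t * dot x (mu j).
Proof. by rewrite dotDl dotZl addrA. Qed.

Lemma polyhP w : (forall j, 0 <= 1 + dot w (mu j)) -> polyh w.
Proof. by move=> H j; rewrite -subr_ge0 opprK addrC. Qed.

Hypothesis bounded : exists B : R, forall w, polyh w -> forall b, `|w 0 b| <= B.

Lemma no_ray w x : polyh w -> x != 0 -> exists j, dot x (mu j) < 0.
Proof.
move=> Pw x0; have [B HB] := bounded; apply: contrapT => H.
have xmu j : 0 <= dot x (mu j) by rewrite leNgt; apply/negP => xj; apply: H; exists j.
have [b xb] : exists b, x 0 b != 0.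
  apply: contrapT => Hb; move/eqP: x0; apply; apply/rowP => b; rewrite mxE; apply/eqP.
  by apply: contraT => xb; case: Hb; exists b.
(* Far enough along the ray for coordinate b to leave the bound B. *)
pose t := (B + `|w 0 b| + 1) / `|x 0 b|.
have B0 : 0 <= B by apply: le_trans (HB w Pw b).
have t0 : 0 <= t by rewrite divr_ge0 // addr_ge0 ?addr_ge0.
have /HB /(_ b) : polyh (w + t *: x).
  by apply: polyhP => j; rewrite dot_move; apply: addr_ge0; [exact: slack_ge0|exact: mulr_ge0].
rewrite mxE [(t *: x) 0 b]mxE => H1.
have H2 : `|t * x 0 b| <= B + `|w 0 b|.
  rewrite (_ : t * x 0 b = (w 0 b + t * x 0 b) - w 0 b); last by rewrite addrC addKr.
  by apply: le_trans (ler_normB _ _) _; rewrite lerD2r.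
have : `|t * x 0 b| = B + `|w 0 b| + 1.
  by rewrite normrM (ger0_norm t0) divfK // normr_eq0.
by move=> E; move: H2; rewrite E -subr_ge0 opprD addrA subrr sub0r oppr_ge0 ler10.
Qed.

(** If the active normals at w have a common kernel, a move along it keeps them active, and its sign
    can be chosen so that the pairing with c does not rise. By boundedness a further facet becomes
    active; the induction is on the number of inactive facets. *)
Lemma climb c w : polyh w -> exists v,
  [/\ corner v, forall j, active w j -> active v j & dot v c <= dot w c].
Proof.
have [m] := ubnP #|[pred j | ~~ active w j]|; elim: m w => // m IH w wm Pw.
case: (pselect (forall x, (forall j, active w j -> dot x (mu j) = 0) -> x = 0)) => [cw|].
  by exists w; split.
move=> /existsNP[x0] /not_implyP[x0a /eqP x0n].
have [x [xn xa xc]] : exists x, [/\ x != 0, forall j, active w j -> dot x (mu j) = 0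
    & dot x c <= 0].
  case: (leP (dot x0 c) 0) => x0c; first by exists x0.
  exists (- x0); rewrite oppr_eq0; split=> // [j wj|].
    by rewrite dotNl x0a ?oppr0.
  by rewrite dotNl oppr_le0 ltW.
have [|||t [t0 tP [j wj tj]]] := @first_zero J (fun j => 1 + dot w (mu j)) (fun j => dot x (mu j)).
- by move=> j; exact: slack_ge0.
- by move=> j /eqP; rewrite slack_eq0 => /xa ->.
- exact: no_ray Pw xn.
have Pw' : polyh (w + t *: x) by apply: polyhP => i; rewrite dot_move.
have aw' i : active w i -> active (w + t *: x) i.
  move=> wi; rewrite -slack_eq0 dot_move xa // mulr0 addr0.
  by rewrite slack_eq0.
have [|v [cv av vc]] := IH (w + t *: x) _ Pw'.
  move: wm; rewrite ltnS; apply: leq_trans; apply: proper_card; apply/properP; split.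
    by apply/fintype.subsetP => i; rewrite !inE; apply: contra; exact: aw'.
  exists j; first by rewrite inE -slack_eq0.
  by rewrite inE negbK -slack_eq0 dot_move tj.
exists v; split=> // [i wi|]; first by apply: av; exact: aw'.
by apply: le_trans vc _; rewrite dotDl dotZl -subr_ge0 opprD addrA subrr sub0r oppr_ge0
  mulr_ge0_le0 // ltW.
Qed.

Lemma dot_sumr (I : Type) (s : seq I) (Q : pred I) (f : I -> 'rV[R]_d) x :
  dot x (\sum_(i <- s | Q i) f i) = \sum_(i <- s | Q i) dot x (f i).
Proof. by rewrite dotC dot_suml; apply: eq_bigr => i _; rewrite dotC. Qed.

(** The sum of the normals in Q attains its bound only where every summand attains its own. *)
Lemma face_support (Q : pred J) v : polyh v -> (forall j, Q j -> active v j) ->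
  supporting polyh [set w | polyh w /\ forall j, Q j -> active w j]
    (\sum_(j | Q j) mu j) (- \sum_(j | Q j) 1).
Proof.
move=> Pv vQ; split=> [w Pw|].
  by rewrite dot_sumr -sumrN; apply: ler_sum => j _; exact: Pw.
apply/seteqP; split=> [w [Pw wQ]|w [Pw wE]].
  split=> //=; rewrite dot_sumr -sumrN; apply: eq_bigr => j Qj.
  exact/eqP/wQ.
split=> // j Qj; move: wE => /= /eqP; rewrite dot_sumr -addr_eq0 -big_split /= => /eqP H.
have := @psumr_eq0P R J Q (fun i => dot w (mu i) + 1).
move=> /(_ _ H j Qj) E; rewrite /active -addr_eq0 E // => i _.
by rewrite addrC slack_ge0.
Qed.

Lemma corner_vertex v : corner v -> vertex polyh v.
Proof.
move=> [Pv cv]; split; first by exists v.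
have [H1 H2] := face_support Pv (fun j => id : active v j -> active v j).
exists (\sum_(j | active v j) mu j), (- \sum_(j | active v j) 1); split=> //.
rewrite -H2; apply/seteqP; split=> [w ->|w [Pw wv]]; first by split.
apply/eqP; rewrite -subr_eq0; apply/eqP; apply: cv => j vj.
by rewrite dotDl dotNl (eqP (wv j vj)) (eqP vj) subrr.
Qed.

Section ExtremeRay.
Variable v : 'rV[R]_d.
Hypothesis cv : corner v.

Definition tcone : set 'rV[R]_d := [set x | forall j, active v j -> 0 <= dot x (mu j)].

Let h := \sum_(j | active v j) mu j.

Lemma tcone_height0 x : tcone x -> dot x h = 0 -> x = 0.
Proof.
move=> Cx; rewrite /h dot_sumr => H; apply: cv.2 => j vj.
exact: (@psumr_eq0P R J (active v) (fun i => dot x (mu i)) Cx H j vj).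
Qed.

(** Fixing the height h, the sum of the active normals, makes the pointed cone bounded. A move in
    the kernel of h that does not raise g therefore reaches a new facet of the cone, and this ends
    at an extreme ray on which g is still negative. *)
Lemma extreme_ray g y : tcone y -> dot y g < 0 -> exists z,
  [/\ tcone z, dot z g < 0 &
    forall x, (forall j, active v j -> dot z (mu j) = 0 -> dot x (mu j) = 0) ->
      exists t : R, x = t *: z].
Proof.
have [m] := ubnP #|[pred j | active v j & dot y (mu j) != 0]|.
elim: m y => // m IH y ym Cy yg.
have hy : dot y h != 0.
  by apply/eqP => /(tcone_height0 Cy) y0; move: yg; rewrite y0 dot0l ltxx.
case: (pselect (forall x, dot x h = 0 ->
    (forall j, active v j -> dot y (mu j) = 0 -> dot x (mu j) = 0) -> x = 0)) => [ex|].
  exists y; split=> // x xy; exists (dot x h / dot y h); apply/eqP; rewrite -subr_eq0.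
  apply/eqP; apply: ex; first by rewrite dotDl dotNl dotZl divfK ?subrr.
  by move=> j vj yj; rewrite dotDl dotNl dotZl yj xy // mulr0 subrr.
move=> /existsNP[x0] /not_implyP[x0h] /not_implyP[x0y /eqP x0n].
have [x [xn xh xy xg]] : exists x, [/\ x != 0, dot x h = 0,
    forall j, active v j -> dot y (mu j) = 0 -> dot x (mu j) = 0 & dot x g <= 0].
  case: (leP (dot x0 g) 0) => x0g; first by exists x0.
  exists (- x0); rewrite oppr_eq0 !dotNl x0h oppr0 oppr_le0 ltW //; split=> // j vj yj.
  by rewrite dotNl x0y ?oppr0.
(* Facets inactive at v do not constrain the cone; the defaults 1 and 0 keep them from being the
   first to vanish. *)
pose a j := if active v j then dot y (mu j) else 1.
pose b j := if active v j then dot x (mu j) else 0.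
have [|||t [t0 tP [j aj tj]]] := @first_zero J a b.
- by move=> j; rewrite /a; case: ifP => // /Cy.
- move=> j; rewrite /a /b; case: ifP => [vj yj|_ /eqP]; last by rewrite oner_eq0.
  by rewrite xy.
- apply: contrapT => H; move/eqP: xn; apply; apply: tcone_height0 => // j vj.
  by rewrite leNgt; apply/negP => xj; apply: H; exists j; rewrite /b vj.
have E i : active v i -> dot (y + t *: x) (mu i) = a i + t * b i.
  by move=> vi; rewrite /a /b vi dotDl dotZl.
have vj : active v j.
  by move: tj; rewrite /a /b; case: ifP => // _ /eqP; rewrite mulr0 addr0 oner_eq0.
apply: (IH (y + t *: x)).
- move: ym; rewrite ltnS; apply: leq_trans; apply: proper_card; apply/properP; split.
    apply/fintype.subsetP => i; rewrite !inE => /andP[vi]; rewrite vi /=; apply: contra => /eqP yi.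
    by rewrite dotDl dotZl yi xy // mulr0 addr0.
  exists j; rewrite inE vj /=; first by move: aj; rewrite /a vj.
  by rewrite E // tj eqxx.
- by move=> i vi; rewrite E.
- by rewrite dotDl dotZl; apply: ltr_wnDr => //; rewrite mulr_ge0_le0 // ltW.
Qed.

Lemma extreme_edge z : tcone z -> z != 0 ->
  (forall x, (forall j, active v j -> dot z (mu j) = 0 -> dot x (mu j) = 0) ->
      exists t : R, x = t *: z) ->
  exists E, [/\ edge polyh E, E v & exists2 t, 0 < t & E (v + t *: z)].
Proof.
move=> Cz z0 ez; have Pv := cv.1.
pose Q : pred J := [pred j | active v j & dot z (mu j) == 0].
have vQ j : Q j -> active v j by case/andP.
have [S1 S2] := face_support Pv vQ.
set E := [set w | _] in S1 S2.
have [t t0 tP] : exists2 t, 0 < t & forall j, 0 <= 1 + dot v (mu j) + t * dot z (mu j).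
  apply: small_step => j; first exact: slack_ge0.
  by move/eqP; rewrite slack_eq0 => /Cz.
have Ez : E (v + t *: z).
  split=> [|j /andP[vj /eqP zj]]; first by apply: polyhP => j; rewrite dot_move.
  by rewrite -slack_eq0 dot_move zj mulr0 addr0 slack_eq0.
exists E; split=> //; last by exists t.
split; first split; first by exists v.
  by exists (\sum_(j | Q j) mu j), (- \sum_(j | Q j) 1).
exists v, (t *: z); split=> //.
- rewrite /row_free rank_rV scaler_eq0 (gt_eqF t0) //= z0 //.
- by move=> i; rewrite row_id.
- move=> w [Pw wQ]; have [s sE] : exists s, w - v = s *: z.
    apply: ez => j vj zj; rewrite dotDl dotNl (eqP vj).
    by rewrite (eqP (wQ j _)) ?subrr // /Q /= vj zj eqxx.
  rewrite sE; apply/sub_rVP; exists (s / t).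
  by rewrite scalerA divfK // gt_eqF.
Qed.

End ExtremeRay.

End Polyhedron.

(** * Delzant corners and facets *)

Section Delzant.
Context {R : realType} {d : nat}.

Lemma mulmx_trE m n (A : 'M[R]_(m, d)) (B : 'M[R]_(n, d)) i j :
  (A *m B^T) i j = dot (row i A) (row j B).
Proof. by rewrite dotE mxE; apply: eq_bigr => k _; rewrite !mxE. Qed.

Lemma dual_basis_expand (f alpha : 'I_d -> 'rV[R]_d) x :
  (forall i j, dot (f i) (alpha j) = (i == j)%:R) ->
  x = \sum_i dot x (alpha i) *: f i.
Proof.
move=> H; pose N := \matrix_i f i; pose A := \matrix_i alpha i.
have NA : N *m A^T = 1%:M.
  by apply/matrixP => i j; rewrite [RHS]mxE -H mulmx_trE !rowK.
have AN : A^T *m N = 1%:M by exact: mulmx1C.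
rewrite -{1}[x]mulmx1 -AN mulmxA mulmx_sum_row; apply: eq_bigr => i _.
by rewrite rowK -dot_row_mul rowK.
Qed.

Context {r : nat} (mu : 'I_r -> 'rV[R]_d).
Hypothesis prim : forall j, primitive (mu j).
Hypothesis irredundant :
  forall j, polyh mu <> [set w | forall i, i != j -> -1 <= dot w (mu i)].
Hypothesis delz : delzant (polyh mu).

(** The cone at v is generated by the edge directions: a vector of the cone that is negative on some
    f_k would yield an extreme ray, hence an edge, negative on f_k. That edge would point along -
    alpha_k, which the pointedness of the cone excludes. *)
Lemma delzant_cone v : corner mu v -> exists alpha f : 'I_d -> 'rV[R]_d,
  [/\ forall i, Defs.integral (alpha i), forall i, Defs.integral (f i),
     forall i j, dot (f i) (alpha j) = (i == j)%:R,
     forall i, tcone mu v (alpha i)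
   & forall y i, tcone mu v y -> 0 <= dot y (f i)].
Proof.
move=> cv; have [A [E [uA Einj Eedge Eall EA]]] := delz (corner_vertex cv).
pose AR := map_mx (intr : int -> R) A.
pose FR := map_mx (intr : int -> R) (invmx A).
have AF : AR *m FR = 1%:M by rewrite -map_mxM mulmxV // map_mx1.
have intA i j : AR i j \is a Num.int by rewrite mxE intr_int.
have intF i j : FR i j \is a Num.int by rewrite mxE intr_int.
have Etwo i : exists t : R, t != 0 /\ polyh mu (v + t *: row i AR).
  have [[Eface [p [B [Ep rB EB _]]]] Ev] := Eedge i.
  have sub : E i `<=` polyh mu by have [_ [xi [c [_ ->]]]] := Eface; move=> w [].
  have B0 : row 0 B != 0.
    apply/eqP => B0; move: rB; rewrite /row_free (_ : B = 0) ?mxrank0 //.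
    by apply/row_matrixP => k; rewrite ord1 B0 row0.
  have [q [Eq qv]] : exists q, E i q /\ q != v.
    case: (eqVneq p v) => [pv|]; last by exists p.
    exists (p + row 0 B); split; first exact: EB.
    by rewrite pv -subr_eq0 addrC addKr.
  have [t tE] := EA i q Eq; exists t; split.
    by apply: contra qv => /eqP t0; rewrite -subr_eq0 tE t0 scale0r.
  by rewrite -tE addrC subrK; exact: sub.
have [T HT] : exists T : 'I_d -> R, forall i, T i != 0 /\ polyh mu (v + T i *: row i AR).
  by have [T HT] := @choice _ _ _ Etwo; exists T.
(* [delzant] only gives the lines of the edges; the sign makes each basis vector point into the
   polytope. *)
pose sg i : R := if 0 < T i then 1 else -1.
have sgsg i : sg i * sg i = 1 by rewrite /sg; case: ifP => _; rewrite ?mulrNN ?mulr1.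
have sgint i : sg i \is a Num.int by rewrite /sg; case: ifP => _; rewrite ?rpredN rpred1.
have sgT i : 0 < sg i * T i.
  rewrite /sg; case: ifPn => [|nT]; rewrite ?mul1r // mulN1r oppr_gt0 lt_neqAle (HT i).1.
  by rewrite leNgt.
exists (fun i => sg i *: row i AR), (fun i => sg i *: row i FR^T).
have dual i j : dot (sg i *: row i FR^T) (sg j *: row j AR) = (i == j)%:R.
  rewrite dotZl dotZr dot_row_mul -row_mul -trmx_mul AF trmx1.
  rewrite [row i _ _ _]mxE mxE.
  by case: eqP => [<-|_]; rewrite ?mulr1 ?sgsg // !mulr0.
have Calpha i : tcone mu v (sg i *: row i AR).
  move=> j vj; have := (HT i).2 j; rewrite dotDl (eqP vj) lerDl !dotZl => H.
  rewrite -(pmulr_rge0 _ (sgT i)).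
  have -> : sg i * T i * (sg i * dot (row i AR) (mu j)) =
     (sg i * sg i) * (T i * dot (row i AR) (mu j)) by ring.
  by rewrite sgsg mul1r.
split=> //.
- by move=> i j; rewrite mxE rpredM // mxE.
- by move=> i j; rewrite mxE rpredM // !mxE intr_int.
move=> y k Cy; rewrite leNgt; apply/negP => yk.
have [z [Cz zk ez]] := extreme_ray cv Cy yk.
have z0 : z != 0 by apply: contraTneq zk => ->; rewrite dot0l ltxx.
have [E' [eE E'v [t t0 E'z]]] := extreme_edge cv Cz z0 ez.
have [i Ei] := Eall _ eE E'v; rewrite Ei in E'z.
have [s] := EA i _ E'z; rewrite addrC addKr -/AR => sE.
have zE : z = (s / t * sg i) *: (sg i *: row i AR).
  rewrite scalerA -mulrA sgsg mulr1 mulrC -scalerA -sE scalerA mulVf ?scale1r //.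
  by rewrite gt_eqF.
move: zk; rewrite zE dotZl [dot (sg i *: _) _]dotC dual.
case: eqP => [_|_]; last by rewrite mulr0 ltxx.
rewrite mulr1 => neg; have Ci := Calpha i.
have : z = 0.
  apply: cv.2 => j vj; apply/eqP; rewrite eq_le Cz // andbT zE dotZl.
  by rewrite mulr_le0_ge0 // ?(ltW neg) // Ci.
by move/eqP: z0.
Qed.

Lemma primitive_scale (nu f : 'rV[R]_d) (m : R) : primitive nu ->
  Defs.integral f -> nu = m *: f -> 0 <= m -> m \is a Num.int -> nu = f.
Proof.
move=> [_ P] intf E m0 /intrP[z zE].
have mE : m = `|z|%N%:R.
  by rewrite zE -[in LHS](@gez0_abs z) // -(ler0z R) -zE.
by rewrite E mE (P `|z|%N f intf) ?scale1r // E mE.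
Qed.

(** The facet normals at a vertex form the dual basis of its edge directions. Each dual vector is
    proportional to an active normal, primitivity makes them equal, and irredundancy excludes
    further active facets. *)
Lemma delzant_corner v : corner mu v -> exists (f : 'I_d -> 'I_r) (alpha : 'I_d -> 'rV[R]_d),
  [/\ forall j, active mu v j <-> exists i, f i = j,
     forall i, Defs.integral (alpha i) & forall i j, dot (mu (f i)) (alpha j) = (i == j)%:R].
Proof.
move=> cv; have [alpha [f [ia iF dual Ca Cf]]] := delzant_cone cv.
have expand x : x = \sum_i dot x (alpha i) *: f i by exact: dual_basis_expand.
have Hk k : exists j, active mu v j /\ mu j = f k.
  (* x lies inside the face of the cone opposite to alpha_k. If no active normal vanished on x and
     were positive on alpha_k, then x - t alpha_k would stay in the cone for a small t, against
     [Cf]. *)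
  pose x := \sum_(i | i != k) alpha i.
  have Cx : tcone mu v x.
    by move=> j vj; rewrite /x dot_suml; apply: sumr_ge0 => i _; exact: Ca.
  have [j [vj xj kj]] : exists j, [/\ active mu v j, dot x (mu j) = 0 & 0 < dot (alpha k) (mu j)].
    apply: contrapT => H.
    pose a j := if active mu v j then dot x (mu j) else 1.
    have [||t t0 tP] := @small_step R _ a (fun j => - dot (alpha k) (mu j)).
    - by move=> j; rewrite /a; case: ifP => // /Cx.
    - move=> j; rewrite /a; case: ifP => [vj xj|_ /eqP]; last by rewrite oner_eq0.
      rewrite oppr_ge0 leNgt; apply/negP => kj; apply: H; exists j; split=> //.
    have /(Cf _ k) : tcone mu v (x - t *: alpha k).
      by move=> j vj; have := tP j; rewrite /a vj mulrN dotDl dotNl dotZl.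
    rewrite dotDl dotNl dotZl [dot (alpha k) _]dotC dual eqxx mulr1 /x dot_suml big1 => [|i ik].
      by rewrite sub0r oppr_ge0 leNgt t0.
    by rewrite dotC dual eq_sym (negPf ik).
  exists j; split=> //.
  have muE : mu j = dot (mu j) (alpha k) *: f k.
    rewrite {1}[mu j]expand (bigD1 k) //= big1 ?addr0 // => i ik.
    have H := @psumr_eq0P R 'I_d (fun i => i != k) (fun i => dot (alpha i) (mu j)).
    rewrite dotC H ?scale0r // => [l _|]; first exact: Ca.
    by rewrite -dot_suml.
  apply: primitive_scale muE _ _ => //.
    by rewrite dotC ltW.
  by apply: dot_int => //; exact: (prim j).1.
have [g Hg] := @choice _ _ _ Hk.
exists g, alpha; split=> // [j|i j]; last by rewrite (Hg i).2 dual.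
split=> [vj|[i <-]]; last exact: (Hg i).1.
(* A further active normal is a nonnegative combination of the normals found, which are all tight at
   v, so its inequality would follow from theirs. *)
apply: contrapT => H; apply: (irredundant (j := j)).
apply/seteqP; split=> [w Pw i _|w Hw i]; first exact: Pw.
case: (eqVneq i j) => [->|ij]; last exact: Hw.
have E : dot w (mu j) = -1 + \sum_i dot (mu j) (alpha i) * (1 + dot w (mu (g i))).
  have -> : dot w (mu j) = -1 + dot (w - v) (mu j).
    by rewrite dotDl dotNl (eqP vj) opprK addrC addrK.
  congr (_ + _); rewrite {1}[mu j]expand dot_sumr; apply: eq_bigr => k _.
  by rewrite dotZr -(Hg k).2 dotDl dotNl (eqP (Hg k).1) opprK addrC.
rewrite E lerDl; apply: sumr_ge0 => k _; apply: mulr_ge0.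
  by rewrite dotC; exact: Ca.
rewrite addrC -[1]opprK subr_ge0; apply: Hw; apply/eqP => gk.
by apply: H; exists k.
Qed.

End Delzant.

Section Facets.
Context {R : realType} {d : nat} {r : nat} (mu : 'I_r -> 'rV[R]_d).
Hypothesis bounded : exists B : R, forall w, polyh mu w -> forall b, `|w 0 b| <= B.
Hypothesis prim : forall j, primitive (mu j).
Hypothesis irredundant :
  forall j, polyh mu <> [set w | forall i, i != j -> -1 <= dot w (mu i)].
Hypothesis delz : delzant (polyh mu).

(* A supporting vector with two or more nonzero coordinates in the dual basis
   of a vertex cuts out a face of codimension at least two. *)
Lemma facet_normal F nu : facet (polyh mu) F -> primitive nu ->
  supporting (polyh mu) F nu (-1) -> exists j, nu = mu j.
Proof.
move=> [[[p0 Fp0] _] [k dk [p [B [Fp rB FB _]]]]] pnu [nuge FE].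
have Pp0 : polyh mu p0 by move: Fp0; rewrite FE => -[].
have p0nu : dot p0 nu = -1 by move: Fp0; rewrite FE => -[].
have [v [cv _ vnu]] := climb bounded nu Pp0.
have {}vnu : dot v nu = -1 by apply/eqP; rewrite eq_le nuge ?andbT -?p0nu //; exact: cv.1.
have [f [alpha [actf ialpha dual]]] := delzant_corner prim irredundant delz cv.
have dual' i j : dot ((mu \o f) i) (alpha j) = (i == j)%:R by exact: dual.
have expand x : x = \sum_i dot x (alpha i) *: mu (f i) := dual_basis_expand x dual'.
have expand' x : x = \sum_i dot x (mu (f i)) *: alpha i.
  by apply: (@dual_basis_expand _ _ alpha (mu \o f)) => i j; rewrite dotC dual eq_sym.
have m0 i : 0 <= dot nu (alpha i).
  have [t t0 tP] : exists2 t, 0 < t & forall j, 0 <= 1 + dot v (mu j) + t * dot (alpha i) (mu j).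
    apply: small_step => j; first by apply: slack_ge0; exact: cv.1.
    by move/eqP; rewrite slack_eq0 => /actf[l <-]; rewrite dotC dual ler0n.
  have Pw : polyh mu (v + t *: alpha i) by apply: polyhP => j; rewrite dot_move.
  by have := nuge _ Pw; rewrite dotDl dotZl vnu lerDl (pmulr_rge0 _ t0) dotC.
have Fzero w i : F w -> dot nu (alpha i) != 0 -> dot (w - v) (mu (f i)) = 0.
  rewrite FE => -[Pw /= wnu] mi.
  have H j : 0 <= dot (w - v) (mu (f j)).
    have vj : active mu v (f j) by apply/actf; exists j.
    by rewrite dotDl dotNl (eqP vj) opprK addrC; exact: slack_ge0.
  have : \sum_j dot nu (alpha j) * dot (w - v) (mu (f j)) = 0.
    transitivity (dot (w - v) nu); last by rewrite dotDl dotNl wnu vnu subrr.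
    rewrite {2}[nu]expand dot_sumr; apply: eq_bigr => j _; by rewrite dotZr.
  move=> /psumr_eq0P E; have := E (fun j _ => mulr_ge0 (m0 j) (H j)) i isT.
  by move/eqP; rewrite mulf_eq0 (negPf mi) => /eqP.
case: (pselect (exists i, dot nu (alpha i) != 0)) => [[i mi]|H]; last first.
  have nu0 : nu = 0.
    rewrite [nu]expand big1 // => i _; have [->|mi] := eqVneq (dot nu (alpha i)) 0.
      by rewrite scale0r.
    by case: H; exists i.
  by move: vnu; rewrite nu0 dot0r => /eqP; rewrite eq_sym oppr_eq0 oner_eq0.
exists (f i).
have other j : j != i -> dot nu (alpha j) = 0.
  move=> ji; apply/eqP; apply: contraT => mj.
  (* Both normals vanish on the d - 1 independent directions of F, and they are independent because
     their pairings with alpha_i and alpha_j form the identity; the ranks would add up to d + 1. *)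
  pose S : 'M[R]_(2, d) := \matrix_(a < 2) (if a == 0 then mu (f i) else mu (f j)).
  have BS : B *m S^T = 0.
    apply/matrixP => a b; rewrite [RHS]mxE.
    rewrite mulmx_trE rowK; have Hz l : dot nu (alpha l) != 0 -> dot (row a B) (mu (f l)) = 0.
      move=> ml; have := Fzero _ l (FB a) ml; have := Fzero _ l Fp ml.
      rewrite !dotDl => E1 E2; have := congr2 (fun x y => y - x) E1 E2.
      by rewrite subrr => <-; ring.
    by case: ifP => _; exact: Hz.
  pose S' : 'M[R]_(2, d) := \matrix_(a < 2) (if a == 0 then alpha i else alpha j).
  have SS : S *m S'^T = 1%:M.
    apply/matrixP => a b; rewrite mulmx_trE !rowK [RHS]mxE.
    case: (splitP (a : 'I_(1 + 1))) => a' aE; case: (splitP (b : 'I_(1 + 1))) => b' bE;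
      rewrite !ord1 /= in aE bE; rewrite -!val_eqE /= aE bE /= dual ?eqxx //.
      by rewrite eq_sym (negPf ji).
    by rewrite (negPf ji).
  have rS : \rank S^T = 2%N.
    have := mxrankM_maxl S S'^T; rewrite SS mxrank1 => H.
    by apply/eqP; rewrite mxrank_tr eqn_leq rank_leq_row.
  have := mulmx0_rank_max BS; move: rB => /eqP ->; rewrite rS dk.
  by rewrite addn2 ltnn.
have nuE : nu = dot nu (alpha i) *: mu (f i).
  rewrite {1}[nu]expand (bigD1 i) //= big1 ?addr0 // => j ji.
  by rewrite other // scale0r.
apply: (primitive_scale pnu _ nuE (m0 i)); first exact: (prim _).1.
by apply: dot_int => //; exact: pnu.1.
Qed.

End Facets.

(** * The thickened polytope *)

Section Thickening.
Context {R : realType} {d r : nat} (mu : 'I_r -> 'rV[R]_d) (nu : 'rV[R]_d).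
Variable sel : bool -> bool -> bool.
Implicit Types (w : 'rV[R]_d) (x : 'rV[R]_(d + 1)) (tb b : bool).

Definition mub b : 'rV[R]_d := if b then nu else 0.
Definition height x : R := x 0 (rshift d ord0).
Definition mkpt w (y : R) : 'rV[R]_(d + 1) := row_mx w (const_mx y).
Definition sgb tb : R := if tb then 1 else -1.

(* A facet is a wall [inl j] over a facet of the base or a lid [inr (tb, b)], on
   top ([tb]) or at the bottom, of slope nu ([b]) or 0. Lids that are not
   selected get the normal 0. *)
Definition tfacet : finType := ('I_r + bool * bool)%type.
Definition tnormal (i : tfacet) : 'rV[R]_(d + 1) :=
  match i with
  | inl j => mkpt (mu j) 0
  | inr (tb, b) => if sel tb b then sgb tb *: mkpt (mub b) (-1) else 0
  end.

Lemma dot_mkpt x w y : dot x (mkpt w y) = dot (lsubmx x) w + height x * y.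
Proof.
rewrite /dot -{1}[x]hsubmxK tr_row_mx mul_row_col mxE; congr (_ + _).
by rewrite mxE big_ord1 !mxE.
Qed.

Lemma mkptK x : mkpt (lsubmx x) (height x) = x.
Proof.
rewrite -[RHS]hsubmxK; congr row_mx; apply/rowP => i.
by rewrite (ord1 i) !mxE.
Qed.

Lemma lsub_mkpt w y : lsubmx (mkpt w y) = w. Proof. exact: row_mxKl. Qed.
Lemma height_mkpt w y : height (mkpt w y) = y.
Proof. by rewrite /height row_mxEr mxE. Qed.

Lemma mkptZ (c : R) w y : c *: mkpt w y = mkpt (c *: w) (c * y).
Proof. by rewrite /mkpt scale_row_mx; congr row_mx; apply/rowP => i; rewrite !mxE. Qed.

Lemma integral_mkpt w y : Defs.integral w -> y \is a Num.int -> Defs.integral (mkpt w y).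
Proof.
move=> iw iy i; rewrite -(splitK i); case: (fintype.split i) => k /=.
  by rewrite row_mxEl.
by rewrite row_mxEr mxE.
Qed.

Definition tlen tb b x : R := sgb tb * (dot (lsubmx x) (mub b) - height x).

Lemma dot_tnormal tb b x : sel tb b -> dot x (tnormal (inr (tb, b))) = tlen tb b x.
Proof. by move=> H; rewrite /= H dotZr dot_mkpt mulrN1. Qed.

Lemma dot_tnormalN tb b x : ~~ sel tb b -> dot x (tnormal (inr (tb, b))) = 0.
Proof. by move=> /negPf H; rewrite /= H dot0r. Qed.

Lemma dot_inl j x : dot x (tnormal (inl j)) = dot (lsubmx x) (mu j).
Proof. by rewrite /= dot_mkpt mulr0 addr0. Qed.

Definition inthick x := forall i, 0 <= 1 + dot x (tnormal i).

Lemma inthickP x : inthick x <-> polyh mu (lsubmx x) /\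
  forall tb b, sel tb b -> 0 <= 1 + tlen tb b x.
Proof.
split=> [H|[H1 H2] [j|[tb b]]].
- split=> [|tb b s]; last by rewrite -dot_tnormal.
  by apply: polyhP => j; have := H (inl j); rewrite dot_inl.
- by rewrite dot_inl; exact: slack_ge0.
- by case: (boolP (sel tb b)) => s; [rewrite dot_tnormal // H2|rewrite dot_tnormalN // addr0].
Qed.

Definition nmat (f : 'I_d.+1 -> tfacet) : 'M[R]_(d.+1, d + 1) := \matrix_k tnormal (f k).

Definition unimod (f : 'I_d.+1 -> tfacet) : Prop :=
  exists A : 'M[R]_(d.+1, d + 1), [/\ forall k, Defs.integral (row k A),
    nmat f *m A^T = 1%:M & A^T *m nmat f = 1%:M].

Lemma mulmx1C_cast p q (A : 'M[R]_(p, q)) (B : 'M[R]_(q, p)) :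
  p = q -> A *m B = 1%:M -> B *m A = 1%:M.
Proof. by move=> E; subst q; exact: mulmx1C. Qed.

Lemma unimodP f (a : 'I_d.+1 -> 'rV[R]_(d + 1)) : (forall k, Defs.integral (a k)) ->
  (forall k l, dot (tnormal (f k)) (a l) = (k == l)%:R) -> unimod f.
Proof.
move=> ia H; have E : nmat f *m (\matrix_k a k)^T = 1%:M.
  by apply/matrixP => k l; rewrite mulmx_trE !rowK [RHS]mxE.
exists (\matrix_k a k); split=> // [k|]; first by rewrite rowK.
by apply: mulmx1C_cast E; rewrite addn1.
Qed.

(* Charts at a vertex of the base: its walls and one lid, or, where two lids
   meet, both of them and all its walls except the wall [f j0] of normal nu. *)
Definition vfac (f : 'I_d -> 'I_r) tb b (k : 'I_d.+1) : tfacet :=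
  if unlift ord0 k is Some j then inl (f j) else inr (tb, b).

Definition sfac (f : 'I_d -> 'I_r) (j0 : 'I_d) tb (k : 'I_d.+1) : tfacet :=
  if unlift ord0 k is Some j then (if j == j0 then inr (tb, true) else inl (f j))
  else inr (tb, false).

Lemma eq_lift0 (j : 'I_d) : (ord0 == lift ord0 j) = false.
Proof. by apply/negP => /eqP/(congr1 val). Qed.

Hypothesis imu : forall j, Defs.integral (mu j).
Hypothesis inu : Defs.integral nu.

Lemma imub b : Defs.integral (mub b).
Proof. by case: b => // i; rewrite mxE rpred0. Qed.

Lemma isgb tb : sgb tb \is a Num.int.
Proof. by case: tb; rewrite /= ?rpredN rpred1. Qed.

Lemma sgsgb tb : sgb tb * sgb tb = 1.
Proof. by case: tb; rewrite /= ?mulrNN mulr1. Qed.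

Lemma unimod_vfac (f : 'I_d -> 'I_r) (alpha : 'I_d -> 'rV[R]_d) tb b : sel tb b ->
  (forall i, Defs.integral (alpha i)) ->
  (forall i j, dot (mu (f i)) (alpha j) = (i == j)%:R) -> unimod (vfac f tb b).
Proof.
move=> s ia dual.
pose a k := if unlift ord0 k is Some j then mkpt (alpha j) (dot (mub b) (alpha j))
  else mkpt 0 (- sgb tb).
apply: (@unimodP _ a) => [k|k l]; rewrite /a.
  case: (unliftP ord0 k) => [j|] _; apply: integral_mkpt => //.
  - by apply: dot_int => //; exact: imub.
  - by move=> i; rewrite mxE rpred0.
  - by rewrite rpredN isgb.
rewrite dotC /vfac; case: (unliftP ord0 k) => [j|] ->; case: (unliftP ord0 l) => [j'|] ->; cbv iota beta.
- by rewrite dot_inl lsub_mkpt dotC dual (inj_eq lift_inj).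
- by rewrite dot_inl lsub_mkpt dot0l eq_sym eq_lift0.
- by rewrite dot_tnormal // /tlen lsub_mkpt height_mkpt [dot (alpha _) _]dotC subrr mulr0 eq_lift0.
- by rewrite dot_tnormal // /tlen lsub_mkpt height_mkpt dot0l sub0r opprK sgsgb eqxx.
Qed.

(** The normals (nu, -1) and (0, -1) of the two lids differ by the normal (nu, 0) of the omitted
    wall, so both lids span the same lattice as one lid and that wall. *)
Lemma unimod_sfac (f : 'I_d -> 'I_r) (alpha : 'I_d -> 'rV[R]_d) j0 tb :
  sel tb true -> sel tb false -> nu = mu (f j0) ->
  (forall i, Defs.integral (alpha i)) ->
  (forall i j, dot (mu (f i)) (alpha j) = (i == j)%:R) -> unimod (sfac f j0 tb).
Proof.
move=> st sf nuE ia dual.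
pose a k := if unlift ord0 k is Some j
  then (if j == j0 then sgb tb *: mkpt (alpha j0) 0 else mkpt (alpha j) 0)
  else - sgb tb *: mkpt (alpha j0) 1.
have iz (c : R) (x : 'rV[R]_(d + 1)) : c \is a Num.int -> Defs.integral x -> Defs.integral (c *: x).
  by move=> ic ix i; rewrite mxE rpredM.
apply: (@unimodP _ a) => [k|k l]; rewrite /a.
  case: (unliftP ord0 k) => [j|] _; first case: ifP => _.
  - by apply: iz; [exact: isgb|apply: integral_mkpt; rewrite ?rpred0].
  - by apply: integral_mkpt; rewrite ?rpred0.
  - by apply: iz; [rewrite rpredN isgb|apply: integral_mkpt; rewrite ?rpred1].
have nua j : dot (alpha j) nu = (j == j0)%:R by rewrite nuE dotC dual eq_sym.
have dual' i j : dot (alpha j) (mu (f i)) = (i == j)%:R by rewrite dotC.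
rewrite dotC /sfac; case: (unliftP ord0 k) => [j|] ->; case: (unliftP ord0 l) => [j'|] ->; cbv iota beta.
- rewrite (inj_eq lift_inj); case jj0: (j == j0); case jj0': (j' == j0).
  + rewrite (eqP jj0) (eqP jj0') eqxx.
    by rewrite dotZl dot_tnormal // /tlen lsub_mkpt height_mkpt subr0 nua eqxx mulr1 sgsgb.
  + rewrite (eqP jj0) eq_sym jj0'.
    by rewrite dot_tnormal // /tlen lsub_mkpt height_mkpt subr0 nua jj0' mulr0.
  + by rewrite (eqP jj0') dotZl dot_inl lsub_mkpt dual' jj0 mulr0.
  + by rewrite dot_inl lsub_mkpt dual'.
- rewrite [_ == ord0]eq_sym eq_lift0 dotZl; case jj0: (j == j0).
  + by rewrite dot_tnormal // /tlen lsub_mkpt height_mkpt nua eqxx subrr !mulr0.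
  + by rewrite dot_inl lsub_mkpt dual' jj0 mulr0.
- rewrite eq_lift0 dot_tnormal //; case: ifP => _; rewrite /tlen ?mkptZ lsub_mkpt height_mkpt.
  + by rewrite dot0r mulr0 subrr mulr0.
  + by rewrite dot0r subrr mulr0.
- by rewrite dot_tnormal // /tlen mkptZ lsub_mkpt height_mkpt dot0r sub0r mulr1 opprK sgsgb eqxx.
Qed.

Hypothesis bounded : exists B : R, forall w, polyh mu w -> forall c, `|w 0 c| <= B.
Hypothesis corners : forall v, corner mu v ->
  exists (f : 'I_d -> 'I_r) (alpha : 'I_d -> 'rV[R]_d),
  [/\ forall j, active mu v j <-> exists i, f i = j,
     forall i, Defs.integral (alpha i) & forall i j, dot (mu (f i)) (alpha j) = (i == j)%:R].
Hypothesis sel_ne : forall tb, exists b, sel tb b.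
(** Fibres have length at least 1: opposite lids never meet and no fibre is a point. *)
Hypothesis gap : forall w b b', polyh mu w -> sel true b -> sel false b' ->
  1 <= 2 + dot w (mub b) - dot w (mub b').
(** Two lids of one side can only meet over <w, nu> = 0. There the vertex v supplies a wall of
    normal nu, inactive at w, which the chart can trade for the second lid. *)
Hypothesis slice : forall w tb, polyh mu w -> sel tb true -> sel tb false -> dot w nu = 0 ->
  exists v, [/\ corner mu v, forall j, active mu w j -> active mu v j
    & exists2 j, active mu v j & nu = mu j].

Lemma thick_bounded : exists B : R, forall x, inthick x -> forall c, `|x 0 c| <= B.
Proof.
have [B HB] := bounded.
have H (x : 'rV[R]_(d + 1)) tb b : polyh mu (lsubmx x) ->
    `|dot (lsubmx x) (mub b)| <= \sum_c `|B| * `|nu 0 c|.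
  move=> Px; rewrite dotE; apply: le_trans (ler_norm_sum _ _ _) _; apply: ler_sum => c _.
  rewrite normrM; apply: ler_pM => //; first exact: le_trans (HB _ Px c) (ler_norm _).
  by case: b => //=; rewrite mxE normr0.
exists (`|B| + (1 + \sum_c `|B| * `|nu 0 c|)) => x /inthickP[Px Hx] c.
have S0 : 0 <= \sum_c `|B| * `|nu 0 c| by apply: sumr_ge0 => i _; rewrite mulr_ge0.
rewrite -(splitK c); case: (fintype.split c) => k /=.
  have := HB _ Px k; rewrite mxE => Hk; apply: le_trans Hk _.
  by apply: le_trans (ler_norm _) _; rewrite lerDl addr_ge0.
have [b sb] := sel_ne true; have [b' sb'] := sel_ne false.
have := Hx _ _ sb; have := Hx _ _ sb'; rewrite /tlen /= mul1r mulN1r opprB.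
have := H x true b Px; have := H x true b' Px; rewrite !ler_norml.
rewrite ord1 -/(height x); have := normr_ge0 B.
move: (`|B|) (height x) (dot _ _) (dot _ _) (\sum_c _) => B' y t t' S.
by move=> B0 /andP[h1 h2] /andP[h3 h4] h5 h6; apply/andP; split; lra.
Qed.

(** By [gap] all active lids lie on one side. With at most one active slope, a vertex of the face of
    w and one lid make a chart; with two, [slice] provides it. *)
Lemma thick_cover x : inthick x -> exists2 f : 'I_d.+1 -> tfacet, unimod f &
  forall i, 1 + dot x (tnormal i) = 0 -> exists k, f k = i.
Proof.
move=> /inthickP[Px Hx].
have one tb b v : sel tb b -> corner mu v ->
    (forall j, active mu (lsubmx x) j -> active mu v j) ->
    (forall tb' b', sel tb' b' -> 1 + tlen tb' b' x = 0 -> (tb', b') = (tb, b)) ->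
    exists2 f : 'I_d.+1 -> tfacet, unimod f & forall i, 1 + dot x (tnormal i) = 0 -> exists k, f k = i.
  move=> s cv av uniq; have [f [alpha [af ia dual]]] := corners cv.
  exists (vfac f tb b) => [|[j|[tb' b']]]; first exact: unimod_vfac dual.
    move/eqP; rewrite dot_inl slack_eq0 => /av /af[i <-].
    by exists (lift ord0 i); rewrite /vfac liftK.
  case: (boolP (sel tb' b')) => s'; last by rewrite dot_tnormalN // addr0 => /eqP; rewrite oner_eq0.
  by rewrite dot_tnormal // => /(uniq _ _ s') ->; exists ord0; rewrite /vfac unlift_none.
have opp b b' : sel true b -> sel false b' -> 1 + tlen true b x = 0 -> 1 + tlen false b' x = 0 -> False.
  move=> s s'; have := gap Px s s'; rewrite /tlen /= mul1r mulN1r.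
  move: (dot _ _) (dot _ _) (height x) => t t' y; lra.
have [v [cv av _]] := climb bounded 0 Px.
case: (pselect (exists tb b, sel tb b /\ 1 + tlen tb b x = 0)) => [[tb [b [s E]]]|none]; last first.
  have [b sb] := sel_ne true; apply: (one true b v) => // tb' b' s' E'.
  by case: none; exists tb', b'.
have same tb' b' : sel tb' b' -> 1 + tlen tb' b' x = 0 -> tb' = tb.
  move=> s' E'; case: tb s E => s E; case: tb' s' E' => s' E' //.
    by case: (opp _ _ s s').
  by case: (opp _ _ s' s).
case: (pselect (sel tb (~~ b) /\ 1 + tlen tb (~~ b) x = 0)) => [[s2 E2]|single]; last first.
  apply: (one tb b v) => // tb' b' s' E'; have tE := same _ _ s' E'; rewrite tE in s' E' *.
  case: (eqVneq b' b) => [-> //|bb]; case: single.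
  by have -> : ~~ b = b' by move: bb; case: (b); case: (b').
have [st sf Et Ef] : [/\ sel tb true, sel tb false, 1 + tlen tb true x = 0 & 1 + tlen tb false x = 0].
  by case: b s E s2 E2 => s E s2 E2; split.
(* Both lids have the same constant term, so they have the same height only where the slopes agree
   on w. *)
have wnu : dot (lsubmx x) nu = 0.
  move: Et Ef; rewrite /tlen /= dot0r /sgb; move: (dot _ _) (height x) => t y.
  by case: ifP => _; lra.
have {cv av}[{}v [cv av [j vj nuE]]] := slice Px st sf wnu.
have [f [alpha [af ia dual]]] := corners cv.
have [j0 fj0] := (af j).1 vj; rewrite -fj0 in nuE.
exists (sfac f j0 tb) => [|[i|[tb' b']]]; first exact: unimod_sfac dual.
  move/eqP; rewrite dot_inl slack_eq0 => wi; have /af[i' fi'] := av _ wi.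
  exists (lift ord0 i'); rewrite /sfac liftK -fi'; case: eqP => // i'E.
  (* The wall omitted from this chart has normal nu, on which w takes the value 0 rather than -1. *)
  move: wi; rewrite /active -fi' i'E -nuE wnu => /eqP/esym/eqP.
  by rewrite oppr_eq0 oner_eq0.
case: (boolP (sel tb' b')) => s'; last by rewrite dot_tnormalN // addr0 => /eqP; rewrite oner_eq0.
rewrite dot_tnormal // => /(same _ _ s') ->; case: b' {s'}.
  by exists (lift ord0 j0); rewrite /sfac liftK eqxx.
by exists ord0; rewrite /sfac unlift_none.
Qed.

Definition tchart : finType := {f : {ffun 'I_d.+1 -> tfacet} | `[< unimod f >]}.

Lemma tchartP (I : tchart) : unimod (val I).
Proof. exact/asboolP/(valP I). Qed.

Definition tdual (I : tchart) := projT1 (cid (tchartP I)).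

Lemma tnormal_integral i : Defs.integral (tnormal i).
Proof.
case: i => [j|[tb b]] /=; first by apply: integral_mkpt; rewrite ?rpred0.
case: ifP => _ i; last by rewrite mxE rpred0.
rewrite mxE rpredM ?isgb //; apply: integral_mkpt; first exact: imub.
by rewrite rpredN rpred1.
Qed.

Lemma mk_tchart (f : 'I_d.+1 -> tfacet) : unimod f -> exists I : tchart, val I =1 f.
Proof.
move=> uf; have uF : `[< unimod [ffun k => f k] >].
  apply/asboolP; have -> // : ([ffun k => f k] : {ffun 'I_d.+1 -> tfacet}) = f :> (_ -> _).
  by apply/funext => k; rewrite ffunE.
by exists (Sub [ffun k => f k] uF) => k; rewrite SubK ffunE.
Qed.

Lemma tcharts_cover x : inthick x -> exists I : tchart,
  forall i, 1 + dot x (tnormal i) = 0 -> exists k, val I k = i.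
Proof.
move=> /thick_cover[f uf Hf]; have [I IE] := mk_tchart uf.
by exists I => i /Hf[k <-]; exists k.
Qed.

Definition thick_data : toric_data R d.+1 (d + 1) :=
  @ToricData R d.+1 (d + 1) tfacet tchart tnormal (fun I => val I) tdual tnormal_integral
    (fun I => let: And3 a _ _ := projT2 (cid (tchartP I)) in a)
    (fun I => let: And3 _ a _ := projT2 (cid (tchartP I)) in a)
    (fun I => let: And3 _ _ a := projT2 (cid (tchartP I)) in a)
    thick_bounded tcharts_cover.

End Thickening.

(** * Reduced spaces *)

Section Along.
Context {R : realType} {V W : normedModType R}.

Lemma diff_along (g : V -> W) (h : R -> W) z v w :
  differentiable g z -> (\forall t \near (0 : R), g (z + t *: v) = h t) ->
  is_diff (0 : R) h (fun t => t *: w) -> 'd g z v = w.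
Proof.
move=> dg gh dh.
have dl : is_diff (0 : R) (fun t : R => z + t *: v) (fun t => t *: v).
  have H := is_diffD (is_diff_cst z (0 : R)) (is_diff_scalel (0 : R) v).
  by rewrite add0r in H; exact: H.
have dg' : is_diff (z + (0 : R) *: v) g ('d g z).
  by rewrite scale0r addr0; exact: differentiableP.
have dc := is_diff_comp dl dg'.
have E := is_diffE (1 : R) (near_eq_is_diff gh dc).
by have := etrans (esym E) (is_diffE (1 : R) dh); rewrite /= !scale1r.
Qed.

End Along.

Lemma integral_rectangle (R : realType) (A B : set R) (c : R) :
  measurable A -> measurable B ->
  (\int[lebesgue_measure \x lebesgue_measure]_(z in A `*` B) c%:E =
   c%:E * (lebesgue_measure A * lebesgue_measure B))%E.
Proof.
move=> mA mB; rewrite integral_cst; last exact: measurableX.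
by congr (_ * _)%E; exact: product_measure1E.
Qed.

Section ReducedSpace.
Context {R : realType} {n d : nat} (D : toric_data R n (d + 1)).
Local Notation M := (tmanifold D).
Local Notation omega := (@tomega R n (d + 1) D).
Local Notation Phi := (sub_moment (D := D)).
Local Notation a := (sub_act (D := D)).
Implicit Types (I J : charts D) (u v : 'rV[R]_(n + n)) (w : 'rV[R]_d).

Lemma mkptD w w' (y y' : R) : mkpt w y + mkpt w' y' = mkpt (w + w') (y + y').
Proof. by rewrite /mkpt add_row_mx; congr row_mx; apply/rowP => i; rewrite !mxE. Qed.

(** In action-angle coordinates omega is dx /\ d(th): [Di] undoes [Dm], and the factors 1/2, 2 pi
    and 1/pi cancel. *)
Lemma omega_dpol I u (y phi : 'rV[R]_(d + 1)) : regp u ->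
  ev2 (omega I u) (dpol u (y *m (nmx I)^T) 0) (dpol u 0 (phi *m (dual I)^T)) = dot y phi.
Proof.
move=> ru; rewrite ev2E /tomega /dpol !scaler0 !mul0mx add0r addr0.
rewrite -!scalemxAl -!scalemxAr -!scalemxAl [( _ *: _)^T]linearZ /= -!scalemxAr !trmx_mul trmxK.
rewrite -!mulmxA (mulmxA (Rm u)) RmJ0 (mulmxA (Th u)) ThThT (mulmxA (Di u)) DiDm // mul1mx.
rewrite (mulmxA (nmx I)^T) nmxT_dual mul1mx !scalerA mxE /dot.
rewrite (_ : 2^-1 / pi * (2 * pi) = 1) ?mul1r //.
have p0 : pi != 0 :> R by rewrite gt_eqF // pi_gt0.
by rewrite mulrACA !mulVf ?mulr1 ?pnatr_eq0.
Qed.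

Lemma smooth_mkpt (V : normedModType R) (U : set V) w (f : V -> R) :
  open U -> smooth_on U f -> smooth_on U (fun z => mkpt w (f z)).
Proof.
move=> oU sf; apply: smooth_mx => // b i; rewrite -(splitK i); case: (fintype.split i) => k /=.
  by under [X in smooth_on _ X]funext do rewrite row_mxEl; exact: smooth_cst.
by under [X in smooth_on _ X]funext do rewrite row_mxEr mxE.
Qed.

Lemma smooth_pol0 (V : normedModType R) (U : set V) I (x : V -> 'rV[R]_(d + 1)) :
  open U -> smooth_on U x -> (forall z, U z -> forall i : facets D, 0 < ell i (x z)) ->
  smooth_on U (fun z => pol I (x z) 0).
Proof.
move=> oU sx px; apply: smooth_zrow => // k; apply: csmoothM => //; last exact: csmooth_cst.
apply: csmooth_real; apply: smooth_sqrt => // [z Uz|]; first exact: px.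
exact: smooth_ell.
Qed.

(* One of the pieces into which [reduced_integral] cuts the reduced space. *)
Definition slice_piece w (U A : set (R * R)) (sigma : R * R -> M) (h : R * R -> R) : Prop :=
  [/\ [/\ open U, measurable A & A `<=` U], smooth_into U sigma,
      forall z, U z -> Phi (sigma z) = w, pulls_back_to omega U sigma h
    & forall z, U z -> 0 < h z].

(** Pads the finitely many pieces of a reduced space to a sequence. *)
Lemma slice_piece0 w sigma h : slice_piece w set0 set0 sigma h.
Proof.
have C k (W : normedModType R) (f : (R * R)%type -> W) : Ck k (set0 : set (R * R)%type) f.
  by elim: k f => [|k IH] f /=; [move=> x []|split=> [x []|v]; exact: IH].
by split=> //; split=> // j N; rewrite set0I.
Qed.

Section Interior.
Variables (w : 'rV[R]_d) (tm tp : R) (I : charts D).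
Hypothesis pos : forall y, tm < y < tp -> forall i : facets D, 0 < ell i (mkpt w y).

Let U := [set z : R * R | tm < z.1 < tp].

(** A slice transverse to the orbits of the subtorus: the height in the fibre and the angle of the
    extra circle are action-angle coordinates on the reduced space. *)
Definition annulus (z : R * R) : M :=
  act (mkpt 0 z.2) (parI I (pol I (mkpt w z.1) 0)).

Lemma annulusE z : U z -> annulus z = pt D (mkpt w z.1) (mkpt 0 z.2).
Proof.
move=> Uz; have px : tpoly D (mkpt w z.1) by move=> i; exact/ltW/pos.
by rewrite /annulus par_pol // act_pt // add0r.
Qed.

Lemma open_strip : open U.
Proof.
rewrite (_ : U = ((fun z : R * R => z.1) @^-1` `]tm, tp[%classic)); last first.
  by apply/seteqP; split=> z /=; rewrite in_itv.
by apply: open_comp; [move=> z _; exact: cvg_fst|exact: interval_open].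
Qed.

Lemma annulus_piece : slice_piece w U (`]tm, tp[%classic `*` `[0, 1[%classic) annulus (fun=> 1).
Proof.
have oU := open_strip.
have sx : smooth_on U (fun z : R * R => mkpt w z.1).
  by apply: smooth_mkpt => //; apply: smooth_fst => //; exact: smooth_id.
have sxi : smooth_on U (fun z : R * R => mkpt (0 : 'rV[R]_d) z.2).
  by apply: smooth_mkpt => //; apply: smooth_snd => //; exact: smooth_id.
have su : smooth_on U (fun z : R * R => pol I (mkpt w z.1) 0).
  by apply: smooth_pol0 => // z Uz; exact: pos.
have px z : U z -> tpoly D (mkpt w z.1) by move=> Uz i; exact/ltW/pos.
have Iu z : U z -> imgI I (pol I (mkpt w z.1) 0).
  by move=> Uz i _; rewrite xI_pol; [exact: pos|move=> k; exact/ltW/pos].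
have [cs ss] := smooth_act_par oU sxi su Iu.
split=> //.
- split=> //; first by apply: measurableX; exact: measurable_itv.
  by move=> z [/=]; rewrite in_itv.
- by move=> z Uz; rewrite /sub_moment annulusE // xof_pt ?lsub_mkpt //; exact: px.
- move=> z J Uz Jz; have lz := pos Uz.
  have AE z' : U z' -> chart (J : idx M) (annulus z') = pol J (mkpt w z'.1) (mkpt 0 z'.2).
    move=> Uz'; rewrite annulusE //; apply: chart_pt; first exact: px.
    by move=> i _; rewrite xof_pt; [exact: pos|exact: px].
  have oW : open (U `&` annulus @^-1` domI J).
    rewrite openE => y [Uy Jy]; rewrite /interior; apply: filterI.
      exact: open_nbhs_nbhs.
    by apply: cs => //; apply: open_nbhs_nbhs; split=> //; exact: open_domI.
  have dg : differentiable (chart (J : idx M) \o annulus) z.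
    exact: (smooth_differentiable (ss J)).
  have Ed (b c : R) : 'd (chart (J : idx M) \o annulus) z (b, c) =
      dpol (pol J (mkpt w z.1) (mkpt 0 z.2)) (mkpt (0 : 'rV[R]_d) b *m (nmx J)^T)
        (mkpt (0 : 'rV[R]_d) c *m (dual J)^T).
    apply: (diff_along dg _ (is_diff_pol (mkpt 0 z.2) (mkpt 0 b) (mkpt 0 c) (fun k => lz (fac J k)))).
    have near_U : \forall t \near (0 : R), U (z + t *: (b, c)).
      have ct : continuous (fun t : R => z + t *: ((b, c) : R * R)).
        by move=> t; apply: cvgD; [exact: cvg_cst|apply: cvgZr_tmp; exact: cvg_id].
      have := ct 0; rewrite /continuous_at scale0r addr0 => /(_ U); apply.
      exact: open_nbhs_nbhs.
    apply: filterS near_U => t Ut; apply: etrans (AE _ Ut) _; congr (pol J _ _).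
      by rewrite mkptZ mkptD scaler0 addr0.
    by rewrite mkptZ mkptD scaler0 addr0.
  have := AE z Uz => /= ->.
  have Z : mkpt (0 : 'rV[R]_d) 0 = 0.
    by apply/rowP => i; rewrite -(splitK i); case: (fintype.split i) => k /=; rewrite ?row_mxEl ?row_mxEr !mxE.
  have E1 := Ed 1 0; have E2 := Ed 0 1; rewrite Z !mul0mx in E1 E2.
  apply: etrans _ (esym (congr2 (ev2 _) E1 E2)).
  rewrite omega_dpol; last by apply: regp_pol.
  by rewrite dot_mkpt lsub_mkpt height_mkpt dot0r add0r mulr1.
Qed.

End Interior.

Section Endpoint.
Variables (w : 'rV[R]_d) (y0 : R) (I : charts D) (k0 : 'I_n).
Hypothesis pos : forall i : facets D, i != fac I k0 -> 0 < ell i (mkpt w y0).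
Hypothesis zero : ell (fac I k0) (mkpt w y0) = 0.
Hypothesis dual0 : lsubmx (row k0 (dual I)) = 0.

Let u0 := pol I (mkpt w y0) 0.

Definition disc_coord (z : R * R) : 'rV[R]_(n + n) :=
  u0 + z.1 *: delta_mx 0 (lshift n k0) + z.2 *: delta_mx 0 (rshift n k0).

Definition disc (z : R * R) : M := act 0 (parI I (disc_coord z)).

Lemma tpoly_end : tpoly D (mkpt w y0).
Proof. by move=> i; case: (eqVneq i (fac I k0)) => [->|/pos/ltW //]; rewrite zero. Qed.

Lemma disc_coordE z k : zc (disc_coord z) k = if k == k0 then z.1 +i* z.2 else zc u0 k.
Proof.
have u00 : zc u0 k0 = 0.
  by apply/eqP; rewrite -sqn_eq0 sqn_pol ?zero // => i; exact: tpoly_end.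
rewrite /disc_coord; move: u00; move: u0 => v v0.
rewrite /zc !mxE !eqxx /= !eq_lshift !eq_rshift eq_lrshift eq_rlshift.
case: eqP => [->|_]; last by rewrite !mulr0 !addr0.
by move: v0; rewrite /zc => -[-> ->]; rewrite !mulr1 !mulr0 !addr0 !add0r.
Qed.

Lemma xI_disc z : xI I (disc_coord z) = mkpt w y0 + (z.1 ^+ 2 + z.2 ^+ 2) *: row k0 (dual I).
Proof.
have s0 k : sqn u0 k = ell (fac I k) (mkpt w y0) by rewrite sqn_pol //; exact: tpoly_end.
have sE k : sqn (disc_coord z) k = if k == k0 then z.1 ^+ 2 + z.2 ^+ 2 else sqn u0 k.
  have := disc_coordE z k; rewrite /zc /sqn; case: eqP => _ [-> ->] //.
rewrite -{1}(@xI_pol _ _ _ D I (mkpt w y0) 0); last by move=> k; exact: tpoly_end.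
rewrite -/u0 /xI !mulmx_sum_row (bigD1 k0) //= [in RHS](bigD1 k0) //= !mxE sE eqxx s0 zero.
rewrite [RHS]addrAC -scalerDl sub0r [-1 + _]addrC; congr (_ + _).
by apply: eq_bigr => k kk0; rewrite !mxE sE (negPf kk0).
Qed.

Let U := [set z : R * R | imgI I (disc_coord z)].

Lemma smooth_disc_coord (W : set (R * R)) : open W -> smooth_on W disc_coord.
Proof.
move=> oW; apply: smoothD => //; first apply: smoothD => //; first exact: smooth_cst.
  by apply: smoothZl => //; apply: smooth_fst => //; exact: smooth_id.
by apply: smoothZl => //; apply: smooth_snd => //; exact: smooth_id.
Qed.

(** Near an end of the fibre the reduced space is a disc in the coordinate that vanishes there; by
    [dual0] this coordinate moves the height only. The partition takes just the centre from it, so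
    it adds no area. *)
Lemma disc_piece : slice_piece w U [set (0, 0)] disc (fun=> pi^-1).
Proof.
have oT : open [set: R * R] := openT.
have oU : open U.
  apply: open_comp; last exact: open_imgI.
  by move=> z _; apply: (smooth_continuous (U := setT)) => //; exact: smooth_disc_coord.
have su := smooth_disc_coord oU.
have sxi : smooth_on U (fun _ : R * R => 0 : 'rV[R]_(d + 1)) by exact: smooth_cst.
have [cs ss] := smooth_act_par oU sxi su (fun z (Uz : U z) => Uz).
have Edisc z : disc z = parI I (disc_coord z) by rewrite /disc act0.
split=> //.
- split=> //.
    rewrite (_ : [set (0, 0)] = [set 0] `*` [set 0]); first by apply: measurableX; exact: measurable_set1.
    by apply/seteqP; split=> [z ->|[z1 z2] [/= -> ->]].
  move=> z -> i oi; rewrite xI_disc /= expr0n /= addr0 scale0r addr0; apply: pos.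
  by apply: contraNneq oi => ->; exact: codom_f.
- move=> z Uz; rewrite /sub_moment Edisc xof_par // xI_disc linearD linearZ /= dual0 scaler0 addr0.
  exact: lsub_mkpt.
- move=> z J Uz; rewrite /= => Jz.
  have Lz : loc_dom (M := M) id I J (disc_coord z).
    split; first by rewrite imgME.
    by move: Jz; rewrite Edisc.
  have [_ dt _ _ _] := loc_facts Lz.
  have du : differentiable disc_coord z by exact: (smooth_differentiable su).
  have Eu (b c : R) : 'd disc_coord z (b, c) =
      b *: delta_mx 0 (lshift n k0) + c *: delta_mx 0 (rshift n k0).
    have En t : disc_coord (z + t *: (b, c)) =
        disc_coord z + t *: (b *: delta_mx 0 (lshift n k0) + c *: delta_mx 0 (rshift n k0)).
      rewrite /disc_coord /= !scalerDl scalerDr !scalerA -!addrA; congr (_ + _).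
      by congr (_ + _); rewrite addrCA.
    apply: (diff_along du (@filterE _ (nbhs (0 : R)) _ _ En)).
    have H := is_diffD (is_diff_cst (disc_coord z) (0 : R)) (is_diff_scalel (0 : R) (b *: delta_mx 0 (lshift n k0) + c *: delta_mx 0 (rshift n k0) : 'rV[R]_(n + n))).
    by rewrite add0r in H; exact: H.
  have Ed (v : (R * R)%type) : 'd (chart (J : idx M) \o disc) z v = 'd (loc (M := M) id I J) (disc_coord z) ('d disc_coord z v).
    apply: etrans _ (diff_compE v du dt).
    have FE : chart (J : idx M) \o disc = fun z => loc (M := M) id I J (disc_coord z).
      by apply/funext => z'; rewrite /= Edisc.
    exact: (congr1 (fun f : (R * R)%type -> 'rV[R]_(n + n) => 'd f z v) FE).
  have [[_ _ Hpres] _ _] := tomega_symplectic D.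
  have Cz : chartI J (disc z) = loc (M := M) id I J (disc_coord z) by rewrite Edisc.
  apply: etrans _ (esym (congr2 (ev2 _) (Ed (1, 0)) (Ed (0, 1)))).
  rewrite Cz; apply: etrans _ (Hpres I J _ Lz _ _).
  apply: etrans _ (esym (congr2 (ev2 _) (Eu 1 0) (Eu 0 1))).
  rewrite !scale1r !scale0r addr0 add0r /ev2 /tomega -scalemxAr dotZl.
  rewrite -[LHS]mulr1; congr (_ * _).
  have -> : delta_mx 0 (lshift n k0) *m J0 = delta_mx 0 (rshift n k0) :> 'rV[R]_(n + n).
    rewrite -rowE; apply/rowP => j; rewrite /J0 -(splitK j); case: (fintype.split j) => l /=.
      by rewrite [LHS]mxE block_mxEul !mxE eq_sym eq_rlshift andbF.
    by rewrite [LHS]mxE block_mxEur !mxE !eq_rshift eq_sym.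
  by rewrite /dot trmx_delta mul_delta_mx mxE !eqxx.
- by move=> z _; rewrite invr_gt0 pi_gt0.
Qed.

Lemma disc0 : disc (0, 0) = pt D (mkpt w y0) 0.
Proof.
rewrite /disc act0 /disc_coord !scale0r !addr0.
by apply: par_pol; exact: tpoly_end.
Qed.

(** The circle of the facet normal acts trivially over the facet. Since the normal has nonzero
    height it can absorb the extra angle, so the points over the end form a single orbit of the
    subtorus. *)
Lemma disc_cover th : height (normal (fac I k0)) != 0 ->
  exists xi, a xi (disc (0, 0)) = pt D (mkpt w y0) th.
Proof.
move=> h0; have px := tpoly_end; pose c := - height th / height (normal (fac I k0)).
pose th' := th + c *: normal (fac I k0).
exists (lsubmx th'); rewrite disc0 /sub_act act_pt // add0r -(pt_shift th c px zero).
congr (pt D _ _); rewrite -/th' -[RHS]mkptK /mkpt; congr row_mx.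
have -> : height th' = 0.
  by rewrite /th' /height [LHS]mxE [X in _ + X]mxE /c divfK // subrr.
by apply/rowP => i; rewrite !mxE.
Qed.

End Endpoint.

Lemma mkpt_row w : row_mx w 0 = mkpt w 0 :> 'rV[R]_(d + 1).
Proof. by rewrite /mkpt; congr row_mx; apply/rowP => i; rewrite !mxE. Qed.

(* The fibre over w ends at height y in the relative interior of the facet
   [fac I k]. *)
Definition end_facet w y (I : charts D) (k : 'I_n) : Prop :=
  [/\ forall i : facets D, i != fac I k -> 0 < ell i (mkpt w y),
      ell (fac I k) (mkpt w y) = 0, lsubmx (row k (dual I)) = 0
    & height (normal (fac I k)) != 0].

(** The reduced sphere is cut into an open annulus and two points. The height of the full moment map
    is constant on orbits and tells the pieces apart; in the annulus the angle in [0, 1) is unique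
    because the full torus acts freely there. *)
Lemma reduced_length w tm tp : tm < tp ->
  (forall y, tpoly D (mkpt w y) -> tm <= y <= tp) ->
  (forall y, tm < y < tp -> forall i : facets D, 0 < ell i (mkpt w y)) ->
  (exists I k, end_facet w tp I k) -> (exists I k, end_facet w tm I k) ->
  reduced_integral omega a Phi w (tp - tm)%:E.
Proof.
move=> tmp hY hpos [I1 [k1 [p1 z1 d1 h1]]] [I2 [k2 [p2 z2 d2 h2]]].
pose U0 := [set z : (R * R)%type | tm < z.1 < tp].
pose A0 : set (R * R) := `]tm, tp[%classic `*` `[0, 1[%classic.
pose s0 := annulus w I1.
pose s1 := disc w tp I1 k1; pose s2 := disc w tm I2 k2.
pose U (m : nat) : set (R * R) := match m with 0 => U0
  | 1 => [set z | imgI I1 (disc_coord w tp I1 k1 z)]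
  | 2 => [set z | imgI I2 (disc_coord w tm I2 k2 z)] | _ => set0 end.
pose A (m : nat) : set (R * R) := match m with 0 => A0
  | 1 => [set (0, 0)] | 2 => [set (0, 0)] | _ => set0 end.
pose s (m : nat) : R * R -> M := match m with 0 => s0 | 1 => s1 | 2 => s2 | _ => s0 end.
pose h (m : nat) : R * R -> R := match m with 0 => fun=> 1 | _ => fun=> pi^-1 end.
have piece m : slice_piece w (U m) (A m) (s m) (h m).
  case: m => [|[|[|m]]]; first exact: annulus_piece.
  - exact: disc_piece.
  - exact: disc_piece.
  - exact: slice_piece0.
have xofa xi p : xof (a xi p) = xof p.
  by have [_ _ _ [_ H _]] := toric_hamiltonian D; exact: H.
pose y (m : nat) (z : R * R) : R := match m with 0 => z.1 | 1 => tp | _ => tm end.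
have px1 := tpoly_end p1 z1; have px2 := tpoly_end p2 z2.
have px0 t : tm < t < tp -> tpoly D (mkpt w t) by move=> Ht i; exact/ltW/hpos.
have yE m z : A m z -> height (xof (s m z)) = y m z.
  case: m => [|[|[|m]]] //=.
  - case; rewrite /= in_itv /= => Ht _.
    by rewrite /s0 (annulusE I1 hpos) // xof_pt ?height_mkpt //; exact: px0.
  - by move=> ->; rewrite /s1 disc0 // xof_pt ?height_mkpt.
  - by move=> ->; rewrite /s2 disc0 // xof_pt ?height_mkpt.
exists U, A, s, h; split.
- by move=> m; have [[]] := piece m.
- by move=> m; have [] := piece m.
- move=> m m' z z' xi Az Az' E.
  have Ey : y m z = y m' z' by rewrite -yE // -yE // -E xofa.
  case: m m' Az Az' E Ey => [|[|[|m]]] [|[|[|m']]] //=.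
  + case: z z' => [t r] [t' r'] [/=]; rewrite !in_itv /= => Ht Hr [/= Ht']; rewrite in_itv /= in Ht'.
    rewrite in_itv /= => Hr' E tt'; rewrite -tt' in Ht' E *.
    split=> //; congr (_, _); move: E; rewrite /s0 !(annulusE I1 hpos) // /sub_act act_pt; last exact: px0.
    move/(pt_eqP (hpos _ Ht)) => /(_ (rshift d ord0)).
    rewrite /= !mxE; have -> : fintype.split (rshift d ord0) = inr ord0 :> 'I_d + 'I_1.
      by apply: (can_inj (@unsplitK _ _)); rewrite splitK.
    rewrite !mxE addr0 => /intrP[q qE].
    have : (q == 0).
      move: Hr Hr' => /andP[r0 r1] /andP[r'0 r'1].
      have q1 : q < 1 by rewrite -(ltr_int R) -qE; lra.
      have q2 : -1 < q by rewrite -(ltr_int R) -qE (_ : (-1)%:~R = -1 :> R) //; lra.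
      by move: q1 q2; case: (q) => [[|c]|c].
    by move/eqP=> q0; move: qE; rewrite q0 => /eqP; rewrite subr_eq0 => /eqP.
  + by case=> /=; rewrite in_itv /= => /andP[_ lt] _ _ _ E; rewrite E ltxx in lt.
  + by case=> /=; rewrite in_itv /= => /andP[lt _] _ _ _ E; rewrite E ltxx in lt.
  + by move=> _ [/=]; rewrite in_itv /= => /andP[_ lt] _ _ E; rewrite E ltxx in lt.
  + by move=> -> ->.
  + by move=> _ _ _ E; rewrite E ltxx in tmp.
  + by move=> _ [/=]; rewrite in_itv /= => /andP[lt _] _ _ E; rewrite E ltxx in lt.
  + by move=> _ _ _ E; rewrite E ltxx in tmp.
  + by move=> -> ->.
- move=> p pw; have [x [th [px pE]]] := ptP p.
  have xE : x = mkpt w (height x) by rewrite -pw /sub_moment pE xof_pt // mkptK.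
  have /hY/andP[] : tpoly D (mkpt w (height x)) by rewrite -xE.
  rewrite le_eqVlt => /orP[/eqP Em _|lm].
    have [xi xiE] := disc_cover p2 z2 th h2.
    by exists 2%N, (0, 0), xi; split=> //; rewrite /= xiE pE xE -Em.
  rewrite le_eqVlt => /orP[/eqP Ep|lp].
    have [xi xiE] := disc_cover p1 z1 th h1.
    by exists 1%N, (0, 0), xi; split=> //; rewrite /= xiE pE xE Ep.
  have Ht : tm < height x < tp by rewrite lm lp.
  pose f : R := height th - (Num.floor (height th))%:~R.
  exists 0%N, (height x, f), (lsubmx th); split.
    split; rewrite /= in_itv //= /f subr_ge0 ge_floor /= ltrBlDl.
    by have := lt_succ_floor (height th); rewrite intrD addrC.
  rewrite /= /s0 (annulusE I1 hpos) // /sub_act act_pt; last exact: px0.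
  rewrite -xE pE /= mkpt_row mkptD add0r addr0.
  have iF : Defs.integral (mkpt (0 : 'rV[R]_d) (- (Num.floor (height th))%:~R)).
    apply: integral_mkpt; first by move=> i; rewrite mxE rpred0.
    by rewrite rpredN intr_int.
  transitivity (pt D x (th + mkpt 0 (- (Num.floor (height th))%:~R))); last exact: pt_lattice.
  by have := mkptD (lsubmx th) 0 (height th) (- (Num.floor (height th))%:~R);
    rewrite mkptK addr0 => ->.
- have I0 m : (0 < m)%N -> (\int[lebesgue_measure \x lebesgue_measure]_(z in A m) (h m z)%:E)%E = 0%E :> \bar R.
    have I1' : (\int[lebesgue_measure \x lebesgue_measure]_(z in [set (0%R, 0%R) : R * R]) (pi^-1)%:E)%E = 0%E :> \bar R.
      have -> : [set (0, 0) : R * R] = [set 0] `*` [set 0].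
        by apply/seteqP; split=> [z ->|[y1 y2] [/= -> ->]].
      rewrite integral_rectangle; [|exact: measurable_set1|exact: measurable_set1].
      by rewrite lebesgue_measure_set1 !mule0.
    case: m => [|[|[|m]]] // _; last by rewrite integral_set0.
  rewrite nneseries_recl // => [|m _]; last first.
    apply: integral_ge0 => z _; rewrite lee_fin; case: m => [|m] /=; first exact: ler01.
    by rewrite invr_ge0 pi_ge0.
  rewrite [X in (_ + X)%E]eseries0 ?adde0; last by move=> m m1 _; exact: I0.
  rewrite /= integral_rectangle; [|exact: measurable_itv|exact: measurable_itv].
  rewrite mul1e !lebesgue_measure_itv /= !lte_fin tmp ltr01 -!EFinB -EFinM.
  by rewrite subr0 mulr1.
Qed.

End ReducedSpace.

(** * The Duistermaat-Heckman function *)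

Section Regular.
Context {R : realType} {n d : nat} (D : toric_data R n (d + 1)).
Local Notation M := (tmanifold D).
Local Notation Phi := (sub_moment (D := D)).

Lemma diff_sub_moment (I : charts D) u v : imgI I u ->
  'd (Phi \o par (I : idx M)) u v = lsubmx (2 *: (v *m (Rm u)^T) *m dual I).
Proof.
move=> Iu; have [_ _ _ [Hsm _ _]] := toric_hamiltonian D.
have df : differentiable (xof (D := D) \o par (I : idx M)) u.
  by apply: (smooth_differentiable (Hsm I)); rewrite imgME.
apply: etrans (diff_lsubmx v df) _; congr lsubmx.
exact: diff_xof_par.
Qed.

(* Facets through a point of the fibre confine the image of the differential
   of the moment map. *)
Lemma regular_annihilator w x (I : charts D) (c : 'I_n -> R) g :
  regular_value Phi w -> tpoly D x -> lsubmx x = w -> domI I (pt D x 0) ->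
  (forall k, c k != 0 -> ell (fac I k) x = 0) ->
  mkpt g 0 = \sum_k c k *: normal (fac I k) -> g = 0.
Proof.
move=> reg px xw Ix czero gE.
pose u := chartI I (pt D x 0).
have Iu : imgI I u by rewrite -imgE; exists (pt D x 0).
have Pu : Phi (par (I : idx M) u) = w.
  by rewrite /u /= par_chart // /sub_moment xof_pt.
have Iu' : img (M := M) I u by rewrite imgME.
have [v vE] := reg I u Iu' Pu g; rewrite diff_sub_moment // in vE.
have sq k : sqn u k = ell (fac I k) x by rewrite -(ell_xI I) xI_chart // xof_pt.
apply/eqP; apply: contraT => /dot_self_gt0.
have -> : (g *m g^T) 0 0 = 0; last by rewrite ltxx.
have dl y : dot (lsubmx y) g = dot y (mkpt g 0) by rewrite dot_mkpt mulr0 addr0.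
rewrite -/(dot g g) -{1}vE dl gE dotC dot_suml big1 // => k _; rewrite dotZl dotC mulmx_sum_row dot_suml.
have [->|ck] := eqVneq (c k) 0; first by rewrite mul0r.
rewrite (bigD1 k) //= big1 ?addr0 => [|l lk]; last first.
  by rewrite dotZl dual_fac (negPf lk) mulr0.
have u0 : zc u k = 0 by apply/eqP; rewrite -sqn_eq0 sq czero.
have -> : (2 *: (v *m (Rm u)^T)) 0 k = 0.
  by move: u0; rewrite mxE mul_RmT /zc => -[-> ->]; rewrite !mul0r addr0 mulr0.
by rewrite scale0r dot0l mulr0.
Qed.

End Regular.

Section ThickDH.
Context {R : realType} {d r : nat} (mu : 'I_r -> 'rV[R]_d) (nu : 'rV[R]_d).
Variable sel : bool -> bool -> bool.
Implicit Types (w : 'rV[R]_d) (x : 'rV[R]_(d + 1)) (tb b : bool).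
Hypothesis imu : forall j, Defs.integral (mu j).
Hypothesis inu : Defs.integral nu.
Hypothesis nu0 : nu != 0.
Hypothesis bounded : exists B : R, forall w, polyh mu w -> forall c, `|w 0 c| <= B.
Hypothesis corners : forall v, corner mu v ->
  exists (f : 'I_d -> 'I_r) (alpha : 'I_d -> 'rV[R]_d),
  [/\ forall j, active mu v j <-> exists i, f i = j,
     forall i, Defs.integral (alpha i) & forall i j, dot (mu (f i)) (alpha j) = (i == j)%:R].
Hypothesis sel_ne : forall tb, exists b, sel tb b.
Hypothesis gap : forall w b b', polyh mu w -> sel true b -> sel false b' ->
  1 <= 2 + dot w (mub nu b) - dot w (mub nu b').
Hypothesis slice : forall w tb, polyh mu w -> sel tb true -> sel tb false -> dot w nu = 0 ->
  exists v, [/\ corner mu v, forall j, active mu w j -> active mu v j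
    & exists2 j, active mu v j & nu = mu j].

Local Notation D := (thick_data imu inu bounded corners sel_ne gap slice).
Local Notation M := (tmanifold D).
Local Notation Phi := (sub_moment (D := D)).
Local Notation mb := (mub nu).

(** The lid that bounds the fibre over w: the lowest one on top or the highest one at the bottom. *)
Definition extremal w tb b := sel tb b /\
  forall b', sel tb b' -> 0 <= sgb tb * (dot w (mb b') - dot w (mb b)).

Lemma extremal_exists w tb : exists b, extremal w tb b.
Proof.
have [b sb] := sel_ne tb.
case: (boolP (sel tb (~~ b))) => sb'; last first.
  exists b; split=> // b' s'; have -> : b' = b.
    by apply/eqP; apply: contraNT sb' => bb; have -> : ~~ b = b' by move: bb; case: (b); case: (b').
  by rewrite subrr mulr0.
case: (leP 0 (sgb tb * (dot w (mb (~~ b)) - dot w (mb b)))) => h.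
  exists b; split=> // b' _; case: (eqVneq b' b) => [->|bb]; first by rewrite subrr mulr0.
  by have -> : b' = ~~ b by move: bb; case: (b); case: (b').
exists (~~ b); split=> // b' _; case: (eqVneq b' (~~ b)) => [->|bb]; first by rewrite subrr mulr0.
have -> : b' = b by move: bb; case: (b); case: (b').
by rewrite -opprB mulrN oppr_ge0 ltW.
Qed.

Definition yend w tb b : R := sgb tb + dot w (mb b).

Lemma tlen_mkpt w y tb b : tlen nu tb b (mkpt w y) = sgb tb * (dot w (mb b) - y).
Proof. by rewrite /tlen lsub_mkpt height_mkpt. Qed.

Lemma thick_tpoly x : tpoly D x <-> polyh mu (lsubmx x) /\
  forall tb b, sel tb b -> 0 <= 1 + tlen nu tb b x.
Proof. exact: inthickP. Qed.

Lemma ell_wall j x : ell (D := D) (inl j) x = 1 + dot (lsubmx x) (mu j).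
Proof. by rewrite -(dot_inl mu nu sel). Qed.

Lemma ell_lid tb b x : sel tb b -> ell (D := D) (inr (tb, b)) x = 1 + tlen nu tb b x.
Proof. by move=> s; rewrite -(dot_tnormal mu nu x s). Qed.

Lemma ell_unselected tb b x : ~~ sel tb b -> ell (D := D) (inr (tb, b)) x = 1.
Proof. by move=> s; rewrite -[RHS]addr0 -(dot_tnormalN mu nu x s). Qed.

Section Fibre.
Variables (w : 'rV[R]_d) (bt bb : bool).
Hypothesis Pw : polyh mu w.
Hypotheses (et : extremal w true bt) (eb : extremal w false bb).

Let tp := yend w true bt.
Let tm := yend w false bb.

Lemma fibre_length : 1 <= tp - tm.
Proof.
have := gap Pw et.1 eb.1; rewrite /tp /tm /yend /sgb.
by move: (dot _ _) (dot _ _) => t t'; lra.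
Qed.

Lemma fibreP y : tpoly D (mkpt w y) <-> tm <= y <= tp.
Proof.
rewrite thick_tpoly lsub_mkpt; split=> [[_ H]|/andP[h1 h2]].
  have := H _ _ et.1; have := H _ _ eb.1; rewrite !tlen_mkpt /tp /tm /yend /sgb.
  by move: (dot _ _) (dot _ _) => t t' h1 h2; apply/andP; split; lra.
split=> // -[] b sb; rewrite tlen_mkpt.
  have := et.2 _ sb; move: h2; rewrite /tp /yend /sgb.
  by move: (dot _ _) (dot _ _) => t t'; lra.
have := eb.2 _ sb; move: h1; rewrite /tm /yend /sgb.
by move: (dot _ _) (dot _ _) => t t'; lra.
Qed.

Hypothesis reg : regular_value Phi w.

Lemma fibre_chart y : tm <= y <= tp -> exists2 I : charts D, domI I (pt D (mkpt w y) 0) &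
  forall i, ell (D := D) i (mkpt w y) = 0 -> exists k, fac I k = i.
Proof.
move=> /fibreP px; have [I HI] := charts_cover px; exists I => // i oi.
rewrite xof_pt // lt0r px andbT; apply/eqP => /HI[k kE].
by move: oi; rewrite /outI -kE codom_f.
Qed.

Lemma tmtp : tm < tp.
Proof. by have := fibre_length; lra. Qed.

(** Otherwise the normal of the wall would annihilate the image of the differential of the moment
    map, here at the top end of the fibre. *)
Lemma regular_inactive j : ~~ active mu w j.
Proof.
apply/negP => wj; have Hy : tm <= tp <= tp by rewrite lexx (ltW tmtp).
have [I Ix HI] := fibre_chart Hy; have px := (fibreP _).2 Hy.
have lz : ell (D := D) (inl j) (mkpt w tp) = 0.
  by apply/eqP; rewrite ell_wall lsub_mkpt slack_eq0.
have [k kE] := HI _ lz.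
have m0 : mu j = 0.
  apply: (@regular_annihilator _ _ _ D w (mkpt w tp) I (fun l => (l == k)%:R)) => //.
  - by rewrite lsub_mkpt.
  - by move=> l; case: (eqVneq l k) => [->|_]; rewrite ?kE // eqxx.
  - rewrite (bigD1 k) // big1 => [|l /negPf ->]; last by rewrite scale0r.
    by rewrite eqxx scale1r kE [RHS]addr0.
by move: wj; rewrite /active m0 dot0r eq_sym oppr_eq0 oner_eq0.
Qed.

(** The normals of two lids that tie over w differ by (nu, 0) up to sign, so at their common point
    nu would annihilate the image of the differential. *)
Lemma regular_single tb b : extremal w tb b -> forall b', sel tb b' ->
  sgb tb * (dot w (mb b') - dot w (mb b)) = 0 -> b' = b.
Proof.
move=> [sb _] b' sb' E; apply/eqP; apply: contraT => bb'.
have [st sf] : sel tb true /\ sel tb false by move: bb' sb sb'; case: (b); case: (b').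
have wnu : dot w nu = 0.
  move: E bb'; rewrite /sgb; case: (b); case: (b') => //=; rewrite !dot0r;
    by case: ifP => _ + _; lra.
pose y : R := sgb tb.
have ext b1 : extremal w tb b1.
  split=> [|b2 _]; first by case: b1.
  by case: b1; case: b2; rewrite /= ?dot0r ?wnu subrr mulr0.
have Hy : tm <= y <= tp.
  have := tmtp; rewrite /y; have := et; have := eb.
  have mbz b1 : dot w (mb b1) = 0 by case: b1; rewrite /= ?dot0r.
  by rewrite /tm /tp /yend !mbz /sgb; case: (tb) => _ _ h; apply/andP; split; lra.
have [I Ix HI] := fibre_chart Hy; have px := (fibreP _).2 Hy.
have lz b1 : ell (D := D) (inr (tb, b1)) (mkpt w y) = 0.
  have s1 : sel tb b1 by case: b1.
  rewrite ell_lid // tlen_mkpt.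
  have -> : dot w (mb b1) = 0 by case: b1 {s1}; rewrite /= ?dot0r.
  by rewrite sub0r mulrN /y sgsgb subrr.
have [k1 k1E] := HI _ (lz true); have [k2 k2E] := HI _ (lz false).
have k12 : k1 != k2 by apply/eqP => kk; move: k2E; rewrite -kk k1E => -[].
case/eqP: nu0.
apply: (@regular_annihilator _ _ _ D w (mkpt w y) I
  (fun l => sgb tb * ((l == k1)%:R - (l == k2)%:R))) => //.
- by rewrite lsub_mkpt.
- move=> l; case: (eqVneq l k1) => [->|_]; first by rewrite k1E lz.
  by case: (eqVneq l k2) => [->|_]; rewrite ?k2E ?lz // subrr mulr0 eqxx.
- rewrite (bigD1 k1) // (bigD1 k2) 1?eq_sym // big1 => [|l /andP[/negPf -> /negPf ->]]; last first.
    by rewrite subrr mulr0 scale0r.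
  rewrite [RHS]addrA [RHS]addr0.
  rewrite !eqxx [k2 == k1]eq_sym !(negPf k12) subr0 sub0r mulr1 mulrN1 k1E k2E /= st sf.
  rewrite scaleNr !scalerA sgsgb !scale1r -scaleN1r mkptZ mkptD.
  by rewrite scaler0 addr0 mulrN1 opprK addrC subrr.
Qed.

(** Over a regular value the lid is the only facet active at its end, so any vertex of the base,
    however far from w, yields a suitable chart. *)
Lemma regular_end tb b : extremal w tb b ->
  exists (I : charts D) k, end_facet w (yend w tb b) I k.
Proof.
move=> ext; have [sb eb'] := ext.
have [v [cv _ _]] := climb bounded 0 Pw.
have [f [alpha [af ia dfa]]] := corners cv.
have [I IE] := mk_tchart (unimod_vfac inu sb ia dfa).
have I0 : fac (t := D) I ord0 = inr (tb, b) by rewrite [LHS]IE /vfac unlift_none.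
exists I, ord0; rewrite /end_facet I0; split.
- move=> [j|[tb' b']] ne.
    rewrite ell_wall lsub_mkpt lt0r slack_ge0 // andbT slack_eq0.
    exact: regular_inactive.
  case: (boolP (sel tb' b')) => s'; last by rewrite ell_unselected.
  rewrite ell_lid // tlen_mkpt /yend.
  case: (eqVneq tb' tb) => [tE|tne].
    rewrite tE in s' ne *; have -> : 1 + sgb tb * (dot w (mb b') - (sgb tb + dot w (mb b))) =
        sgb tb * (dot w (mb b') - dot w (mb b)).
      by rewrite opprD addrCA mulrDr mulrN sgsgb addrA subrr add0r.
    rewrite lt0r eb' // andbT; apply: contraNneq ne => /(regular_single ext s') ->.
    by rewrite eqxx.
  have g : 1 <= 2 + sgb tb * (dot w (mb b) - dot w (mb b')).
    move: s' sb tne; case: (tb) => s' sb; case: tb' {ne} s' sb => // s' sb _.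
    - by have := gap Pw sb s'; rewrite /sgb; lra.
    - by have := gap Pw s' sb; rewrite /sgb; lra.
  have sE : sgb tb' = - sgb tb :> R.
    by have {tne} : tb' <> tb := (elimN eqP tne); rewrite /sgb; case: (tb); case: (tb') => // _; rewrite opprK.
  have := sgsgb tb (R := R); rewrite sE; move: (sgb tb) (dot w (mb b)) (dot w (mb b')) g => q t t' g qq.
  have -> : 1 + - q * (t' - (q + t)) = 1 + q * q + q * (t - t') by ring.
  by rewrite qq; lra.
- rewrite ell_lid // tlen_mkpt /yend.
  by rewrite opprD addrCA subrr addr0 mulrN sgsgb subrr.
(* The dual vector of the lid pairs to 0 with all walls of the chart, whose normals are a basis of
   the base; so it is vertical. *)
- rewrite (@dual_basis_expand _ _ alpha (mu \o f) (lsubmx (row ord0 (dual (t := D) I)))) => [|i j]; last first.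
    by rewrite dotC /= dfa eq_sym.
  rewrite big1 // => i _; have If : fac (t := D) I (lift ord0 i) = inl (f i).
    by rewrite [LHS]IE /vfac liftK.
  have := dual_fac (D := D) I ord0 (lift ord0 i); rewrite If eq_lift0 [normal _]/(tnormal mu nu sel _) (dot_inl mu nu sel).
  by move=> /= ->; rewrite scale0r.
- have -> : normal (t := D) (inr (tb, b)) = sgb tb *: mkpt (mb b) (-1) by rewrite /= sb.
  rewrite mkptZ height_mkpt mulrN1 oppr_eq0.
  by rewrite /sgb; case: ifP; rewrite ?oppr_eq0 oner_eq0.
Qed.

Lemma regular_DH : reduced_integral (M := M) (@tomega R d.+1 (d + 1) D) (sub_act (D := D)) Phi w
  (tp - tm)%:E.
Proof.
apply: reduced_length; first exact: tmtp.
- by move=> y /fibreP.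
- move=> y Hy i; have Hy' : tm <= y <= tp by move/andP: Hy => [/ltW -> /ltW ->].
  have px := (fibreP y).2 Hy'; rewrite lt0r px andbT.
  case: i => [j|[tb b]].
    by rewrite ell_wall lsub_mkpt slack_eq0 regular_inactive.
  case: (boolP (sel tb b)) => s'; last by rewrite ell_unselected // oner_eq0.
  rewrite ell_lid // tlen_mkpt; move/andP: Hy => [h1 h2]; rewrite gt_eqF //.
  move: s'; case: tb => s'.
    have := et.2 _ s'; move: h2; rewrite /tp /yend /sgb.
    by move: (dot _ _) (dot _ _) => t t'; lra.
  have := eb.2 _ s'; move: h1; rewrite /tm /yend /sgb.
  by move: (dot _ _) (dot _ _) => t t'; lra.
- exact: regular_end.
- exact: regular_end.
Qed.

End Fibre.

Lemma thick_range : range Phi = polyh mu.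
Proof.
rewrite range_sub_moment; apply/seteqP; split=> [w [x /thick_tpoly[Px _] <-] //|w Pw].
have [bt et] := extremal_exists w true; have [bb eb] := extremal_exists w false.
exists (mkpt w (yend w true bt)); last exact: lsub_mkpt.
apply/(fibreP Pw et eb); rewrite lexx andbT; have := fibre_length Pw et eb; lra.
Qed.

Lemma thick_tall : tall (M := M) (sub_act (D := D)) Phi.
Proof.
apply: sub_tall => x /[dup] px /thick_tpoly[Pw _].
have [bt et] := extremal_exists (lsubmx x) true; have [bb eb] := extremal_exists (lsubmx x) false.
have L := fibre_length Pw et eb.
have P y : yend (lsubmx x) false bb <= y <= yend (lsubmx x) true bt -> tpoly D (mkpt (lsubmx x) y).
  by move=> Hy; apply/(fibreP Pw et eb).
case: (eqVneq (height x) (yend (lsubmx x) true bt)) => hx.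
  exists (mkpt (lsubmx x) (yend (lsubmx x) false bb)); split.
  - by apply: P; rewrite lexx /=; lra.
  - exact: lsub_mkpt.
  - apply/eqP => /(congr1 (@height R d)); rewrite height_mkpt hx; lra.
exists (mkpt (lsubmx x) (yend (lsubmx x) true bt)); split.
- by apply: P; rewrite lexx andbT; lra.
- exact: lsub_mkpt.
- by apply/eqP => /(congr1 (@height R d)); rewrite height_mkpt => E; rewrite E eqxx in hx.
Qed.

Lemma thick_DH (f : 'rV[R]_d -> R) : continuous f ->
  (forall w bt bb, polyh mu w -> extremal w true bt -> extremal w false bb ->
     f w = 2 + dot w (mb bt) - dot w (mb bb)) ->
  is_DH_function (M := M) (@tomega R d.+1 (d + 1) D) (sub_act (D := D)) Phi f.
Proof.
move=> cf fE; split; first exact: continuous_subspaceT.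
rewrite thick_range => w Pw reg.
have [bt et] := extremal_exists w true; have [bb eb] := extremal_exists w false.
have := regular_DH Pw et eb reg; rewrite (fE w bt bb) //.
by congr reduced_integral; congr (_%:E); rewrite /yend /sgb; ring.
Qed.

Lemma thick_space (f : 'rV[R]_d -> R) : continuous f ->
  (forall w bt bb, polyh mu w -> extremal w true bt -> extremal w false bb ->
     f w = 2 + dot w (mb bt) - dot w (mb bb)) ->
  exists (M : manifold R (d.+1 + d.+1)) (omega : twoform M)
    (a : 'rV[R]_d -> M -> M) (Phi : M -> 'rV[R]_d),
  [/\ compact_hamiltonian_space omega a Phi,
      normalized_monotone omega a Phi,
      tall a Phi,
      range Phi = polyh mu /\ is_DH_function omega a Phi f
    & exists (b : 'rV[R]_(d + 1) -> M -> M) (Psi : M -> 'rV[R]_(d + 1)),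
        hamiltonian_action omega b Psi /\
        forall xi p, b (row_mx xi (0 : 'rV[R]_1)) p = a xi p].
Proof.
move=> cf fE; exists M, (@tomega R d.+1 (d + 1) D), (sub_act (D := D)), Phi; split.
- exact: sub_compact_space.
- exact: sub_normalized.
- exact: thick_tall.
- by split; [exact: thick_range|exact: thick_DH].
- by exists (@act R d.+1 (d + 1) D), (@xof R d.+1 (d + 1) D); split=> //; exact: toric_hamiltonian.
Qed.

End ThickDH.

(** * The lids of an admissible quadruple *)

Lemma polytope_bounded (R : realType) d (P : set 'rV[R]_d) : polytope P ->
  exists B : R, forall w, P w -> forall c, `|w 0 c| <= B.
Proof.
move=> [[r [p ->]] _]; exists (\sum_i \sum_c `|p i 0 c|) => w [c [c0 c1 ->]] j.
rewrite summxE; apply: le_trans (ler_norm_sum _ _ _) _; apply: ler_sum => i _.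
rewrite mxE normrM (ger0_norm (c0 i)).
have ci : c i <= 1 by rewrite -c1 (bigD1 i) //= lerDl; apply: sumr_ge0.
apply: le_trans (ler_piMl (normr_ge0 _) ci) _.
by rewrite (bigD1 j) //= lerDl; apply: sumr_ge0.
Qed.

Lemma continuous_abstract_DH (R : realType) d (nu : 'rV[R]_d) s k :
  continuous (abstract_DH nu s k).
Proof.
have oT : open [set: 'rV[R]_d] := openT.
have cd : continuous (fun w : 'rV[R]_d => dot w nu).
  move=> w; apply: (smooth_continuous (U := setT)) => //.
  by apply: smooth_dot => //; [exact: smooth_id|exact: smooth_cst].
(* [rho] is the positive part (t + |t|) / 2 of t = <w, nu>. *)
rewrite (_ : abstract_DH nu s k =
    fun w => 2 - s%:~R * dot w nu - k%:~R * (2^-1 * (dot w nu + `|dot w nu|))).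
  move=> w; apply: (@cvgB _ _ _ (nbhs w)); first apply: (@cvgB _ _ _ (nbhs w)).
  - exact: cvg_cst.
  - by apply: cvgMl_tmp; exact: cd.
  - apply: cvgMl_tmp; apply: cvgMl_tmp; apply: (@cvgD _ _ _ (nbhs w)); first exact: cd.
    by apply: cvg_norm; exact: cd.
apply/funext => w; rewrite /abstract_DH /rho; congr (_ - _ * _); case: leP => h.
  by rewrite ler0_norm // subrr mulr0.
by rewrite gtr0_norm //; lra.
Qed.

(** With t = <w, nu> the length has to be 2, 2 + t, 2 + min(t, 0) or 2 - |t|. Slope nu on top adds
    t, slope 0 beside it caps the top at 1, and for k = 2 slope nu at the bottom raises it to t - 1
    where t > 0. *)
Definition lids (s k : int) (tb b : bool) : bool :=
  match tb, b with
  | true, true => s == -1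
  | true, false => (k != 0) || (s == 0)
  | false, true => k == 2
  | false, false => true
  end.

Lemma abstract_DH_lids (R : realType) d (nu w : 'rV[R]_d) (s k : int) bt bb :
  (s, k) \in [:: (0, 0); (-1, 0); (-1, 1); (-1, 2)] ->
  extremal nu (lids s k) w true bt -> extremal nu (lids s k) w false bb ->
  abstract_DH nu s k w = 2 + dot w (mub nu bt) - dot w (mub nu bb).
Proof.
move=> sk [st Ht] [sb Hb]; move: st sb.
have {Ht} /implyP := Ht (~~ bt); have {Hb} /implyP := Hb (~~ bb).
have z0 : (0 : int)%:~R = 0 :> R by [].
have z1 : (1 : int)%:~R = 1 :> R by [].
have z2 : (2 : int)%:~R = 2 :> R by [].
rewrite /abstract_DH /rho /sgb.
by move: sk; rewrite !inE => /or4P[] /eqP[-> ->]; case: bt; case: bb => //=;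
  rewrite ?dot0r ?mulrN1z ?z0 ?z1 ?z2 => h1 h2 _ _; case: leP => h; lra.
Qed.

Local Close Scope complex_scope.

Theorem corollary5p15 (R : realType) (d : nat) (Delta F : set 'rV[R]_d)
    (nu : 'rV[R]_d) (s k : int) (hadm : admissible Delta F nu s k) :
  exists (M : manifold R (d.+1 + d.+1)) (omega : twoform M)
    (a : 'rV[R]_d -> M -> M) (Phi : M -> 'rV[R]_d),
  [/\ compact_hamiltonian_space omega a Phi,
      normalized_monotone omega a Phi,
      tall a Phi,
      range Phi = Delta /\ is_DH_function omega a Phi (abstract_DH nu s k)
    & exists (b : 'rV[R]_(d + 1) -> M -> M) (Psi : M -> 'rV[R]_(d + 1)),
        hamiltonian_action omega b Psi /\
        forall xi p, b (row_mx xi (0 : 'rV[R]_1)) p = a xi p].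
Proof.
case: hadm => -[pol [[vint [r [mu [prim DE irr]]]] delz]] [fF [pnu [nuge FE]]] sk iv v2.
have {}DE : Delta = polyh mu by [].
rewrite DE in pol vint irr delz fF nuge FE iv v2 *.
have bounded := polytope_bounded pol.
have [j0 nuj] := facet_normal bounded prim irr delz fF pnu (conj nuge FE).
have inu : Defs.integral nu by case: pnu.
have nu0 : nu != 0.
  apply/eqP => E; have [_ /(_ 2%N 0)] := pnu.
  by move=> H; suff: 2%N = 1%N by []; apply: H; [move=> i; rewrite mxE rpred0|rewrite E scaler0].
apply: (@thick_space R d r mu nu (lids s k)) => //.
- by move=> j; case: (prim j).
- by move=> v; exact: delzant_corner.
- case; last by exists false.
  by move: sk; rewrite !inE => /or4P[] /eqP[-> ->]; by [exists false|exists true].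
- move=> w b b' Pw; have := nuge w Pw.
  (* Only for k = 2 can the length be 2 - <w, nu>, and then the facet opposite to F bounds it below
     by 1. *)
  have : k = 2 -> dot w nu <= 1.
    by move=> /v2[F' _ [/(_ w Pw)]]; rewrite dotNr => h _; lra.
  move: sk; rewrite !inE => /or4P[] /eqP[-> ->]; case: b; case: b' => //= h1 h2 _ _;
    rewrite ?dot0r; try lra.
  by have := h1 erefl; lra.
(* Two slopes on one side force k != 0. Descending along nu inside the face of w ends at a vertex v
   with -1 <= <v, nu> <= 0; this is an integer and by (iv) it is not 0, so v lies on F. *)
- move=> w tb Pw st sf wnu; have k0 : k <> 0.
    by move: st sf; case: tb => /= /eqP -> // /orP[/eqP|].
  have [v [cv av vnu]] := climb bounded nu Pw; exists v; split=> //; exists j0 => //.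
  have vv := corner_vertex cv.
  have /intrP[z zE] := dot_int (vint _ vv) inu.
  have := nuge v cv.1; move: vnu; rewrite wnu /active -nuj zE.
  rewrite (_ : -1 = (-1)%:~R :> R) // (_ : 0 = 0%:~R :> R) // !ler_int eqr_int => z0 z1.
  have : z != 0 by apply/eqP => z00; apply/k0/iv; exists v => //; rewrite zE z00.
  by lia.
- exact: continuous_abstract_DH.
- by move=> w bt bb Pw; exact: abstract_DH_lids.
Qed.
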